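(* Let $\mathcal V=V[h^{-1},h]$ be a vertex operator algebra with a formal parameter, $\mathcal F$ its rescaled complex of light modes with quasiclassical Lian–Zuckerman operations $\mu_0,m_0,n_0,\{\cdot,\cdot\}_0$. Let $\{s_i\}\subset V$ be a finite family of primary elements of conformal weight $1$ with $s_i(z)s_j(w)\sim0$ for all $i,j$, let $f_i=cs_i$, let $\eta=(\eta^{ij})$ be a constant matrix, and let $Q^\eta=Q+R_0^\eta$ with $R_0^\eta=\sum_{i,j}\eta^{ij}\mu_0(f_i,\{f_j,\cdot\}_0)$. Then there exist $\eta$-deformed multilinear maps $\mu_0^\eta$, $m_0^\eta$, $n_0^\eta$ on $\mathcal F$ (deformations of $\mu_0,m_0,n_0$, to which they reduce at $\eta=0$) such that: (i) together with $Q^\eta$ they satisfy the relations of a homotopy associative (and homotopy commutative) algebra; moreover $m_0^\eta=m_0$ and $n_0^\eta=n_0$; (ii) the homotopy associative algebra on $\mathcal F$ with the operations $Q^\eta,\mu_0^\eta,n_0^\eta$ is an $A_\infty$-algebra in which all multilinear operations vanish starting from the tetralinear one.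
   Context: **VOA with a formal parameter.** $V=\bigoplus_{n\ge 0}V^n$ is a graded complex vector space, $\mathcal V^n=V^n[h^{-1},h]$, and $\mathcal V=\bigoplus_{n\ge0}\mathcal V^n$ carries a VOA structure whose space of conformal weight $n$ is $\mathcal V^n$. A state $A$ has vertex operator $A(z)=\sum_n A_nz^{-n-1}$; the Virasoro field is $L(z)=\sum_n L_nz^{-n-2}$. Assumed: (i) all modes $A_n$ commute with $\mathbb C[h,h^{-1}]$; (ii) $A_nB\in hV[h]$ for $A,B\in V$, $n\ge0$; (iii) $L_{-1}V\subset V$; (iv) $L_1A\in hV$ for $A\in V^1$. $V[h]$ is a vertex algebra (closed under all products). Primary means highest weight vector for the Virasoro algebra; $s_i(z)s_j(w)\sim0$ means the operator product is regular. **Ghosts and BRST operator.** $\Lambda$ is the Fock module of $\{b_n,c_m\}=\delta_{n+m,0}$ with vacuum $\mathbf 1$, $c_k\mathbf 1=0$ for $k\ge2$, $b_k\mathbf 1=0$ for $k\ge-1$; $b(z)=\sum b_mz^{-m-2}$, $c(z)=\sum c_nz^{-n+1}$ (weights $2$ and $-1$). The ghost number $|a|$ counts $c$ with $+1$ and $b$ with $-1$. On $\mathcal V\otimes\Lambda$: $Q=\mathrm{Res}_z\big(c(z)L(z)+{:}c\,\partial c\,b{:}(z)+\tfrac32\partial^2c(z)\big)$. **The complex $\mathcal F$.** Writing states via their operators, $\mathcal F_0=V^0$, $\mathcal F_1=cV^1\oplus h\,\partial c\,V^0$, $\mathcal F_2=h\,c\,\partial c\,V^1\oplus h\,c\,\partial^2c\,V^0$,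 $\mathcal F_3=h^2c\,\partial c\,\partial^2c\,V^0$, graded by ghost number, preserved by $Q$. **Operations.** $\mu(a_1,a_2)=\mathrm{Res}_z\frac{a_1(z)a_2}{z}$, $\{a_1,a_2\}=(-1)^{|a_1|}\mathrm{Res}_z(b_{-1}a_1)(z)a_2$, $m(a_1,a_2)=\sum_{i\ge0}\frac{(-1)^i}{i+1}\mathrm{Res}_w\mathrm{Res}_{z-w}(z-w)^iw^{-i-1}b_{-1}(a_1(z-w)a_2)(w)\mathbf 1$, $n(a_1,a_2,a_3)=\sum_{i\ge0}\frac1{i+1}\mathrm{Res}_z\mathrm{Res}_w\,w^iz^{-i-1}(b_{-1}a_1)(z)a_2(w)a_3+(-1)^{|a_1||a_2|}\sum_{i\ge0}\frac1{i+1}\mathrm{Res}_w\mathrm{Res}_z\,z^iw^{-i-1}(b_{-1}a_2)(w)a_1(z)a_3$. On $\mathcal F$ these take values in $\mathcal F[h]$ (the bracket in $h\mathcal F[h]$), and $\mu=\mu_0+O(h)$, $m=m_0+O(h)$, $n=n_0+O(h)$, $\{\cdot,\cdot\}=h\{\cdot,\cdot\}_0+O(h^2)$ define the quasiclassical operations. **Homotopy associative and commutative algebra relations** for $(Q,\mu,m,n)$ of degrees $(1,0,-1,-1)$: $Q^2=0$; (a) $Q\mu(a_1,a_2)=\mu(Qa_1,a_2)+(-1)^{|a_1|}\mu(a_1,Qa_2)$; (b) $\mu(a_1,a_2)-(-1)^{|a_1||a_2|}\mu(a_2,a_1)=Qm(a_1,a_2)+m(Qa_1,a_2)+(-1)^{|a_1|}m(a_1,Qa_2)$;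 (c) $Qn(a_1,a_2,a_3)+n(Qa_1,a_2,a_3)+(-1)^{|a_1|}n(a_1,Qa_2,a_3)+(-1)^{|a_1|+|a_2|}n(a_1,a_2,Qa_3)=\mu(\mu(a_1,a_2),a_3)-\mu(a_1,\mu(a_2,a_3))$. **$A_\infty$-algebra with operations vanishing from the tetralinear one** ($\mu_1=Q,\mu_2=\mu,\mu_3=n$): $Q^2=0$, (a), (c), and (d) $(-1)^{|a_1|}\mu(a_1,n(a_2,a_3,a_4))+\mu(n(a_1,a_2,a_3),a_4)=n(\mu(a_1,a_2),a_3,a_4)-n(a_1,\mu(a_2,a_3),a_4)+n(a_1,a_2,\mu(a_3,a_4))$; (e) $n(n(a_1,a_2,a_3),a_4,a_5)+(-1)^{|a_1|}n(a_1,n(a_2,a_3,a_4),a_5)+(-1)^{|a_1|+|a_2|}n(a_1,a_2,n(a_3,a_4,a_5))=0$. *)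

(* Defs.v *)
From HB Require Import structures.
From mathcomp Require Import all_boot all_order all_algebra.
From mathcomp Require Import finmap complex.
From mathcomp Require Import boolp classical_sets functions cardinality.
From mathcomp Require Import fsbigop reals.

Set Implicit Arguments.
Unset Strict Implicit.
Unset Printing Implicit Defensive.

Import Order.TTheory GRing.Theory Num.Theory.
Local Open Scope classical_set_scope.
Local Open Scope ring_scope.

(* [fs I M], the finitely supported families I -> M, is the direct sum of
   copies of M indexed by I. *)

Section FinSupp.
Variables (K : fieldType) (I : choiceType) (M : lmodType K).

Definition fs_pred : {pred I -> M} :=
  [pred f : I -> M | `[< finite_set [set i | f i != 0] >]].

Record fs : Type := FS { fs_fun :> I -> M; _ : fs_fun \in fs_pred }.

HB.instance Definition _ := [isSub for fs_fun].
HB.instance Definition _ := [Choice of fs by <:].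

Lemma fs_pred_submod : submod_closed fs_pred.
Proof.
split=> [|k f g].
  apply/asboolP; rewrite (_ : [set _ | _] = set0) //.
  by apply/seteqP; split=> i //=; rewrite eqxx.
move=> /asboolP finf /asboolP fing; apply/asboolP.
apply: (@sub_finite_set _ _ ([set i | f i != 0] `|` [set i | g i != 0])).
  move=> i /= kfg0; case: (eqVneq (f i) 0) => [fi0|]; [right|by left].
  apply: contra_neq kfg0 => gi0.
  by change (k *: f i + g i = 0); rewrite fi0 gi0 scaler0 addr0.
by rewrite finite_setU.
Qed.

HB.instance Definition _ :=
  GRing.isSubmodClosed.Build K (I -> M) fs_pred fs_pred_submod.
HB.instance Definition _ := [SubChoice_isSubLmodule of fs by <:].

Lemma fsdelta_subproof (i : I) (v : M) :
  (fun j => if j == i then v else 0) \in fs_pred.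
Proof.
apply/asboolP; apply: (@sub_finite_set _ _ [set i]) => // j /=.
by case: (eqVneq j i) => // _; rewrite eqxx.
Qed.

Definition fsdelta (i : I) (v : M) : fs := FS (fsdelta_subproof i v).

End FinSupp.

(* The map on the direct sum whose restriction to the [i]-th summand is the
   additive map [g i]. *)
Definition fslift (K : fieldType) (I : choiceType) (M N : lmodType K)
    (g : I -> M -> N) (x : fs I M) : N :=
  \sum_(i \in [set: I]) g i (x i).

(* Binomial coefficient with integer upper entry (K of characteristic 0). *)
Definition gbin (K : fieldType) (m : int) (j : nat) : K :=
  (\prod_(i < j) (m%:~R - i%:R)) / j`!%:R.

(* [vprod a n b] is the n-th product a_n b, i.e. a(z) = \sum_n a_n z^(-n-1). *)
Record voa_data (K : fieldType) (A : lmodType K) := VOAData {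
  vprod : A -> int -> A -> A;
  vvac : A;
  vomega : A;
  vcharge : K }.

(* L(z) = \sum_n L_n z^(-n-2) is the field of the conformal vector. *)
Definition Lmode (K : fieldType) (A : lmodType K) (D : voa_data A)
    (n : int) (a : A) : A := vprod D (vomega D) (n + 1) a.

Definition is_subspace (K : fieldType) (A : lmodType K) (X : set A) : Prop :=
  X 0 /\ forall (k : K) u v, X u -> X v -> X (k *: u + v).

Record is_grading (K : fieldType) (A : lmodType K) (gr : nat -> set A) :
    Prop := IsGrading {
  gr_sub : forall n, is_subspace (gr n);
  gr_span : forall a, exists p (u : nat -> A),
    (forall n, gr n (u n)) /\ a = \sum_(n < p) u n;
  gr_free : forall p (u : nat -> A), (forall n, gr n (u n)) ->
    \sum_(n < p) u n = 0 -> forall n, (n < p)%N -> u n = 0 }.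

(* [gr n] is the space of conformal weight n.  [voa_jacobi] is the Jacobi
   (Borcherds) identity in components. *)
Record is_voa (K : fieldType) (A : lmodType K) (D : voa_data A)
    (gr : nat -> set A) : Prop := IsVOA {
  voa_linl : forall (k : K) a a' n b,
    vprod D (k *: a + a') n b = k *: vprod D a n b + vprod D a' n b;
  voa_linr : forall (k : K) a n b b',
    vprod D a n (k *: b + b') = k *: vprod D a n b + vprod D a n b';
  voa_trunc : forall a b, exists p : nat,
    forall n : int, p%:Z <= n -> vprod D a n b = 0;
  voa_vacuum : forall n b, vprod D (vvac D) n b = if n == -1 then b else 0;
  voa_creation : forall a, vprod D a (-1) (vvac D) = a /\
    forall n : int, 0 <= n -> vprod D a n (vvac D) = 0;
  voa_jacobi : forall a b c (k m n : int),
    \sum_(j \in [set: nat]) gbin K m j *: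
        vprod D (vprod D a (k + j%:Z) b) (m + n - j%:Z) c =
    \sum_(j \in [set: nat]) ((-1) ^+ j * gbin K k j) *:
        (vprod D a (m + k - j%:Z) (vprod D b (n + j%:Z) c)
         - (-1) ^ k *: vprod D b (n + k - j%:Z) (vprod D a (m + j%:Z) c));
  voa_translation : forall a n b,
    vprod D (Lmode D (-1) a) n b = - (n%:~R *: vprod D a (n - 1) b);
  voa_virasoro : forall (m n : int) a,
    Lmode D m (Lmode D n a) - Lmode D n (Lmode D m a) =
    (m - n)%:~R *: Lmode D (m + n) a
    + (if m + n == 0 then (m ^+ 3 - m)%:~R / 12 * vcharge D else 0) *: a;
  voa_grading : is_grading gr;
  voa_weight : forall n a, gr n a <-> Lmode D 0 a = n%:R *: a }.

Definition primary (K : fieldType) (A : lmodType K) (D : voa_data A)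
    (wt : K) (a : A) : Prop :=
  Lmode D 0 a = wt *: a /\ forall n : int, 0 < n -> Lmode D n a = 0.

Definition regular_ope (K : fieldType) (A : lmodType K) (D : voa_data A)
    (a b : A) : Prop := forall n : int, 0 <= n -> vprod D a n b = 0.

(* V[h^-1, h]: [A k] is the coefficient of h^k. *)
Definition laurent (K : fieldType) (V : lmodType K) : lmodType K := fs int V.

Section FormalParameter.
Variables (K : fieldType) (V : lmodType K) (Vgr : nat -> set V).

Definition laur (k : int) (v : V) : laurent V := fsdelta k v.

Definition hmul (k : int) (A : laurent V) : laurent V :=
  fslift (fun j v => laur (j + k) v) A.

Definition laurent_gr (n : nat) : set (laurent V) :=
  [set A | forall k, Vgr n (A k)].

(* h^p V[h] *)
Definition hpoly (p : int) : set (laurent V) :=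
  [set A | forall k : int, k < p -> A k = 0].

Record voa_formal_parameter (D : voa_data (laurent V)) : Prop :=
    VOAFormalParameter {
  fp_grading : is_grading Vgr;
  fp_voa : is_voa D laurent_gr;
  fp_central : forall A n k B, vprod D A n (hmul k B) = hmul k (vprod D A n B);
  fp_light : forall (u v : V) (n : int), 0 <= n ->
    hpoly 1 (vprod D (laur 0 u) n (laur 0 v));
  fp_translation : forall u : V, exists v, Lmode D (-1) (laur 0 u) = laur 0 v;
  fp_L1 : forall u : V, Vgr 1 u -> exists v, Lmode D 1 (laur 0 u) = laur 1 v;
  fp_Vh_vacuum : hpoly 0 (vvac D);
  fp_Vh_closed : forall A B n,
    hpoly 0 A -> hpoly 0 B -> hpoly 0 (vprod D A n B) }.

End FormalParameter.

(* Since {b_n, c_m} = delta_(n+m,0), each integer m labels one fermionic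
   oscillator, formed by the pair (c_m, b_-m).  The creation operator psi_m of
   this pair is c_m if m <= 1, and b_-m if m >= 2.  The basis vector indexed by
   the finite set S = {s_1 < ... < s_k} is psi_(s_1) ... psi_(s_k) vac. *)
Section Ghosts.
Variable K : fieldType.

Definition fock : lmodType K := fs {fset int} (K^o : lmodType K).

Definition fe (S : {fset int}) : fock := fsdelta S (1 : K^o).

Definition gvac : fock := fe fset0.

Definition fock_lift (g : {fset int} -> fock) (x : fock) : fock :=
  fslift (fun S (k : K^o) => (k : K) *: g S) x.

Definition fock_sign (m : int) (S : {fset int}) : K :=
  (-1) ^+ count (fun s => s < m) (enum_fset S).

Definition fcreate (m : int) : fock -> fock :=
  fock_lift (fun S =>
    if m \in S then 0 else fock_sign m S *: fe (m |` S)%fset).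

Definition fannih (m : int) : fock -> fock :=
  fock_lift (fun S =>
    if m \in S then fock_sign m S *: fe (S `\ m)%fset else 0).

Definition c_ (n : int) : fock -> fock :=
  if n <= 1 then fcreate n else fannih n.

Definition b_ (n : int) : fock -> fock :=
  if n <= -2 then fcreate (- n) else fannih (- n).

(* A field X(z) = \sum_n X_(n) z^(-n-1) is given by its modes n |-> X_(n).
   With the weights -1 of c and 2 of b, c_(n) = c_(n+2) and b_(n) = b_(n-1). *)
Definition field := int -> fock -> fock.
Definition c_field : field := fun n => c_ (n + 2).
Definition b_field : field := fun n => b_ (n - 1).

(* Modes of :u^(j)(z) X(z): for u odd, X of parity e, where u^(j) is the
   divided derivative u^(j)(z) = \partial^j u(z) / j!. *)
Definition normal_order (u : field) (j : nat) (e : bool) (X : field) : field :=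
  fun n x => \sum_(i \in [set: nat]) 'C(j + i, i)%:R *:
    (u (- 1 - j%:Z - i%:Z) (X (n + i%:Z) x)
     + (-1) ^+ (j + e) *: X (n - 1 - j%:Z - i%:Z) (u i%:Z x)).

(* Field of the state psi_(s_1) ... psi_(s_k) vac: c_m creates c^(1-m), and
   b_-m creates b^(m-2). *)
Fixpoint fock_field (l : seq int) : field :=
  if l is m :: l' then
    if m <= 1 then normal_order c_field `|1 - m|%N (odd (size l')) (fock_field l')
    else normal_order b_field `|m - 2|%N (odd (size l')) (fock_field l')
  else fun n x => if n == -1 then x else 0.

Definition fe_field (S : {fset int}) : field :=
  fock_field (sort <=%R (enum_fset S)).

(* The states of 1, c, \partial c, \partial^2 c and of their products. *)
Definition st_c : fock := c_ 1 gvac.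
Definition st_dc : fock := c_ 0 gvac.
Definition st_d2c : fock := 2 *: c_ (-1) gvac.
Definition st_cdc : fock := c_ 1 st_dc.
Definition st_cd2c : fock := c_ 1 st_d2c.
Definition st_cdcd2c : fock := c_ 1 (c_ 0 st_d2c).
Definition st_cdcb : fock := c_ 1 (c_ 0 (b_ (-2) gvac)).

End Ghosts.

(* A (x) fock, as the direct sum of copies of A indexed by the basis of the
   Fock module. *)
Definition gtens (K : fieldType) (A : lmodType K) : lmodType K :=
  fs {fset int} A.

Section LianZuckerman.
Variables (K : fieldType) (A : lmodType K) (D : voa_data A).

Definition tens (a : A) (x : fock K) : gtens A :=
  fslift (fun S (k : K^o) => fsdelta S ((k : K) *: a) : gtens A) x.

Definition ghost_op (g : fock K -> fock K) (x : gtens A) : gtens A :=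
  fslift (fun S a => tens a (g (fe K S))) x.

(* Homogeneous component of parity e for the ghost number modulo 2; this is
   the parity of #|S| on the basis vector indexed by S. *)
Definition gpart (e : bool) (x : gtens A) : gtens A :=
  fslift (fun (S : {fset int}) a => if odd #|` S| == e then fsdelta S a : gtens A else 0) x.

(* n-th product of the tensor product vertex superalgebra; A is purely even:
   (a (x) alpha)_n (b (x) beta) = \sum_k a_k b (x) alpha_(n-1-k) beta. *)
Definition wprod (x : gtens A) (n : int) (y : gtens A) : gtens A :=
  fslift (fun S a => fslift (fun T b =>
    \sum_(k \in [set: int])
       tens (vprod D a k b) (fe_field S (n - 1 - k) (fe K T))) y) x.

Definition wvac : gtens A := tens (vvac D) (gvac K).

(* The residue of a field is its mode of index 0. *)
Definition brst_state : gtens A :=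
  tens (vomega D) (st_c K)
  + tens (vvac D) (st_cdcb K + (3%:R / 2%:R) *: st_d2c K).
Definition brst (x : gtens A) : gtens A := wprod brst_state 0 x.

Definition bm1 : gtens A -> gtens A := ghost_op (@b_ K (-1)).

(* Below Res_z z^p a(z) = a_p for every integer p. *)
Definition lz_mu (x y : gtens A) : gtens A := wprod x (-1) y.

Definition lz_bracket (x y : gtens A) : gtens A :=
  \sum_(e : bool) (-1) ^+ e *: wprod (bm1 (gpart e x)) 0 y.

Definition lz_m (x y : gtens A) : gtens A :=
  \sum_(i \in [set: nat]) ((-1) ^+ i / i.+1%:R) *:
     bm1 (wprod (wprod x i%:Z y) (- i%:Z - 1) wvac).

Definition lz_n (x y z : gtens A) : gtens A :=
  \sum_(i \in [set: nat]) i.+1%:R^-1 *: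
     wprod (bm1 x) (- i%:Z - 1) (wprod y i%:Z z)
  + \sum_(e : bool) \sum_(e' : bool) (-1) ^+ (e && e') *:
    \sum_(i \in [set: nat]) i.+1%:R^-1 *:
     wprod (bm1 (gpart e' y)) (- i%:Z - 1) (wprod (gpart e x) i%:Z z).

End LianZuckerman.

Section LightModes.
Variables (K : fieldType) (V : lmodType K) (Vgr : nat -> set V).
Variable D : voa_data (laurent V).

Local Notation W := (gtens (laurent V)).

Definition st (k : int) (v : V) (x : fock K) : W := tens (laur k v) x.

(* The component of ghost number g of the complex. *)
Definition Fdeg (g : int) : set W :=
  match g with
  | Posz 0 => [set st 0 u (gvac K) | u in Vgr 0]
  | Posz 1 => [set st 0 a (st_c K) + st 1 u (st_dc K) | a in Vgr 1 & u in Vgr 0]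
  | Posz 2 =>
      [set st 1 a (st_cdc K) + st 1 u (st_cd2c K) | a in Vgr 1 & u in Vgr 0]
  | Posz 3 => [set st 2 u (st_cdcd2c K) | u in Vgr 0]
  | _ => [set 0]
  end.

Definition Flight : set W :=
  [set x | exists y : nat -> W,
    (forall g, Fdeg g%:Z (y g)) /\ x = \sum_(g < 4) y g].

Definition hmulW (k : int) (x : W) : W :=
  fslift (fun S a => fsdelta S (hmul k a) : W) x.

(* h^k F[h] *)
Definition Fpoly (k : int) : set W :=
  [set x | exists p (y : nat -> W),
    (forall i, Flight (y i)) /\ x = \sum_(i < p) hmulW (k + i%:Z) (y i)].

(* The f in F such that x = h^k f + O(h^(k+1)), where O(h^p) stands for an
   element of h^p F[h]; it is unique, and exists when x is in h^k F[h]. *)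
Definition lead (k : int) (x : W) : W :=
  xget 0 [set f | Flight f /\ Fpoly (k + 1) (x - hmulW k f)].

Definition mu0 (x y : W) : W := lead 0 (lz_mu D x y).
Definition m0 (x y : W) : W := lead 0 (lz_m D x y).
Definition n0 (x y z : W) : W := lead 0 (lz_n D x y z).
Definition bracket0 (x y : W) : W := lead 1 (lz_bracket D x y).

(* Q + R_0^eta, with f_i = c s_i *)
Definition brst_eta (N : nat) (s : 'I_N -> V) (eta : 'M[K]_N) (x : W) : W :=
  brst D x + \sum_i \sum_j eta i j *:
    mu0 (st 0 (s i) (st_c K)) (bracket0 (st 0 (s j) (st_c K)) x).

End LightModes.

(* [G g] is the component of degree g of the graded subspace [X] of W.  The
   operations are maps on W of which only the restrictions to X matter. *)

Section HomotopyAlgebras.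
Variables (K : fieldType) (W : lmodType K) (G : int -> set W) (X : set W).
Variables (Q : W -> W) (mu m : W -> W -> W) (n : W -> W -> W -> W).

Let sg (k : int) : K := (-1) ^ k.

Definition operation1 (d : int) (f : W -> W) : Prop :=
  (forall (k : K) x x', X x -> X x' -> f (k *: x + x') = k *: f x + f x') /\
  (forall g x, G g x -> G (g + d) (f x)).

Definition operation2 (d : int) (f : W -> W -> W) : Prop :=
  [/\ forall (k : K) x x' y, X x -> X x' -> X y ->
        f (k *: x + x') y = k *: f x y + f x' y,
      forall (k : K) x y y', X x -> X y -> X y' ->
        f x (k *: y + y') = k *: f x y + f x y' &
      forall g g' x y, G g x -> G g' y -> G (g + g' + d) (f x y)].

Definition operation3 (d : int) (f : W -> W -> W -> W) : Prop :=
  [/\ forall (k : K) x x' y z, X x -> X x' -> X y -> X z ->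
        f (k *: x + x') y z = k *: f x y z + f x' y z,
      forall (k : K) x y y' z, X x -> X y -> X y' -> X z ->
        f x (k *: y + y') z = k *: f x y z + f x y' z,
      forall (k : K) x y z z', X x -> X y -> X z -> X z' ->
        f x y (k *: z + z') = k *: f x y z + f x y z' &
      forall g g' g'' x y z, G g x -> G g' y -> G g'' z ->
        G (g + g' + g'' + d) (f x y z)].

Definition rel_nilpotent : Prop := forall g a, G g a -> Q (Q a) = 0.

Definition rel_leibniz : Prop := forall g1 g2 a1 a2, G g1 a1 -> G g2 a2 ->
  Q (mu a1 a2) = mu (Q a1) a2 + sg g1 *: mu a1 (Q a2).

Definition rel_comm : Prop := forall g1 g2 a1 a2, G g1 a1 -> G g2 a2 ->
  mu a1 a2 - sg (g1 * g2) *: mu a2 a1 =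
  Q (m a1 a2) + m (Q a1) a2 + sg g1 *: m a1 (Q a2).

Definition rel_assoc : Prop := forall g1 g2 g3 a1 a2 a3,
  G g1 a1 -> G g2 a2 -> G g3 a3 ->
  Q (n a1 a2 a3) + n (Q a1) a2 a3 + sg g1 *: n a1 (Q a2) a3
    + sg (g1 + g2) *: n a1 a2 (Q a3) =
  mu (mu a1 a2) a3 - mu a1 (mu a2 a3).

Definition rel_pentagon : Prop := forall g1 g2 g3 g4 a1 a2 a3 a4,
  G g1 a1 -> G g2 a2 -> G g3 a3 -> G g4 a4 ->
  sg g1 *: mu a1 (n a2 a3 a4) + mu (n a1 a2 a3) a4 =
  n (mu a1 a2) a3 a4 - n a1 (mu a2 a3) a4 + n a1 a2 (mu a3 a4).

Definition rel_nn : Prop := forall g1 g2 g3 g4 g5 a1 a2 a3 a4 a5,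
  G g1 a1 -> G g2 a2 -> G g3 a3 -> G g4 a4 -> G g5 a5 ->
  n (n a1 a2 a3) a4 a5 + sg g1 *: n a1 (n a2 a3 a4) a5
    + sg (g1 + g2) *: n a1 a2 (n a3 a4 a5) = 0.

Record homotopy_assoc_comm : Prop := HomotopyAssocComm {
  hac_Q : operation1 1 Q;
  hac_mu : operation2 0 mu;
  hac_m : operation2 (-1) m;
  hac_n : operation3 (-1) n;
  hac_nilpotent : rel_nilpotent;
  hac_leibniz : rel_leibniz;
  hac_comm : rel_comm;
  hac_assoc : rel_assoc }.

(* A_infinity-algebra with vanishing k-linear operations for k >= 4 *)
Record ainfty3 : Prop := AInfty3 {
  ai_Q : operation1 1 Q;
  ai_mu : operation2 0 mu;
  ai_n : operation3 (-1) n;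
  ai_nilpotent : rel_nilpotent;
  ai_leibniz : rel_leibniz;
  ai_assoc : rel_assoc;
  ai_pentagon : rel_pentagon;
  ai_nn : rel_nn }.

End HomotopyAlgebras.

(* A deformation depends polynomially on the entries of eta and is equal to the
   given operation at eta = 0. *)

Definition polynomial_in (K : fieldType) (W : lmodType K) (N : nat)
    (g : 'M[K]_N -> W) : Prop :=
  exists d (w : {ffun 'I_N * 'I_N -> 'I_d.+1} -> W), forall eta,
    g eta = \sum_(alpha : {ffun 'I_N * 'I_N -> 'I_d.+1})
      (\prod_ij eta ij.1 ij.2 ^+ alpha ij) *: w alpha.

Definition deformation2 (K : fieldType) (W : lmodType K) (X : set W) (N : nat)
    (f : W -> W -> W) (fd : 'M[K]_N -> W -> W -> W) : Prop :=
  forall x y, X x -> X y ->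
    polynomial_in (fun eta => fd eta x y) /\ fd 0 x y = f x y.

Definition deformation3 (K : fieldType) (W : lmodType K) (X : set W) (N : nat)
    (f : W -> W -> W -> W) (fd : 'M[K]_N -> W -> W -> W -> W) : Prop :=
  forall x y z, X x -> X y -> X z ->
    polynomial_in (fun eta => fd eta x y z) /\ fd 0 x y z = f x y z.

(* Main.v *)
(* A state of the complex is a sextuple of elements of V^0 and V^1, the
   coefficients of 1, c, dc, c dc, c d^2c and c dc d^2c.  By conformal weights
   the Lian-Zuckerman operations on such states involve only the products
   a_(-1) b, a_0 b and a_1 b, and their leading coefficients in h make
   V^0 + V^1 a Courant algebroid with a divergence, in terms of which Q, mu_0,
   m_0 and n_0 are given by universal formulas.  All the relations then follow
   from a Courant algebroid structure "up to the Jacobi identity", where the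
   operators Delta measuring the failure of div d = 0 may be nonzero.
   Q + R_0^eta is the differential of the structure obtained from eta by
   correcting the anchor, the bracket, d and div, and by the Laplacian
   Delta = eta^ij s_i s_j; the pairing and the module structure are unchanged,
   hence so are m_0 and n_0.  In the axioms of the corrected structure the terms
   quadratic in eta cancel by the symmetry exchanging the two factors of eta,
   because the s_i commute and are isotropic. *)

Require Import Defs.
From HB Require Import structures.
From mathcomp Require Import all_boot all_order all_algebra.
From mathcomp Require Import finmap complex ring zify.
From mathcomp Require Import boolp classical_sets functions cardinality.
From mathcomp Require Import fsbigop reals.

Set Implicit Arguments.
Unset Strict Implicit.
Unset Printing Implicit Defensive.

Import Order.TTheory GRing.Theory Num.Theory.
Local Open Scope ring_scope.

(** * Linear identities in a module by reflection *)

(** The axioms are dictated by the relations on sextuples. Q^2 = 0 means div d = -2 Delta and that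
    Delta commutes with d and div; the Leibniz rule of Q calls for product rules of Delta and div.
    An iterated bracket never arises in the relations: three factors of ghost number one multiply
    into ghost number three, which has only a V^0 part. The corrections of d and div are read off
    from R_0^eta. The anchor is then forced by <du, a> = a(u), and the symmetric part of the bracket
    by [a, b] + [b, a] = d<a, b>. Ghost products are a matter of computation because light states
    contain no b: on them c(z) has no pole, normal ordering reduces to multiplication of power
    series, and conformal weights leave finitely many modes. The field b enters only through b_-1
    and the BRST current. A product of nonnegative index gains a factor h, and the powers of h in
    the complex match this gain component by component. Orders in h are therefore followed
    separately in each component, and the terms of too high order are those absent from the
    classical formulas. *)

Section LinearExpressions.
Variables (K : fieldType) (M : lmodType K).

Inductive lexp : Type :=
| LVar of nat
| LZero
| LAdd of lexp & lexp
| LOpp of lexp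
| LScale of K & lexp.

Fixpoint leval (env : seq M) (e : lexp) : M :=
  match e with
  | LVar i => nth 0 env i
  | LZero => 0
  | LAdd e1 e2 => leval env e1 + leval env e2
  | LOpp e1 => - leval env e1
  | LScale k e1 => k *: leval env e1
  end.

(** The index test is [eqn], which [cbn] reduces on numerals; what is left for each atom is one
    equation between scalars, fit for [ring] or [field]. *)
Fixpoint lcoef (e : lexp) (i : nat) : K :=
  match e with
  | LVar j => if eqn i j then 1 else 0
  | LZero => 0
  | LAdd e1 e2 => lcoef e1 i + lcoef e2 i
  | LOpp e1 => - lcoef e1 i
  | LScale k e1 => k * lcoef e1 i
  end.

Fixpoint lsame (e1 e2 : lexp) (n : nat) : Prop :=
  if n is m.+1 then lcoef e1 m = lcoef e2 m /\ lsame e1 e2 m else True.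

Lemma leval_coef env e :
  leval env e = \sum_(i < size env) lcoef e i *: nth 0 env i.
Proof.
elim: e => [j||e1 IH1 e2 IH2|e IH|k e IH] /=.
- transitivity (\sum_(i < size env) (if i == j :> nat then 1 else 0) *: nth 0 env i).
    case: (ltnP j (size env)) => [jlt|jge].
      rewrite (bigD1 (Ordinal jlt)) //= eqxx scale1r big1 ?addr0 // => i.
      by rewrite -val_eqE /= => /negPf ->; rewrite scale0r.
    rewrite nth_default // big1 // => i _; case: eqP => [ij|_]; last by rewrite scale0r.
    by move: (ltn_ord i); rewrite ij ltnNge jge.
  by [].
- by rewrite big1 // => i _; rewrite scale0r.
- by rewrite IH1 IH2 -big_split; apply: eq_bigr => i _; rewrite scalerDl.
- by rewrite IH -sumrN; apply: eq_bigr => i _; rewrite scaleNr.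
- by rewrite IH scaler_sumr; apply: eq_bigr => i _; rewrite scalerA.
Qed.

Lemma leval_eq env e1 e2 : lsame e1 e2 (size env) -> leval env e1 = leval env e2.
Proof.
rewrite !leval_coef => same; apply: eq_bigr => i _; congr (_ *: _).
elim: (size env) i same => [|n IH] [i i_lt] //= [en en'].
move: i_lt; rewrite ltnS leq_eqVlt => /orP[/eqP -> //|i_lt].
exact: (IH (Ordinal i_lt)).
Qed.

End LinearExpressions.

Ltac lmod_mem x env :=
  lazymatch env with
  | nil => constr:(false)
  | cons ?y ?env' =>
      let b := match constr:(Set) with
               | _ => let _ := match constr:(Set) with _ => constr_eq x y end in
                      constr:(true)
               | _ => constr:(false) end in
      lazymatch b with true => constr:(true) | _ => lmod_mem x env' end
  end.

Ltac lmod_idx x env :=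
  lazymatch env with
  | cons ?y ?env' =>
      match constr:(Set) with
      | _ => let _ := match constr:(Set) with _ => constr_eq x y end in
             constr:(O)
      | _ => let i := lmod_idx x env' in constr:(S i)
      end
  end.

Ltac lmod_atoms e env :=
  lazymatch e with
  | GRing.add ?a ?b => let env := lmod_atoms a env in lmod_atoms b env
  | GRing.opp ?a => lmod_atoms a env
  | GRing.scale _ ?a => lmod_atoms a env
  | GRing.zero => env
  | _ => let b := lmod_mem e env in
         lazymatch b with true => env | _ => constr:(cons e env) end
  end.

Ltac lmod_reify K e env :=
  lazymatch e with
  | GRing.add ?a ?b =>
      let x := lmod_reify K a env in let y := lmod_reify K b env in
      constr:(@LAdd K x y)
  | GRing.opp ?a => let x := lmod_reify K a env in constr:(@LOpp K x)
  | GRing.scale ?k ?a => let x := lmod_reify K a env in constr:(@LScale K k x)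
  | GRing.zero => constr:(@LZero K)
  | _ => let i := lmod_idx e env in constr:(@LVar K i)
  end.

(** Atoms are compared syntactically, so equal vectors must first be rewritten into the same
    form. *)
Ltac lmod_with K tac :=
  lazymatch goal with
  | |- ?a = ?b =>
      let T := type of a in
      let env := lmod_atoms a (@nil T) in
      let env := lmod_atoms b env in
      let x := lmod_reify K a env in
      let y := lmod_reify K b env in
      refine (@leval_eq K _ env x y _);
      cbn [lsame lcoef eqn size]; repeat split; tac
  end.

Definition lin (K : fieldType) (U V : lmodType K) (f : U -> V) : Prop :=
  forall k x y, f (k *: x + y) = k *: f x + f y.

Definition bilin (K : fieldType) (U V W : lmodType K) (f : U -> V -> W) : Prop :=
  (forall y, lin (f^~ y)) /\ (forall x, lin (f x)).

Lemma linE (K : fieldType) (U V : lmodType K) (f : U -> V) : lin f ->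
  ((forall x y, (f (x + y) = f x + f y)%R) * (f 0 = 0) *
   (forall x, (f (- x) = - f x)%R) * (forall k x, (f (k *: x) = k *: f x)%R))%type.
Proof.
move=> fl; have f0 : f 0 = 0.
  by have := fl (-1) 0 0; rewrite scaler0 addr0 scaleN1r addNr.
have fD x y : f (x + y) = f x + f y by have := fl 1 x y; rewrite !scale1r.
have fZ k x : f (k *: x) = k *: f x by have := fl k x 0; rewrite f0 !addr0.
by do !split=> //; move=> x; rewrite -scaleN1r fZ scaleN1r.
Qed.

Lemma bilE (K : fieldType) (U V W : lmodType K) (f : U -> V -> W) : bilin f ->
  ((forall x y z, (f (x + y) z = f x z + f y z)%R) *
   (forall x y z, (f x (y + z) = f x y + f x z)%R) *
   (forall z, f 0 z = 0) * (forall z, f z 0 = 0) *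
   (forall x z, (f (- x) z = - f x z)%R) * (forall x z, (f x (- z) = - f x z)%R) *
   (forall k x z, (f (k *: x) z = k *: f x z)%R) *
   (forall k x z, (f x (k *: z) = k *: f x z)%R))%type.
Proof.
case=> fl fr.
have L z := linE (fl z); have R z := linE (fr z).
do !split=> *.
- exact: (L _).1.1.1.
- exact: (R _).1.1.1.
- exact: (L _).1.1.2.
- exact: (R _).1.1.2.
- exact: (L _).1.2.
- exact: (R _).1.2.
- exact: (L _).2.
- exact: (R _).2.
Qed.

Lemma lin_sum (K : fieldType) (U V : lmodType K) (f : U -> V) : lin f ->
  forall (I : Type) (r : seq I) (P : pred I) (F : I -> U),
  f (\sum_(i <- r | P i) F i) = \sum_(i <- r | P i) f (F i).
Proof.
by move=> /linE fE I r P F; apply: (big_morph f) => [x y|]; rewrite !fE.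
Qed.

(** * Courant-type structures and their six-term complexes *)

(* Module structure, anchor, bracket, pairing, differential and divergence. *)
Record courant_data (K : fieldType) (V0 V1 : lmodType K) := CourantData {
  mul : V0 -> V0 -> V0;
  act : V0 -> V1 -> V1;
  anc : V1 -> V0 -> V0;
  brk : V1 -> V1 -> V1;
  prg : V1 -> V1 -> V0;
  dd : V0 -> V1;
  dv : V1 -> V0;
  lap0 : V0 -> V0;
  lap1 : V1 -> V1 }.

(* A Courant algebroid up to the Jacobi identity, with a divergence operator.
   The operators [lap0] and [lap1] measure the failure of [dv \o dd = 0]; they
   vanish for the structure carried by light modes and become nonzero under the
   deformation. *)
Record is_courant (K : fieldType) (V0 V1 : lmodType K) (C : courant_data V0 V1) :
    Prop := IsCourant {
  mul_bil : bilin (mul C);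
  act_bil : bilin (act C);
  anc_bil : bilin (anc C);
  brk_bil : bilin (brk C);
  prg_bil : bilin (prg C);
  dd_lin : lin (dd C);
  dv_lin : lin (dv C);
  lap0_lin : lin (lap0 C);
  lap1_lin : lin (lap1 C);
  mulC : forall u v, mul C u v = mul C v u;
  mulA : forall u v w, mul C (mul C u v) w = mul C u (mul C v w);
  actA : forall u v a, act C (mul C u v) a = act C u (act C v a);
  prgC : forall a b, prg C a b = prg C b a;
  prg_act : forall u a b, prg C (act C u a) b = mul C u (prg C a b);
  anc_mul : forall a u v,
    anc C a (mul C u v) = mul C (anc C a u) v + mul C u (anc C a v);
  anc_act : forall u a v, anc C (act C u a) v = mul C u (anc C a v);
  dd_mul : forall u v, dd C (mul C u v) = act C u (dd C v) + act C v (dd C u);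
  prg_dd : forall u a, prg C (dd C u) a = anc C a u;
  brk_act : forall u a b, brk C (act C u a) b =
    act C u (brk C a b) + act C (prg C a b) (dd C u) - act C (anc C b u) a;
  brkC : forall a b, brk C a b + brk C b a = dd C (prg C a b);
  anc_prg : forall b a c,
    anc C b (prg C a c) = prg C (brk C b a) c + prg C a (brk C b c);
  lap_dd : forall u, lap1 C (dd C u) = dd C (lap0 C u);
  dv_dd : forall u, dv C (dd C u) = - (2 *: lap0 C u);
  dv_lap : forall a, dv C (lap1 C a) = lap0 C (dv C a);
  lap_mul : forall u v, lap0 C (mul C u v) =
    mul C u (lap0 C v) + mul C v (lap0 C u) - anc C (dd C u) v;
  lap_act : forall u a, lap1 C (act C u a) =
    act C u (lap1 C a) + act C (lap0 C u) a - brk C (dd C u) a;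
  dv_act : forall u a, dv C (act C u a) = mul C u (dv C a) + anc C a u;
  dv_brk : forall a b, dv C (brk C a b) =
    anc C a (dv C b) - anc C b (dv C a) - prg C (lap1 C a) b + prg C a (lap1 C b)
    - lap0 C (prg C a b) }.

(** An ordering is imposed only where both [f x y] and [f y x] occur; this is enough to make the
    atoms of the two sides coincide, and it terminates. *)
Ltac comm_norm f fC :=
  repeat match goal with
  |- context [f ?x ?y] =>
    match goal with |- context [f y x] =>
      tryif constr_eq x y then fail else rewrite (fC x y) end
  end.
Ltac commA_norm f fCA :=
  repeat match goal with
  |- context [f ?x (f ?y ?z)] =>
    match goal with |- context [f y (f x z)] =>
      tryif constr_eq x y then fail else rewrite (fCA x y z) end
  end.

Section SixTerm.
Variables (K : fieldType) (V0 V1 : lmodType K).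

Definition six : lmodType K := (V0 * V1 * V0 * V1 * V0 * V0)%type.

(* The coefficients of 1, c, h dc, h c dc, h c d^2c and h^2 c dc d^2c. *)
Definition mk6 (x0 : V0) (x1 : V1) (y1 : V0) (x2 : V1) (y2 x3 : V0) : six :=
  (x0, x1, y1, x2, y2, x3).

Lemma six_mk (P : six -> Prop) :
  (forall x0 x1 y1 x2 y2 x3, P (mk6 x0 x1 y1 x2 y2 x3)) -> forall x, P x.
Proof. by move=> H [[[[[]]]]]. Qed.

Lemma mk6D x0 x1 y1 x2 y2 x3 x0' x1' y1' x2' y2' x3' :
  mk6 x0 x1 y1 x2 y2 x3 + mk6 x0' x1' y1' x2' y2' x3' =
  mk6 (x0 + x0') (x1 + x1') (y1 + y1') (x2 + x2') (y2 + y2') (x3 + x3').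
Proof. by []. Qed.

Lemma mk6N x0 x1 y1 x2 y2 x3 : - mk6 x0 x1 y1 x2 y2 x3 =
  mk6 (- x0) (- x1) (- y1) (- x2) (- y2) (- x3).
Proof. by []. Qed.

Lemma mk6Z k x0 x1 y1 x2 y2 x3 : k *: mk6 x0 x1 y1 x2 y2 x3 =
  mk6 (k *: x0) (k *: x1) (k *: y1) (k *: x2) (k *: y2) (k *: x3).
Proof. by []. Qed.

Lemma mk60 : 0 = mk6 0 0 0 0 0 0.
Proof. by []. Qed.

Lemma mk6_eq x0 x1 y1 x2 y2 x3 x0' x1' y1' x2' y2' x3' :
  x0 = x0' -> x1 = x1' -> y1 = y1' -> x2 = x2' -> y2 = y2' -> x3 = x3' ->
  mk6 x0 x1 y1 x2 y2 x3 = mk6 x0' x1' y1' x2' y2' x3'.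
Proof. by move=> -> -> -> -> -> ->. Qed.

Definition six0 (x : six) : V0 := x.1.1.1.1.1.
Definition six1 (x : six) : V1 := x.1.1.1.1.2.
Definition six1' (x : six) : V0 := x.1.1.1.2.
Definition six2 (x : six) : V1 := x.1.1.2.
Definition six2' (x : six) : V0 := x.1.2.
Definition six3 (x : six) : V0 := x.2.

Lemma mk6E x0 x1 y1 x2 y2 x3 : let x := mk6 x0 x1 y1 x2 y2 x3 in
  ((six0 x = x0) * (six1 x = x1) * (six1' x = y1) * (six2 x = x2)
   * (six2' x = y2) * (six3 x = x3))%type.
Proof. by []. Qed.

(* Multiplication by (-1)^g in degree g: with it the graded relations become
   identities between arbitrary sextuples. *)
Definition tau6 (x : six) : six :=
  mk6 (six0 x) (- six1 x) (- six1' x) (six2 x) (six2' x) (- six3 x).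

Definition deg6 (g : int) (x : six) : Prop :=
  [/\ g != 0 -> six0 x = 0,
      g != 1 -> six1 x = 0 /\ six1' x = 0,
      g != 2 -> six2 x = 0 /\ six2' x = 0 &
      g != 3 -> six3 x = 0].

Variable C : courant_data V0 V1.
Local Notation "u ** v" := (mul C u v) (at level 40, left associativity).
Local Notation "u *> a" := (act C u a) (at level 40).

(** The BRST operator: [dd] and [dv] stand for L_-1 and the leading part of L_1, and 2^-1 is the
    coefficient of \partial^2 c in the Taylor expansion of c. The Laplacians are second order terms
    of the kind that R_0^eta adds. *)
Definition Q6 (x : six) : six :=
  mk6 0 (dd C (six0 x)) (- lap0 C (six0 x))
    (dd C (six1' x) + lap1 C (six1 x)) (six1' x - 2^-1 *: dv C (six1 x))
    (2^-1 *: dv C (six2 x) + lap0 C (six2' x)).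

Definition mu6 (x y : six) : six :=
  mk6 (six0 x ** six0 y)
    (six0 x *> six1 y + six0 y *> six1 x)
    (six0 x ** six1' y + six0 y ** six1' x + anc C (six1 x) (six0 y))
    (six0 x *> six2 y + six0 y *> six2 x - brk C (six1 x) (six1 y)
       + six1' y *> six1 x - six1' x *> six1 y)
    (six0 x ** six2' y + six0 y ** six2' x - 2^-1 *: prg C (six1 x) (six1 y))
    (six0 x ** six3 y + six0 y ** six3 x
       + (2^-1 *: prg C (six1 x) (six2 y) - anc C (six1 x) (six2' y)
          - six1' x ** six2' y)
       + (2^-1 *: prg C (six1 y) (six2 x) - anc C (six1 y) (six2' x)
          - six1' y ** six2' x)).

Definition m6 (x y : six) : six := mk6 0 0 (- prg C (six1 x) (six1 y)) 0 0 0.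

Definition n6 (x y z : six) : six :=
  mk6 0 0 0
    (prg C (six1 x) (six1 z) *> six1 y - prg C (six1 y) (six1 z) *> six1 x) 0
    (- (prg C (six1 y) (six1 z) ** six2' x) - prg C (six1 x) (six1 z) ** six2' y).

Hypothesis two : 2 != 0 :> K.
Hypothesis HC : is_courant C.

Let linE6 := (bilE (mul_bil HC), bilE (act_bil HC), bilE (anc_bil HC),
  bilE (brk_bil HC), bilE (prg_bil HC), linE (dd_lin HC), linE (dv_lin HC),
  linE (lap0_lin HC), linE (lap1_lin HC)).
Let axE6 := (mulA HC, actA HC, prg_act HC, anc_mul HC, anc_act HC, dd_mul HC,
  prg_dd HC, brk_act HC, lap_dd HC, dv_dd HC, dv_lap HC, lap_mul HC, lap_act HC,
  dv_act HC, dv_brk HC).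

(** On ghost number 0 the two components are [lap_dd] and [dv_dd]; on ghost number 1 the only
    component is [dv_lap] combined with [dv_dd]. *)
Lemma Q6_Q6 x : Q6 (Q6 x) = 0.
Proof.
move: x; apply: six_mk => x0 x1 y1 x2 y2 x3; rewrite /Q6 /= mk60.
rewrite /six0 /six1 /six1' /six2 /six2' /six3 /=.
apply: mk6_eq; rewrite ?linE6 ?axE6 ?linE6; do ?[by []].
all: lmod_with K ltac:(first [ring | field => //]).
Qed.

Lemma mulCA u v w : u ** (v ** w) = v ** (u ** w).
Proof. by rewrite -!(mulA HC) (mulC HC u). Qed.
Lemma actCA u v a : u *> (v *> a) = v *> (u *> a).
Proof. by rewrite -!(actA HC) (mulC HC u). Qed.
Lemma prg_actr u a b : prg C a (u *> b) = u ** prg C a b.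
Proof. by rewrite (prgC HC) (prg_act HC) (prgC HC). Qed.
(** [brk_act] treats the first argument; [brkC] carries it over to the second, where the term with
    [dd] is absorbed by the symmetric part. *)
Lemma brk_actr u a b : brk C a (u *> b) = u *> brk C a b + anc C a u *> b.
Proof.
apply: (addIr (brk C (u *> b) a)); rewrite (brkC HC) prg_actr (brk_act HC) (dd_mul HC).
rewrite (prgC HC b a) -(brkC HC a b) !linE6.
lmod_with K ltac:(first [ring | by field]).
Qed.
Lemma prg_ddr u a : prg C a (dd C u) = anc C a u.
Proof. by rewrite (prgC HC) (prg_dd HC). Qed.
Lemma brk_ddr u a : brk C a (dd C u) = dd C (anc C a u) - brk C (dd C u) a.
Proof. by rewrite -prg_ddr -(brkC HC) addrK. Qed.

Local Ltac six_unfold :=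
  rewrite /Q6 /mu6 /n6 /m6 /tau6 /six0 /six1 /six1' /six2 /six2' /six3 /= ?(mk6D, mk6N, mk6Z) /=.
Local Ltac six_norm :=
  rewrite ?linE6 ?axE6 ?prg_actr ?brk_actr ?prg_ddr ?brk_ddr ?linE6 ?axE6 ?linE6;
  comm_norm (prg C) (prgC HC); comm_norm (mul C) (mulC HC);
  commA_norm (mul C) mulCA; commA_norm (act C) actCA.
Local Ltac six_solve := six_norm;
  lmod_with K ltac:(first [ring | by field]).

(** For two elements of V^1 the component of ghost number three is [dv_brk]; this is the origin of
    the Laplacian terms in that axiom. *)
Lemma mu6_leibniz x y : Q6 (mu6 x y) = mu6 (Q6 x) y + mu6 (tau6 x) (Q6 y).
Proof.
move: x; apply: six_mk => x0 x1 y1 x2 y2 x3; move: y; apply: six_mk => u0 u1 v1 u2 v2 u3.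
six_unfold.
apply: mk6_eq.
all: by six_solve.
Qed.

Lemma n6_assoc x y z :
  Q6 (n6 x y z) + n6 (Q6 x) y z + n6 (tau6 x) (Q6 y) z + n6 (tau6 x) (tau6 y) (Q6 z)
  = mu6 (mu6 x y) z - mu6 x (mu6 y z).
Proof.
move: x; apply: six_mk => x0 x1 y1 x2 y2 x3; move: y; apply: six_mk => u0 u1 v1 u2 v2 u3.
move: z; apply: six_mk => z0 z1 w1 z2 w2 z3.
six_unfold.
apply: mk6_eq.
all: do ?[by six_solve].
(* Left is the component c dc d^2c, where the divergence of [n6] differentiates pairings of the
   three V^1 entries. Invariance of the pairing expands them, and the two orders of the bracket are
   then reduced to one. *)
have flip a b : brk C a b = dd C (prg C a b) - brk C b a by rewrite -(brkC HC) addrK.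
six_norm; rewrite (anc_prg HC u1) (anc_prg HC x1) (flip u1 x1).
by six_solve.
Qed.

Lemma n6_pentagon x y z t :
  mu6 (tau6 x) (n6 y z t) + mu6 (n6 x y z) t
  = n6 (mu6 x y) z t - n6 x (mu6 y z) t + n6 x y (mu6 z t).
Proof.
move: x; apply: six_mk => x0 x1 y1 x2 y2 x3; move: y; apply: six_mk => u0 u1 v1 u2 v2 u3.
move: z; apply: six_mk => z0 z1 w1 z2 w2 z3; move: t; apply: six_mk => t0 t1 s1 t2 s2 t3.
six_unfold.
apply: mk6_eq.
all: by six_solve.
Qed.

(** Each of the three terms vanishes: [n6] reads only the components [six1] and [six2'] of its
    arguments, and both are 0 in its values. *)
Lemma n6_n6 x y z t s :
  n6 (n6 x y z) t s + n6 (tau6 x) (n6 y z t) s + n6 (tau6 x) (tau6 y) (n6 z t s) = 0.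
Proof.
move: x; apply: six_mk => x0 x1 y1 x2 y2 x3; move: y; apply: six_mk => u0 u1 v1 u2 v2 u3.
move: z; apply: six_mk => z0 z1 w1 z2 w2 z3; move: t; apply: six_mk => t0 t1 s1 t2 s2 t3.
rewrite mk60.
six_unfold.
apply: mk6_eq.
all: by six_solve.
Qed.

(* (-1)^(g h) = (1 + (-1)^g + (-1)^h - (-1)^(g + h)) / 2 *)
Lemma m6_comm x y :
  mu6 x y - 2^-1 *: (mu6 y x + mu6 y (tau6 x) + mu6 (tau6 y) x - mu6 (tau6 y) (tau6 x))
  = Q6 (m6 x y) + m6 (Q6 x) y + m6 (tau6 x) (Q6 y).
Proof.
have flip a b : brk C a b = dd C (prg C a b) - brk C b a by rewrite -(brkC HC) addrK.
move: x; apply: six_mk => x0 x1 y1 x2 y2 x3; move: y; apply: six_mk => u0 u1 v1 u2 v2 u3.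
six_unfold.
apply: mk6_eq.
all: six_norm; rewrite ?(flip u1 x1).
all: by six_solve.
Qed.

Let degN (g g' i j : int) : g + g' != i + j -> g != i \/ g' != j.
Proof.
by case: (eqVneq g i) => [->|]; [case: (eqVneq g' j) => [->|]; rewrite ?eqxx; auto|auto].
Qed.

Let degB (g h k : int) : g + (-1) != h -> k = h + 1 -> g != k.
Proof. by move=> gh ->; apply: contra gh => /eqP ->; rewrite addrK. Qed.

Lemma deg6_Q g x : deg6 g x -> deg6 (g + 1) (Q6 x).
Proof.
case=> x0 x1 x2 x3; split=> g1 //; rewrite /Q6 !mk6E.
- by rewrite x0 ?linE6 ?oppr0 //; move: g1; apply: contra => /eqP ->.
- have [-> ->] : six1 x = 0 /\ six1' x = 0 by apply: x1; move: g1; apply: contra => /eqP ->.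
  by rewrite !linE6 scaler0 subr0 addr0.
- have [-> ->] : six2 x = 0 /\ six2' x = 0 by apply: x2; move: g1; apply: contra => /eqP ->.
  by rewrite !linE6 scaler0 addr0.
Qed.

Lemma deg6_mu g g' x y : deg6 g x -> deg6 g' y -> deg6 (g + g' + 0) (mu6 x y).
Proof.
rewrite addr0; case=> x0 x1 x2 x3 [y0 y1 y2 y3].
have h i j := @degN g g' i j.
split=> gg; rewrite /mu6 !mk6E.
- by case: (h 0 0 gg) => [/x0|/y0] ->; rewrite !linE6.
- have [e1 e1'] : (six0 x = 0 \/ (six1 y = 0 /\ six1' y = 0)) /\
      ((six1 x = 0 /\ six1' x = 0) \/ six0 y = 0).
    by split; [case: (h 0 1 gg) => [/x0|/y1]; auto | case: (h 1 0 gg) => [/x1|/y0]; auto].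
  by case: e1 => [->|[-> ->]]; case: e1' => [[-> ->]|->]; rewrite !linE6 !addr0.
- have [[e1 e1'] e1''] : ((six0 x = 0 \/ (six2 y = 0 /\ six2' y = 0)) /\
      ((six2 x = 0 /\ six2' x = 0) \/ six0 y = 0)) /\
      ((six1 x = 0 /\ six1' x = 0) \/ (six1 y = 0 /\ six1' y = 0)).
    by do !split; [case: (h 0 2 gg) => [/x0|/y2]; auto | case: (h 2 0 gg) => [/x2|/y0]; auto
      | case: (h 1 1 gg) => [/x1|/y1]; auto].
  by case: e1 => [->|[-> ->]]; case: e1' => [[-> ->]|->]; case: e1'' => [[-> ->]|[-> ->]];
    rewrite !linE6 ?scaler0 !(subr0, addr0).
- have [[e0 e0'] [e1 e1']] : ((six0 x = 0 \/ six3 y = 0) /\ (six3 x = 0 \/ six0 y = 0)) /\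
      (((six1 x = 0 /\ six1' x = 0) \/ (six2 y = 0 /\ six2' y = 0)) /\
      ((six2 x = 0 /\ six2' x = 0) \/ (six1 y = 0 /\ six1' y = 0))).
    by do !split; [case: (h 0 3 gg) => [/x0|/y3]; auto | case: (h 3 0 gg) => [/x3|/y0]; auto
      | case: (h 1 2 gg) => [/x1|/y2]; auto | case: (h 2 1 gg) => [/x2|/y1]; auto].
  by case: e0 => ->; case: e0' => ->; case: e1 => [[-> ->]|[-> ->]];
    case: e1' => [[-> ->]|[-> ->]]; rewrite !linE6 ?scaler0 !(subr0, addr0).
Qed.

Lemma deg6_m g g' x y : deg6 g x -> deg6 g' y -> deg6 (g + g' + (-1)) (m6 x y).
Proof.
case=> _ x1 _ _ [_ y1 _ _]; split=> // gg; split=> //.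
rewrite /m6 mk6E.
have /degN : g + g' != 1 + 1 by exact: (degB gg).
by case=> [/x1|/y1] [-> _]; rewrite !linE6 oppr0.
Qed.

Lemma deg6_n g g' g'' x y z : deg6 g x -> deg6 g' y -> deg6 g'' z ->
  deg6 (g + g' + g'' + (-1)) (n6 x y z).
Proof.
case=> _ x1 x2 _ [_ y1 y2 _] [_ z1 _ _]; split=> // gg.
- split=> //; rewrite /n6 mk6E.
  have /degN : g + g' + g'' != (1 + 1) + 1 by exact: (degB gg).
  by case=> [/degN[/x1|/y1]|/z1] [-> _]; rewrite !linE6 subr0.
- rewrite /n6 mk6E.
  have ggN : g + g' + g'' != 4 by exact: (degB gg).
  have [/degN h1|/z1[-> _]] := @degN (g + g') g'' (2 + 1) 1 ggN;
    last by rewrite !linE6 subr0 oppr0.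
  have [/degN h2|/z1[-> _]] := @degN (g + g') g'' (1 + 2) 1 ggN;
    last by rewrite !linE6 subr0 oppr0.
  by case: h1 => [/x2[_ ->]|/y1[-> _]]; case: h2 => [/x1[-> _]|/y2[_ ->]];
    rewrite !linE6 subr0 oppr0.
Qed.

Lemma Q6_lin : lin Q6.
Proof.
move=> k; apply: six_mk => x0 x1 y1 x2 y2 x3; apply: six_mk => u0 u1 v1 u2 v2 u3.
rewrite /Q6 ?(mk6D, mk6Z) /six0 /six1 /six1' /six2 /six2' /six3 /=; apply: mk6_eq.
all: by rewrite ?linE6 //; lmod_with K ltac:(first [ring | by field]).
Qed.

Lemma mu6_bil : bilin mu6.
Proof.
split=> x k.
all: move: x; apply: six_mk => x0 x1 y1 x2 y2 x3; apply: six_mk => u0 u1 v1 u2 v2 u3.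
all: apply: six_mk => z0 z1 w1 z2 w2 z3.
all: rewrite /mu6 ?(mk6D, mk6Z) /six0 /six1 /six1' /six2 /six2' /six3 /=; apply: mk6_eq.
all: by rewrite ?linE6 //; lmod_with K ltac:(first [ring | by field]).
Qed.

Lemma m6_bil : bilin m6.
Proof.
split=> x k.
all: move: x; apply: six_mk => x0 x1 y1 x2 y2 x3; apply: six_mk => u0 u1 v1 u2 v2 u3.
all: apply: six_mk => z0 z1 w1 z2 w2 z3.
all: rewrite /m6 ?(mk6D, mk6Z) /six0 /six1 /six1' /six2 /six2' /six3 /=; apply: mk6_eq.
all: by rewrite ?linE6 //; lmod_with K ltac:(first [ring | by field]).
Qed.

Lemma n6_tri : [/\ forall y z, lin (fun x => n6 x y z),
  forall x z, lin (fun y => n6 x y z) & forall x y, lin (n6 x y)].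
Proof.
split=> x y k.
all: move: x; apply: six_mk => x0 x1 y1 x2 y2 x3; apply: six_mk => u0 u1 v1 u2 v2 u3.
all: apply: six_mk => z0 z1 w1 z2 w2 z3; move: y; apply: six_mk => s0 s1 t1 s2 t2 s3.
all: rewrite /n6 ?(mk6D, mk6Z) /six0 /six1 /six1' /six2 /six2' /six3 /=; apply: mk6_eq.
all: by rewrite ?linE6 //; lmod_with K ltac:(first [ring | by field]).
Qed.
End SixTerm.

(** * Deformation by commuting isotropic sections *)

Definition esum (K : fieldType) (N : nat) (eta : 'M[K]_N) (W : lmodType K)
  (F : 'I_N -> 'I_N -> W) : W := \sum_i \sum_j eta i j *: F i j.

Section EtaSums.
Variables (K : fieldType) (N : nat) (eta : 'M[K]_N).
Implicit Types W : lmodType K.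

Lemma eq_esum W (F G : 'I_N -> 'I_N -> W) :
  (forall i j, F i j = G i j) -> esum eta F = esum eta G.
Proof. by move=> FG; apply: eq_bigr => i _; apply: eq_bigr => j _; rewrite FG. Qed.

Lemma esumD W (F G : 'I_N -> 'I_N -> W) :
  esum eta (fun i j => F i j + G i j) = esum eta F + esum eta G.
Proof.
rewrite -big_split; apply: eq_bigr => i _; rewrite -big_split.
by apply: eq_bigr => j _; rewrite scalerDr.
Qed.

Lemma esum_lin W W' (f : W -> W') F : lin f ->
  f (esum eta F) = esum eta (fun i j => f (F i j)).
Proof.
move=> fl; rewrite lin_sum //; apply: eq_bigr => i _; rewrite lin_sum //.
by apply: eq_bigr => j _; rewrite (linE fl).
Qed.

Lemma esumN W (F : 'I_N -> 'I_N -> W) :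
  esum eta (fun i j => - F i j) = - esum eta F.
Proof. by rewrite -(@esum_lin _ _ -%R) // => k x y; rewrite scalerN opprD. Qed.

Lemma esum0 W : esum eta (fun _ _ => 0 : W) = 0.
Proof. by rewrite /esum big1 // => i _; rewrite big1 // => j _; rewrite scaler0. Qed.

Lemma esumZ W k (F : 'I_N -> 'I_N -> W) :
  esum eta (fun i j => k *: F i j) = k *: esum eta F.
Proof. by rewrite -(@esum_lin _ _ ( *:%R k)) // => a x y; rewrite scalerDr !scalerA mulrC. Qed.

Lemma esum_swap W (F : 'I_N -> 'I_N -> 'I_N -> 'I_N -> W) :
  esum eta (fun i j => esum eta (fun k l => F i j k l)) =
  esum eta (fun i j => esum eta (fun k l => F k l i j)).
Proof.
have pairE (G : 'I_N -> 'I_N -> W) :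
    esum eta G = \sum_(p : 'I_N * 'I_N) eta p.1 p.2 *: G p.1 p.2.
  by rewrite /esum pair_bigA.
rewrite !pairE; under eq_bigr do rewrite pairE scaler_sumr.
under [RHS]eq_bigr do rewrite pairE scaler_sumr.
rewrite exchange_big; apply: eq_bigr => p _; apply: eq_bigr => q _.
by rewrite !scalerA mulrC.
Qed.

End EtaSums.

(** The first five fields concern [C] alone: before the deformation there is no Laplacian, and the
    bracket satisfies the Jacobi identity. The last three concern the family [s]. *)
Record is_isotropic (K : fieldType) (V0 V1 : lmodType K) (C : courant_data V0 V1)
    (N : nat) (s : 'I_N -> V1) : Prop := IsIsotropic {
  iso_lap0 : forall u, lap0 C u = 0;
  iso_lap1 : forall a, lap1 C a = 0;
  iso_jacobi : forall a b c,
    brk C a (brk C b c) = brk C (brk C a b) c + brk C b (brk C a c);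
  iso_anc_brk : forall a b u,
    anc C (brk C a b) u = anc C a (anc C b u) - anc C b (anc C a u);
  iso_brk_dd : forall u a, brk C (dd C u) a = 0;
  iso_dv : forall i, dv C (s i) = 0;
  iso_brk : forall i j, brk C (s i) (s j) = 0;
  iso_prg : forall i j, prg C (s i) (s j) = 0 }.

Section Deformation.
Variables (K : fieldType) (V0 V1 : lmodType K) (C : courant_data V0 V1).
Variables (N : nat) (s : 'I_N -> V1) (eta : 'M[K]_N).
Local Notation "u ** v" := (mul C u v) (at level 40, left associativity).
Local Notation "u *> a" := (act C u a) (at level 40).
Local Notation E := (esum eta).

(** The corrections of [dd] and [dv] and the Laplacians are the terms of R_0^eta. Pairing the new
    [dd] with a gives the new anchor. In the bracket, the first term of the correction symmetrizes
    to the derivative of the pairing along s_j, as the new [dd] demands, and the other two are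
    antisymmetric to each other under exchange of a and b. *)
Definition deformed : courant_data V0 V1 := {|
  mul := mul C;
  act := act C;
  anc := fun a u => anc C a u - E (fun i j => prg C (s i) a ** anc C (s j) u);
  brk := fun a b => brk C a b
    - E (fun i j => prg C (brk C (s j) a) b *> s i - prg C (s i) b *> brk C (s j) a
                    + prg C (s i) a *> brk C (s j) b);
  prg := prg C;
  dd := fun u => dd C u - E (fun i j => anc C (s j) u *> s i);
  dv := fun a => dv C a - E (fun i j => prg C (s i) (brk C (s j) a));
  lap0 := fun u => E (fun i j => anc C (s i) (anc C (s j) u));
  lap1 := fun a => E (fun i j => brk C (s i) (brk C (s j) a)) |}.

Hypothesis two : 2 != 0 :> K.
Hypothesis HC : is_courant C.
Hypothesis Hs : is_isotropic C s.

Let cE := (bilE (mul_bil HC), bilE (act_bil HC), bilE (anc_bil HC),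
  bilE (brk_bil HC), bilE (prg_bil HC), linE (dd_lin HC), linE (dv_lin HC),
  linE (lap0_lin HC), linE (lap1_lin HC)).

Let brk_ddr0 u a : brk C a (dd C u) = dd C (anc C a u).
Proof. by rewrite -(prg_ddr HC) -(brkC HC) (iso_brk_dd Hs) addr0. Qed.
(** This is all that the product rule [lap_mul] says when the Laplacian is zero. *)
Let anc_dd u v : anc C (dd C u) v = 0.
Proof.
have := lap_mul HC u v; rewrite !(iso_lap0 Hs) !cE !add0r => /esym /eqP.
by rewrite oppr_eq0 => /eqP.
Qed.
Let dv_brk_s i a : dv C (brk C (s i) a) = anc C (s i) (dv C a).
Proof.
by rewrite (dv_brk HC) (iso_dv Hs) !(iso_lap0 Hs, iso_lap1 Hs) !cE !(subr0, addr0).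
Qed.
Let dv_dd0 u : dv C (dd C u) = 0.
Proof. by rewrite (dv_dd HC) (iso_lap0 Hs) scaler0 oppr0. Qed.
Let brk_ss i j a : brk C (s i) (brk C (s j) a) = brk C (s j) (brk C (s i) a).
Proof. by rewrite (iso_jacobi Hs) (iso_brk Hs) cE add0r. Qed.
Let anc_ss i j u : anc C (s i) (anc C (s j) u) = anc C (s j) (anc C (s i) u).
Proof.
by apply/eqP; rewrite -subr_eq0 -(iso_anc_brk Hs) (iso_brk Hs) cE.
Qed.
Let aE := (mulA HC, actA HC, prg_act HC, (prg_actr HC), anc_mul HC, anc_act HC, dd_mul HC,
  prg_dd HC, (prg_ddr HC), brk_act HC, (brk_actr HC), iso_brk_dd Hs, brk_ddr0, anc_dd,
  iso_lap0 Hs, iso_lap1 Hs, dv_dd0, dv_act HC, iso_dv Hs, dv_brk_s, iso_brk Hs,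
  iso_prg Hs, scaler0, oppr0).

Local Ltac cnorm := rewrite ?cE ?aE ?cE ?aE ?cE;
  comm_norm (prg C) (prgC HC); comm_norm (mul C) (mulC HC);
  commA_norm (mul C) (mulCA HC); commA_norm (act C) (actCA HC).
Local Ltac csolve := cnorm; lmod_with K ltac:(first [ring | by field]).
Local Ltac lsolve := lmod_with K ltac:(first [ring | by field]).

Lemma bil_esuml (A B W : lmodType K) (f : A -> B -> W) F y : bilin f ->
  f (E F) y = E (fun i j => f (F i j) y).
Proof. by case=> fl _; rewrite (esum_lin eta F (fl y)). Qed.
Lemma bil_esumr (A B W : lmodType K) (f : A -> B -> W) F x : bilin f ->
  f x (E F) = E (fun i j => f x (F i j)).
Proof. by case=> _ fr; rewrite (esum_lin eta F (fr x)). Qed.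

Let pE := (fun (F : 'I_N -> 'I_N -> V0) y => bil_esuml F y (mul_bil HC),
  fun (F : 'I_N -> 'I_N -> V0) y => bil_esumr F y (mul_bil HC),
  fun (F : 'I_N -> 'I_N -> V0) y => bil_esuml F y (act_bil HC),
  fun (F : 'I_N -> 'I_N -> V1) y => bil_esumr F y (act_bil HC),
  fun (F : 'I_N -> 'I_N -> V1) y => bil_esuml F y (anc_bil HC),
  fun (F : 'I_N -> 'I_N -> V0) y => bil_esumr F y (anc_bil HC),
  fun (F : 'I_N -> 'I_N -> V1) y => bil_esuml F y (brk_bil HC),
  fun (F : 'I_N -> 'I_N -> V1) y => bil_esumr F y (brk_bil HC),
  fun (F : 'I_N -> 'I_N -> V1) y => bil_esuml F y (prg_bil HC),
  fun (F : 'I_N -> 'I_N -> V1) y => bil_esumr F y (prg_bil HC),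
  fun (F : 'I_N -> 'I_N -> V0) => esum_lin eta F (dd_lin HC),
  fun (F : 'I_N -> 'I_N -> V1) => esum_lin eta F (dv_lin HC)).

Let dancE a u : anc deformed a u = anc C a u - E (fun i j => prg C (s i) a ** anc C (s j) u).
Proof. by []. Qed.
Let br i j a b : V1 := prg C (brk C (s j) a) b *> s i - prg C (s i) b *> brk C (s j) a
                    + prg C (s i) a *> brk C (s j) b.
Let brE i j a b : br i j a b = prg C (brk C (s j) a) b *> s i
  - prg C (s i) b *> brk C (s j) a + prg C (s i) a *> brk C (s j) b.
Proof. by []. Qed.
Local Ltac esolve := rewrite -?esumZ -?esumN -?esumD; apply: eq_esum => i j; rewrite ?brE; csolve.
Let dbrkE a b : brk deformed a b = brk C a b
    - E (fun i j => br i j a b).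
Proof. by []. Qed.
Let dddE u : dd deformed u = dd C u - E (fun i j => anc C (s j) u *> s i).
Proof. by []. Qed.
Let ddvE a : dv deformed a = dv C a - E (fun i j => prg C (s i) (brk C (s j) a)).
Proof. by []. Qed.
Let dlap0E u : lap0 deformed u = E (fun i j => anc C (s i) (anc C (s j) u)).
Proof. by []. Qed.
Let dlap1E a : lap1 deformed a = E (fun i j => brk C (s i) (brk C (s j) a)).
Proof. by []. Qed.
Let dE := (dancE, dbrkE, dddE, ddvE, dlap0E, dlap1E).

Lemma deformed_lin : [/\ bilin (anc deformed), bilin (brk deformed),
  lin (dd deformed), lin (dv deformed) & (lin (lap0 deformed) /\ lin (lap1 deformed))].
Proof.
split; last split.
- split=> x k y z; rewrite !dE !cE.
    rewrite (_ : E _ = k *: E (fun i j => prg C (s i) y ** anc C (s j) x)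
      + E (fun i j => prg C (s i) z ** anc C (s j) x)); [lsolve|esolve].
  rewrite (_ : E _ = k *: E (fun i j => prg C (s i) x ** anc C (s j) y)
      + E (fun i j => prg C (s i) x ** anc C (s j) z)); [lsolve|esolve].
- split=> x k y z; rewrite !dE !cE.
    rewrite [X in _ - X](_ : E _ =
      k *: E (fun i j => br i j y x) + E (fun i j => br i j z x)); first lsolve.
    esolve.
  rewrite [X in _ - X](_ : E _ =
    k *: E (fun i j => br i j x y) + E (fun i j => br i j x z)); first lsolve.
  esolve.
- move=> k y z; rewrite !dE !cE.
  rewrite (_ : E _ = k *: E (fun i j => anc C (s j) y *> s i)
      + E (fun i j => anc C (s j) z *> s i)); [lsolve|esolve].
- move=> k y z; rewrite !dE !cE.
  rewrite (_ : E _ = k *: E (fun i j => prg C (s i) (brk C (s j) y))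
      + E (fun i j => prg C (s i) (brk C (s j) z))); [lsolve|esolve].
- by move=> k y z; rewrite !dE; esolve.
- by move=> k y z; rewrite !dE; esolve.
Qed.

Lemma deformed_anc_mul a u v : anc deformed a (u ** v) =
  anc deformed a u ** v + u ** anc deformed a v.
Proof.
rewrite !dE ?cE ?pE.
rewrite (_ : E _ = E (fun i j => (prg C (s i) a ** anc C (s j) u) ** v) +
   E (fun i j => u ** (prg C (s i) a ** anc C (s j) v))); last by esolve.
by rewrite ?aE; lsolve.
Qed.

Lemma deformed_anc_act u a v : anc deformed (u *> a) v = u ** anc deformed a v.
Proof.
rewrite !dE ?cE ?pE (anc_act HC); congr (_ - _); esolve.
Qed.

Lemma deformed_dd_mul u v : dd deformed (u ** v) =
  u *> dd deformed v + v *> dd deformed u.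
Proof.
rewrite !dE ?cE ?pE.
rewrite (_ : E _ = E (fun i j => u *> (anc C (s j) v *> s i)) +
   E (fun i j => v *> (anc C (s j) u *> s i))); last first.
  rewrite -?esumD; apply: eq_esum => i j; rewrite (anc_mul HC) cE !(actA HC) addrC.
  by rewrite (actCA HC v).
by rewrite ?aE; lsolve.
Qed.

Lemma deformed_prg_dd u a : prg C (dd deformed u) a = anc deformed a u.
Proof. by rewrite !dE ?cE ?pE (prg_dd HC); congr (_ - _); esolve. Qed.

Lemma deformed_brk_act u a b : brk deformed (u *> a) b =
  u *> brk deformed a b + prg C a b *> dd deformed u - anc deformed b u *> a.
Proof.
rewrite !dE ?cE ?pE (brk_act HC).
rewrite [X in _ - X](_ : E _ =
  E (fun i j => u *> br i j a b) +
  E (fun i j => prg C a b *> (anc C (s j) u *> s i)) -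
  E (fun i j => (prg C (s i) b ** anc C (s j) u) *> a)); [lsolve|esolve].
Qed.

Lemma deformed_brkC a b :
  brk deformed a b + brk deformed b a = dd deformed (prg C a b).
Proof.
rewrite !dE -(brkC HC).
rewrite [X in _ = _ - X](_ : E _ =
  E (fun i j => br i j a b) +
  E (fun i j => br i j b a)); first lsolve.
rewrite -esumD; apply: eq_esum => i j; rewrite !brE (anc_prg HC); csolve.
Qed.

Lemma deformed_anc_prg b a c : anc deformed b (prg C a c) =
  prg C (brk deformed b a) c + prg C a (brk deformed b c).
Proof.
rewrite !dE ?cE ?pE (anc_prg HC).
rewrite [X in _ - X](_ : E _ =
  E (fun i j => prg C (br i j b a) c) +
  E (fun i j => prg C a (br i j b c))); first lsolve.
rewrite -esumD; apply: eq_esum => i j; rewrite !brE (anc_prg HC); csolve.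
Qed.

Lemma deformed_lap_dd u : lap1 deformed (dd deformed u) = dd deformed (lap0 deformed u).
Proof.
rewrite !dE ?pE.
transitivity (E (fun i j => dd C (anc C (s i) (anc C (s j) u)))
  - E (fun i j => E (fun k l => anc C (s i) (anc C (s j) (anc C (s l) u)) *> s k))).
  apply: esym; rewrite -esumN -esumD; apply: eq_esum => i j.
  rewrite !cE !pE !brk_ddr0; congr (_ - _).
  by apply: eq_esum => k l; csolve.
(* The Laplacian and the correction of [dd] carry one factor of eta each. Exchanging the factors
   turns one order of the two operators into the other, up to commuting the anchors of the s_i. *)
congr (_ - _); rewrite esum_swap; apply: eq_esum => i j; rewrite !pE.
by apply: eq_esum => k l; rewrite (anc_ss j) (anc_ss j).
Qed.

(** The 2 counts two equal terms of first order: the divergence of (s_j u) s_i, and the pairing of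
    s_i with the bracket of s_j and du. The term of second order vanishes because the s_i commute
    and are isotropic. *)
Lemma deformed_dv_dd u : dv deformed (dd deformed u) = - (2 *: lap0 deformed u).
Proof.
rewrite !dE !cE !pE dv_dd0.
rewrite [X in _ - X - _](_ : E _ = lap0 deformed u); last first.
  by rewrite dE; apply: eq_esum => i j; rewrite (dv_act HC) (iso_dv Hs) cE add0r.
rewrite [X in _ - X](_ : E _ = lap0 deformed u); first by rewrite !dE; lsolve.
rewrite dE; apply: eq_esum => i j; rewrite !cE !pE brk_ddr0 (prg_ddr HC).
rewrite (_ : E _ = 0) ?subr0 //.
by rewrite -[RHS](esum0 eta); apply: eq_esum => k l; csolve.
Qed.

Lemma deformed_dv_lap a : dv deformed (lap1 deformed a) = lap0 deformed (dv deformed a).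
Proof.
rewrite !dE ?pE.
transitivity (E (fun i j => anc C (s i) (anc C (s j) (dv C a)))
  - E (fun i j => E (fun k l => anc C (s i) (anc C (s j) (prg C (s k) (brk C (s l) a)))))).
  congr (_ - _).
    by apply: eq_esum => i j; rewrite !dv_brk_s.
  rewrite esum_swap; apply: eq_esum => i j; rewrite !pE; apply: eq_esum => k l.
  by rewrite !(anc_prg HC, iso_brk Hs, cE, add0r) !(brk_ss j).
rewrite -esumN -esumD; apply: eq_esum => i j; rewrite !cE !pE.
by [].
Qed.

Lemma deformed_lap_mul u v : lap0 deformed (u ** v) =
  u ** lap0 deformed v + v ** lap0 deformed u - anc deformed (dd deformed u) v.
Proof.
rewrite !dE ?cE ?pE anc_dd.
have -> : E (fun i j => prg C (s i) (dd C u - E (fun k l => anc C (s l) u *> s k)) ** anc C (s j) v)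
  = E (fun i j => anc C (s i) u ** anc C (s j) v).
  apply: eq_esum => i j; rewrite !cE !pE (prg_ddr HC).
  rewrite (_ : E _ = 0) ?subr0 //.
  by rewrite -[RHS](esum0 eta); apply: eq_esum => k l; csolve.
rewrite add0r opprD !opprK; esolve.
Qed.

Lemma deformed_lap_act u a : lap1 deformed (u *> a) =
  u *> lap1 deformed a + lap0 deformed u *> a - brk deformed (dd deformed u) a.
Proof.
rewrite !dE ?cE ?pE (iso_brk_dd Hs) sub0r.
set F2 : 'I_N -> 'I_N -> 'I_N -> 'I_N -> V1 := fun i j k l =>
  (prg C (s k) a ** anc C (s j) (anc C (s l) u)) *> s i
  - (prg C (s i) a ** anc C (s j) (anc C (s l) u)) *> s k.
(* [F2] changes sign when (i, j) and (k, l) are exchanged, since the anchors of the s_i commute; its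
   double sum equals its own opposite, and 2 is invertible. *)
have F20 : E (fun i j => E (F2 i j)) = 0.
  have : E (fun i j => E (F2 i j)) = - E (fun i j => E (F2 i j)).
    rewrite {1}esum_swap -esumN; apply: eq_esum => i j; rewrite -esumN.
    by apply: eq_esum => k l; rewrite /F2 (anc_ss j) opprB.
  move=> /eqP; rewrite -addr_eq0 -mulr2n -scaler_nat scaler_eq0 => /orP[|/eqP//].
  by rewrite (negPf two).
rewrite [X in _ - X](_ : _ = E (fun i j => E (F2 i j)) - E (fun i j =>
   anc C (s j) u *> brk C (s i) a + anc C (s i) u *> brk C (s j) a)); last first.
  have br2 i j : br i j (dd C u - E (fun k l => anc C (s l) u *> s k)) a =
      br i j (dd C u) a - E (F2 i j).
    rewrite !brE !cE !pE.
    rewrite [E (F2 i j)](_ : _ =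
      E (fun k l => prg C (brk C (s j) (anc C (s l) u *> s k)) a *> s i)
      - E (fun k l => prg C (s i) a *> brk C (s j) (anc C (s l) u *> s k))
      + E (fun k l => prg C (s i) (anc C (s l) u *> s k) *> brk C (s j) a)); first lsolve.
    by rewrite -esumN -!esumD; apply: eq_esum => k l; rewrite /F2; csolve.
  under [in X in _ - X]eq_esum => i j do rewrite br2.
  rewrite esumD esumN.
  rewrite [E (fun i j => br i j _ _)](_ : _ =
    E (fun i j => anc C (s j) u *> brk C (s i) a + anc C (s i) u *> brk C (s j) a)
    - E (fun i j => brk C (anc C (s j) u *> s i) a)); first lsolve.
  esolve.
rewrite F20 sub0r opprK; esolve.
Qed.

Lemma deformed_dv_act u a : dv deformed (u *> a) = u ** dv deformed a + anc deformed a u.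
Proof.
rewrite !dE ?cE ?pE (dv_act HC).
rewrite [X in _ - X](_ : E _ = E (fun i j => u ** prg C (s i) (brk C (s j) a)) +
  E (fun i j => prg C (s i) a ** anc C (s j) u)); [lsolve|esolve].
Qed.

(** The part of [deformed_dv_brk] of first order in eta, which holds for every pair (i, j) before
    summation. The second term on the left comes from the correction of [dv] applied to the
    undeformed bracket. *)
Let dv_br i j a b : dv C (br i j a b) + prg C (s i) (brk C (s j) (brk C a b)) =
  anc C a (prg C (s i) (brk C (s j) b)) + prg C (s i) a ** anc C (s j) (dv C b)
  - anc C b (prg C (s i) (brk C (s j) a)) - prg C (s i) b ** anc C (s j) (dv C a)
  + prg C (brk C (s i) (brk C (s j) a)) b - prg C a (brk C (s i) (brk C (s j) b))
  + anc C (s i) (anc C (s j) (prg C a b)).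
Proof.
have flip x y : brk C x y = dd C (prg C x y) - brk C y x by rewrite -(brkC HC) addrK.
rewrite (anc_prg HC a) (anc_prg HC b) (iso_jacobi Hs (s j)) (flip a (s i)) (flip b (s i)).
rewrite (flip b (brk C (s j) a)).
rewrite brE (anc_prg HC (s j) a b) cE.
by cnorm; rewrite !(anc_prg HC (s i)); csolve.
Qed.

Lemma deformed_dv_brk a b : dv deformed (brk deformed a b) =
  anc deformed a (dv deformed b) - anc deformed b (dv deformed a)
  - prg C (lap1 deformed a) b + prg C a (lap1 deformed b) - lap0 deformed (prg C a b).
Proof.
rewrite !dE ?cE ?pE (dv_brk HC) !(iso_lap0 Hs, iso_lap1 Hs) !cE !(subr0, addr0).
pose S i j k l := prg C (s i) (brk C (s j) (br k l a b)).
pose T x y i j k l := prg C (s i) x ** anc C (s j) (prg C (s k) (brk C (s l) y)).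
have quad : E (fun i j => E (S i j)) =
    E (fun i j => E (T a b i j)) - E (fun i j => E (T b a i j)).
  (* [W] collects the terms in which both a and b are bracketed with some s. They come twice, with
     opposite signs and with the two factors of eta exchanged, and so cancel in the sum. *)
  pose W i j k l := prg C (s k) (brk C (s j) a) ** prg C (s i) (brk C (s l) b).
  transitivity (E (fun i j => E (W i j)) - E (fun i j => E (fun k l => W k l i j))
      + E (fun i j => E (fun k l => T a b k l i j))
      - E (fun i j => E (fun k l => T b a k l i j))).
    rewrite -!esumN -!esumD; apply: eq_esum => i j; rewrite -!esumN -!esumD.
    apply: eq_esum => k l; rewrite /S /T /W brE !cE !aE !cE !(anc_prg HC) !(brk_ss l).
    by csolve.
  by rewrite (esum_swap eta W) subrr add0r (esum_swap eta (T a b)) (esum_swap eta (T b a)).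
have TE x y i j :
  prg C (s i) x ** anc C (s j) (dv C y - E (fun k l => prg C (s k) (brk C (s l) y)))
   = prg C (s i) x ** anc C (s j) (dv C y) - E (T x y i j).
  by rewrite !cE !pE.
have SE i j : prg C (s i) (brk C (s j) (brk C a b - E (fun k l => br k l a b)))
   = prg C (s i) (brk C (s j) (brk C a b)) - E (S i j).
  by rewrite !cE !pE.
have -> : E (fun i j => dv C (br i j a b)) =
    - E (fun i j => prg C (s i) (brk C (s j) (brk C a b)))
    + E (fun i j => anc C a (prg C (s i) (brk C (s j) b)))
    + E (fun i j => prg C (s i) a ** anc C (s j) (dv C b))
    - E (fun i j => anc C b (prg C (s i) (brk C (s j) a)))
    - E (fun i j => prg C (s i) b ** anc C (s j) (dv C a))
    + E (fun i j => prg C (brk C (s i) (brk C (s j) a)) b)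
    - E (fun i j => prg C a (brk C (s i) (brk C (s j) b)))
    + E (fun i j => anc C (s i) (anc C (s j) (prg C a b))).
  rewrite -!esumN -!esumD; apply: eq_esum => i j.
  by apply: (addIr (prg C (s i) (brk C (s j) (brk C a b)))); rewrite dv_br; lsolve.
rewrite (eq_esum eta SE) (eq_esum eta (TE a b)) (eq_esum eta (TE b a)).
rewrite !esumD !esumN quad; lsolve.
Qed.

Lemma deformed_courant : is_courant deformed.
Proof.
have [ancb brkb ddl dvl [l0l l1l]] := deformed_lin.
split=> //.
- exact: (mul_bil HC).
- exact: (act_bil HC).
- exact: (prg_bil HC).
- exact: (mulC HC).
- exact: (mulA HC).
- exact: (actA HC).
- exact: (prgC HC).
- exact: (prg_act HC).
- exact: deformed_anc_mul.
- exact: deformed_anc_act.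
- exact: deformed_dd_mul.
- exact: deformed_prg_dd.
- exact: deformed_brk_act.
- exact: deformed_brkC.
- exact: deformed_anc_prg.
- exact: deformed_lap_dd.
- exact: deformed_dv_dd.
- exact: deformed_dv_lap.
- exact: deformed_lap_mul.
- exact: deformed_lap_act.
- exact: deformed_dv_act.
- exact: deformed_dv_brk.
Qed.
End Deformation.

(** * Finitely supported families *)

Arguments fsdelta : simpl never.

Lemma fsumE (W : zmodType) (I : choiceType) (r : seq I) (F : I -> W) : uniq r ->
  (forall i, i \notin r -> F i = 0) -> \sum_(i \in [set: I]) F i = \sum_(i <- r) F i.
Proof.
move=> r_uniq F0; rewrite (fsbigE r) //; last by move=> i _; exact: F0.
by apply: eq_bigl => i; rewrite in_setT.
Qed.

Section FinitelySupported.
Variables (K : fieldType) (I : choiceType) (M N : lmodType K).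
Implicit Types (x y : fs I M) (g : I -> M -> N).

Lemma fsP x y : (forall i, x i = y i) -> x = y.
Proof. by move=> xy; apply/val_inj/funext. Qed.

Lemma fsDE x y i : (x + y) i = x i + y i. Proof. by []. Qed.
Lemma fsZE k x i : (k *: x) i = k *: x i. Proof. by []. Qed.
Lemma fs0E i : (0 : fs I M) i = 0. Proof. by []. Qed.

Lemma fs_sumE (J : Type) (r : seq J) (F : J -> fs I M) i :
  (\sum_(j <- r) F j) i = \sum_(j <- r) F j i.
Proof. by elim: r => [|j r IH]; rewrite ?big_nil // !big_cons fsDE IH. Qed.

Lemma fsdeltaE i v j : (fsdelta i v : fs I M) j = if j == i then v else 0.
Proof. by []. Qed.

Lemma fs_supp x : exists2 r : seq I, uniq r & forall i, i \notin r -> x i = 0.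
Proof.
have /asboolP fin := valP x.
exists (enum_fset (fset_set [set i | x i != 0])); first exact: fset_uniq.
move=> i; apply: contraNeq => xi.
by rewrite in_fset_set // inE.
Qed.

Lemma fslift_on g x (r : seq I) : uniq r -> (forall i, i \notin r -> x i = 0) ->
  (forall i, g i 0 = 0) -> fslift g x = \sum_(i <- r) g i (x i).
Proof.
by move=> r_uniq x0 g0; rewrite /fslift (fsumE r_uniq) // => i /x0 ->.
Qed.

Lemma fslift_delta g i v : (forall i, g i 0 = 0) -> fslift g (fsdelta i v) = g i v.
Proof.
move=> g0; rewrite (@fslift_on _ _ [:: i]) //.
  by rewrite big_seq1 fsdeltaE eqxx.
by move=> j; rewrite inE fsdeltaE => /negPf ->.
Qed.

Lemma fslift_lin g : (forall i, lin (g i)) -> lin (fslift g).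
Proof.
move=> gl k x y; have [r r_uniq x0] := fs_supp x; have [r' r'_uniq y0] := fs_supp y.
have g0 i : g i 0 = 0 by rewrite (linE (gl i)).
pose s := undup (r ++ r').
have s_uniq : uniq s by exact: undup_uniq.
have xs i : i \notin s -> x i = 0.
  by rewrite mem_undup mem_cat negb_or => /andP[/x0].
have ys i : i \notin s -> y i = 0.
  by rewrite mem_undup mem_cat negb_or => /andP[_ /y0].
rewrite !(fslift_on s_uniq) //; last first.
  by move=> i i_s; rewrite fsDE fsZE xs // ys // scaler0 addr0.
rewrite scaler_sumr -big_split; apply: eq_bigr => i _.
by rewrite fsDE fsZE (linE (gl i)) (linE (gl i)).
Qed.

End FinitelySupported.

Lemma fs_decomp (K : fieldType) (I : choiceType) (M : lmodType K) (x : fs I M) (r : seq I) :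
  uniq r -> (forall i, i \notin r -> x i = 0) -> x = \sum_(i <- r) fsdelta i (x i).
Proof.
move=> r_uniq x0; apply: fsP => i; rewrite fs_sumE.
case: (boolP (i \in r)) => [ir|ir].
  rewrite (bigD1_seq i) // fsdeltaE eqxx big1 => [|j ji]; first by rewrite /= addr0.
  by rewrite fsdeltaE eq_sym (negPf ji).
rewrite x0 // big1_seq // => j /andP[_ jr]; rewrite fsdeltaE; case: eqP => // ij.
by move: ir; rewrite ij jr.
Qed.

Lemma fsdelta_lin (K : fieldType) (I : choiceType) (M : lmodType K) (i : I) :
  lin (fun v : M => fsdelta i v).
Proof.
move=> k u v; apply: fsP => j; rewrite fsDE fsZE !fsdeltaE.
by case: eqP; rewrite ?scaler0 ?addr0.
Qed.

Lemma lin_fs_eq (K : fieldType) (I : choiceType) (M N : lmodType K) (f g : fs I M -> N) :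
  lin f -> lin g -> (forall i v, f (fsdelta i v) = g (fsdelta i v)) -> forall x, f x = g x.
Proof.
move=> fl gl fg x; have [r r_uniq x0] := fs_supp x.
rewrite (fs_decomp r_uniq x0) (lin_sum fl) (lin_sum gl).
by apply: eq_bigr => i _; exact: fg.
Qed.

Lemma lin_comp (K : fieldType) (U V W : lmodType K) (f : V -> W) (g : U -> V) :
  lin f -> lin g -> lin (fun x => f (g x)).
Proof. by move=> fl gl k x y; rewrite gl fl. Qed.

Lemma lin_sub (K : fieldType) (U V : lmodType K) (f g : U -> V) :
  lin f -> lin g -> lin (fun x => f x - g x).
Proof. by move=> fl gl k x y; rewrite gl fl; lmod_with K ltac:(ring). Qed.

Lemma lin_opp (K : fieldType) (U V : lmodType K) (f : U -> V) : lin f -> lin (fun x => - f x).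
Proof. by move=> fl k x y; rewrite fl; lmod_with K ltac:(ring). Qed.

Lemma lin_zero (K : fieldType) (U V : lmodType K) : lin (fun _ : U => 0 : V).
Proof. by move=> k x y; rewrite scaler0 addr0. Qed.

(** * Ghosts *)

Section GhostModes.
Variable K : fieldType.
Local Notation fock := (fock K).
Implicit Types (S : {fset int}) (x y : fock) (g : {fset int} -> fock).

Lemma fock_lift_lin g : lin (fock_lift g).
Proof.
by apply: fslift_lin => S k u v; rewrite scalerDl scalerA.
Qed.

Lemma fock_lift_fe g S : fock_lift g (fe K S) = g S.
Proof.
by rewrite /fock_lift fslift_delta ?scale1r // => T; rewrite scale0r.
Qed.

Lemma fock_eq (f g : fock -> fock) : lin f -> lin g ->
  (forall S, f (fe K S) = g (fe K S)) -> forall x, f x = g x.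
Proof.
move=> fl gl fg; apply: lin_fs_eq => // S v.
have -> : fsdelta S v = v *: fe K S.
  apply: fsP => T; rewrite fsZE /fe !fsdeltaE.
  by case: eqP; rewrite ?scaler0 // => _; rewrite /GRing.scale /= mulr1.
by rewrite (linE fl) (linE gl) fg.
Qed.

Definition below (m : int) S : nat := count (fun s => s < m) (enum_fset S).

Lemma belowU m n S : n \notin S -> below m (n |` S)%fset = ((n < m)%R + below m S)%N.
Proof.
move=> nS; have E T : below m T = (\sum_(s <- T) (s < m)%R)%N.
  by rewrite /below -sum1_count big_mkcond.
by rewrite !E big_fsetU1.
Qed.

Lemma belowD m n S : n \in S -> below m S = ((n < m)%R + below m (S `\ n)%fset)%N.
Proof. by move=> nS; rewrite -{1}(fsetD1K nS) belowU // !inE eqxx. Qed.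

Lemma fcreate_lin m : lin (@fcreate K m). Proof. exact: fock_lift_lin. Qed.
Lemma fannih_lin m : lin (@fannih K m). Proof. exact: fock_lift_lin. Qed.

Lemma fcreate_fe m S : fcreate m (fe K S) =
  if m \in S then 0 else (-1) ^+ below m S *: fe K (m |` S)%fset.
Proof. by rewrite /fcreate fock_lift_fe. Qed.

Lemma fannih_fe m S : fannih m (fe K S) =
  if m \in S then (-1) ^+ below m S *: fe K (S `\ m)%fset else 0.
Proof. by rewrite /fannih fock_lift_fe. Qed.

Lemma fcreateK m x : fcreate m (fcreate m x) = 0.
Proof.
move: x; apply: fock_eq => [|| S].
- exact: lin_comp (fcreate_lin m) (fcreate_lin m).
- exact: lin_zero.
rewrite fcreate_fe; case: ifP => mS; first by rewrite (linE (fcreate_lin m)).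
by rewrite (linE (fcreate_lin m)) fcreate_fe !inE eqxx scaler0.
Qed.

Let sgnS (b b' : nat) : (-1) ^+ (b + b') = (-1) ^+ b * (-1) ^+ b' :> K.
Proof. exact: exprD. Qed.

Lemma fcreateC m n x : fcreate m (fcreate n x) = - fcreate n (fcreate m x).
Proof.
have [->|mn] := eqVneq m n; first by rewrite fcreateK oppr0.
move: x; apply: fock_eq => [|| S].
- exact: lin_comp (fcreate_lin m) (fcreate_lin n).
- by apply: lin_opp; exact: lin_comp (fcreate_lin n) (fcreate_lin m).
rewrite !fcreate_fe; case: ifP => nS; case: ifP => mS; rewrite !(linE (fcreate_lin _)) ?oppr0 //.
- by rewrite fcreate_fe !inE nS orbT scaler0 oppr0.
- by rewrite fcreate_fe !inE mS orbT scaler0.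
rewrite !fcreate_fe !inE (negPf mn) eq_sym (negPf mn) nS mS /= !belowU ?nS ?mS //.
rewrite !scalerA fsetUCA -scaleNr; congr (_ *: _); rewrite !sgnS.
by move: (_ ^+ below m _) (_ ^+ below n _) => p q; case: (ltgtP m n) mn => // _ _;
    rewrite expr0 expr1 !(mul1r, mulN1r, mulrN, mulNr, opprK) mulrC.
Qed.

Lemma fannih_create m n x :
  fannih m (fcreate n x) = (if m == n then x else 0) - fcreate n (fannih m x).
Proof.
move: x; apply: fock_eq => [|| S].
- exact: lin_comp (fannih_lin m) (fcreate_lin n).
- apply: lin_sub; last exact: lin_comp (fcreate_lin n) (fannih_lin m).
  by case: eqP => _ // k x y; rewrite scaler0 addr0.
have [<-|mn] := eqVneq m n.
  rewrite fcreate_fe fannih_fe; case: ifP => mS.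
    rewrite !(linE (fannih_lin _)) !(linE (fcreate_lin _)) fcreate_fe !inE eqxx /=.
    rewrite fsetD1K // scalerA -sgnS (belowD m mS) ltxx add0n -signr_odd oddD addbb expr0.
    by rewrite scale1r subrr.
  rewrite (linE (fannih_lin _)) (linE (fcreate_lin _)) fannih_fe !inE eqxx /= oppr0 addr0.
  rewrite belowU ?mS // ltxx add0n scalerA -sgnS -signr_odd oddD addbb expr0 scale1r.
  by rewrite fsetU1K ?mS.
rewrite sub0r fcreate_fe fannih_fe; case: ifP => nS; case: ifP => mS;
  rewrite ?(linE (fannih_lin _)) ?(linE (fcreate_lin _)) ?oppr0 //.
- by rewrite fcreate_fe !inE nS eq_sym mn scaler0 oppr0.
- rewrite fannih_fe fcreate_fe !inE (negPf mn) eq_sym (negPf mn) nS mS /=.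
  have nSm : n \notin (S `\ m)%fset by rewrite !inE nS andbF.
  rewrite belowU ?nS // (belowD n mS) !scalerA -scaleNr.
  have -> : ((n |` S) `\ m = n |` (S `\ m))%fset.
    by apply/fsetP => k; rewrite !inE; case: (eqVneq k n) => // ->; rewrite eq_sym mn.
  congr (_ *: _); rewrite !sgnS.
  by move: (_ ^+ below m _) (_ ^+ below n _) => p q; case: (ltgtP m n) mn => // _ _;
    rewrite expr0 expr1 !(mul1r, mulN1r, mulrN, mulNr, opprK) mulrC.
- by rewrite fannih_fe !inE (negPf mn) mS scaler0.
Qed.

Lemma fannih_vac m : fannih m (gvac K) = 0.
Proof. by rewrite fannih_fe. Qed.

Lemma c_lin n : lin (@c_ K n).
Proof. by rewrite /c_; case: ifP => _; [exact: fcreate_lin|exact: fannih_lin]. Qed.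
Lemma b_lin n : lin (@b_ K n).
Proof. by rewrite /b_; case: ifP => _; [exact: fcreate_lin|exact: fannih_lin]. Qed.

End GhostModes.

(** * Words in the derivatives of c *)

Section GhostWords.
Variable K : fieldType.
Local Notation fock := (fock K).

Definition dc (j : nat) : fock -> fock := @c_ K (1 - j%:Z).

(* [dw [:: j1; ..; jr]] is the state of the product of the divided derivatives
   \partial^j c / j! for j = j1, .., jr. *)
Definition dw (v : seq nat) : fock := foldr dc (gvac K) v.

Definition cint (j : nat) : int := 1 - j%:Z.

Lemma dcE j : dc j = @fcreate K (cint j).
Proof. by rewrite /dc /c_ ifT //; lia. Qed.

Lemma dc_lin j : lin (dc j).
Proof. exact: c_lin. Qed.

(** Decreasing, because [cint] reverses the order: the modes of such a word increase from left to
    right, as in the basis vectors of the Fock module. *)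
Definition canon (v : seq nat) : bool := sorted gtn v.

Definition Fw (v : seq nat) : {fset int} := [fset x in map cint v]%fset.

Lemma cint_inj : injective cint.
Proof. by move=> i j; rewrite /cint; lia. Qed.

Lemma canon_sorted v : canon v -> sorted <%R (map cint v).
Proof.
rewrite /canon sorted_map => cv; apply: sub_sorted cv => i j /=.
by rewrite /gtn /cint /=; lia.
Qed.

Lemma sort_fset (l : seq int) : sorted <%R l -> sort <=%R (enum_fset [fset x in l]%fset) = l.
Proof.
move=> sl; have ul : uniq l by exact: lt_sorted_uniq sl.
have /perm_sort_leP -> : perm_eq (enum_fset [fset x in l]%fset) l.
  by apply: uniq_perm => // x; rewrite !inE.
by apply: sort_le_id; exact: (sub_sorted (fun x y => @ltW _ _ x y) sl).
Qed.

(** Each new mode lies below all the modes already present, so no sign appears. *)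
Lemma fcreate_word (l : seq int) : sorted <%R l ->
  foldr (@fcreate K) (gvac K) l = fe K [fset x in l]%fset.
Proof.
elim: l => [|m l IH] sl.
  by rewrite /gvac /=; congr (fe K _); apply/fsetP => x; rewrite !inE.
rewrite /= (IH (path_sorted sl)) fcreate_fe.
have lt_l x : x \in [fset x in l]%fset -> m < x.
  by rewrite !inE => xl; have /allP /(_ _ xl) := order_path_min (@lt_trans _ int) sl.
rewrite ifF; last by apply/negP => /lt_l; rewrite ltxx.
rewrite (_ : below _ _ = 0%N) ?expr0 ?scale1r.
  by congr (fe K _); apply/fsetP => x; rewrite !inE.
apply/eqP; rewrite /below -leqn0 leqNgt -has_count; apply/hasPn => x /lt_l jx.
by rewrite -leNgt ltW.
Qed.

Lemma enum_Fw v : canon v -> sort <=%R (enum_fset (Fw v)) = map cint v.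
Proof. by move=> /canon_sorted; exact: sort_fset. Qed.

Lemma Fw_inj v v' : canon v -> canon v' -> Fw v = Fw v' -> v = v'.
Proof.
move=> cv cv' E; apply: (inj_map cint_inj).
by rewrite -(enum_Fw cv) E enum_Fw.
Qed.

Lemma dw_fe v : canon v -> dw v = fe K (Fw v).
Proof.
move=> /canon_sorted /fcreate_word <-; rewrite /dw foldr_map.
by elim: v => //= j v ->; rewrite dcE.
Qed.

(** The modes c_n with n >= 2 are the coefficients of the negative powers of z in c(z); on these
    states c(z) has no pole. *)
Definition regular_state (x : fock) : Prop := forall n, 2 <= n -> c_ n x = 0.

Lemma regular_dc j x : regular_state x -> regular_state (dc j x).
Proof.
move=> rx n n2; rewrite dcE /c_ ifF; last by lia.
rewrite fannih_create ifF; last by rewrite /cint; lia.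
have := rx n n2; rewrite /c_ ifF => [->|]; last by lia.
by rewrite (linE (fcreate_lin _)) subr0.
Qed.

Lemma regular_vac : regular_state (gvac K).
Proof. by move=> n n2; rewrite /c_ ifF ?fannih_vac //; lia. Qed.

Lemma regular_dw v : regular_state (dw v).
Proof. by elim: v => [|j v IH]; [exact: regular_vac|exact: regular_dc]. Qed.

Lemma regular0 : regular_state 0.
Proof. by move=> n _; rewrite (linE (c_lin n)). Qed.

(* The coefficient of z^p in the product of the fields of [v] applied to a
   state on which these fields are regular. *)
Fixpoint cprod (v : seq nat) (p : nat) (x : fock) : fock :=
  if v is j :: v' then
    \sum_(i <- iota 0 p.+1) 'C(j + i, i)%:R *: dc (j + i) (cprod v' (p - i) x)
  else if p is 0%N then x else 0.

Lemma cprod_lin v p : lin (cprod v p).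
Proof.
elim: v p => [|j v IH] p k x y /=.
  by case: p => // p; rewrite scaler0 addr0.
rewrite scaler_sumr -big_split; apply: eq_bigr => i _.
by rewrite IH (dc_lin _) scalerDr !scalerA [k * _]mulrC.
Qed.

(** The annihilation half of each normal ordered product is 0 on a regular state, and what remains
    is a product of power series. The mode n is the coefficient of z^(-n-1), whence the
    predecessor. *)
Lemma fock_field_c v n x : regular_state x ->
  fock_field (map cint v) n x =
  if n < 0 then cprod v (absz n).-1 x else 0.
Proof.
elim: v n x => [|j v IH] n x rx.
  rewrite /=; case: eqP => [->|] // n1; case: ifP => // n0.
  case E: (absz n).-1 => [|p] //; exfalso; apply: n1.
  by case: n n0 E => // -[].
rewrite [LHS]/= ifT; last by rewrite /cint; lia.
rewrite /normal_order.
have jE : absz (1 - cint j) = j by rewrite /cint; lia.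
have term (i : nat) : c_field (- 1 - (absz (1 - cint j))%:Z - i%:Z)
      (fock_field (map cint v) (n + i%:Z) x)
    + (-1) ^+ (absz (1 - cint j) + odd (size (map cint v))) *:
      fock_field (map cint v) (n - 1 - (absz (1 - cint j))%:Z - i%:Z) (c_field i%:Z x)
    = if n + i%:Z < 0 then dc (j + i) (cprod v (absz (n + i%:Z)).-1 x) else 0.
  rewrite jE; have -> : c_field i%:Z x = 0 by apply: rx; lia.
  rewrite (IH _ _ regular0) (linE (cprod_lin _ _)) if_same scaler0 addr0 IH //.
  rewrite /c_field (_ : - 1 - j%:Z - i%:Z + 2 = 1 - (j + i)%N%:Z); last by lia.
  by rewrite -/(dc _); case: ifP; rewrite ?(linE (dc_lin _)).
case: ifP => n0.
- rewrite (@fsumE _ _ (iota 0 (absz n).-1.+1)) ?iota_uniq // => [|i].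
    rewrite /=; apply: eq_big_seq => i; rewrite -[_ :: _]/(iota 0 (absz n).-1.+1).
    rewrite mem_iota => /andP[_ i_lt].
    rewrite term jE ifT; last by lia.
    by congr (_ *: dc _ (cprod _ _ _)); lia.
  by rewrite mem_iota => i_ge; rewrite term ifF ?scaler0 //; lia.
- rewrite (@fsumE _ _ [::]) ?big_nil // => i _.
  by rewrite term ifF ?scaler0 //; lia.
Qed.

(** * Symbolic evaluation of ghost products *)

(* On words of ghosts these expansions and signs are computed by evaluation. *)
Fixpoint cterms (v : seq nat) (p : nat) (u : seq nat) : seq (nat * seq nat) :=
  if v is j :: v' then
    flatten [seq [seq ('C(j + i, i) * t.1, (j + i) :: t.2)%N | t <- cterms v' (p - i) u]
            | i <- iota 0 p.+1]
  else if p is 0%N then [:: (1%N, u)] else [::].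

Lemma cterms_cons j v p u : cterms (j :: v) p u =
  flatten [seq [seq ('C(j + i, i) * t.1, (j + i) :: t.2)%N | t <- cterms v (p - i) u]
          | i <- iota 0 p.+1].
Proof. by []. Qed.

Lemma cprod_cons j v p x : cprod (j :: v) p x =
  \sum_(i <- iota 0 p.+1) 'C(j + i, i)%:R *: dc (j + i) (cprod v (p - i) x).
Proof. by []. Qed.

Lemma cprod_terms v p u :
  cprod v p (dw u) = \sum_(t <- cterms v p u) t.1%:R *: dw t.2.
Proof.
elim: v p => [|j v IH] p.
  by case: p => [|p]; rewrite ?big_seq1 ?big_nil ?scale1r.
rewrite cterms_cons cprod_cons big_flatten big_map; apply: eq_bigr => i _.
rewrite big_map IH (lin_sum (dc_lin _)) scaler_sumr; apply: eq_bigr => t _ /=.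
by rewrite (linE (dc_lin _)) scalerA natrM.
Qed.

(** Insertion sort of anticommuting letters: the Boolean is the parity of the transpositions, and
    [None] stands for the value 0 caused by a repeated letter. *)
Fixpoint cins (j : nat) (v : seq nat) : option (bool * seq nat) :=
  if v is i :: v' then
    if eqn j i then None
    else if (i < j)%N then Some (false, j :: v)
    else if cins j v' is Some (s, u) then Some (~~ s, i :: u) else None
  else Some (false, [:: j]).

Fixpoint cnorm (v : seq nat) : option (bool * seq nat) :=
  if v is j :: v' then
    if cnorm v' is Some (s, u) then
      if cins j u is Some (s', u') then Some (s (+) s', u') else None
    else None
  else Some (false, [::]).

Definition cval (o : option (bool * seq nat)) : fock :=
  if o is Some (s, u) then (-1) ^+ s *: dw u else 0.

Lemma dcC i j x : dc i (dc j x) = - dc j (dc i x).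
Proof. by rewrite !dcE fcreateC. Qed.

Lemma dcK i x : dc i (dc i x) = 0.
Proof. by rewrite !dcE fcreateK. Qed.

Lemma cins_val j v : dc j (dw v) = cval (cins j v).
Proof.
elim: v => [|i v IH] /=; first by rewrite scale1r.
case: (@eqnP j i) => [->|ji]; first by rewrite /= dcK.
case: ifP => _; first by rewrite /= scale1r.
rewrite dcC IH; case: (cins j v) => [[s u]|] /=; last by rewrite (linE (dc_lin _)) oppr0.
by rewrite (linE (dc_lin _)) signrN scaleNr.
Qed.

Lemma cnorm_val v : dw v = cval (cnorm v).
Proof.
elim: v => [|j v IH] /=; first by rewrite scale1r.
rewrite IH; case: (cnorm v) => [[s u]|] /=; last by rewrite (linE (dc_lin _)).
rewrite (linE (dc_lin _)) cins_val; case: (cins j u) => [[s' u']|] /=; last by rewrite scaler0.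
by rewrite scalerA signr_addb.
Qed.

Definition cev (v : seq nat) (p : nat) (u : seq nat) : seq (bool * nat * seq nat) :=
  pmap (fun t => if cnorm t.2 is Some (s, w) then Some (s, t.1, w) else None)
    (cterms v p u).

Lemma cprod_ev v p u :
  cprod v p (dw u) = \sum_(t <- cev v p u) ((-1) ^+ t.1.1 * t.1.2%:R) *: dw t.2.
Proof.
rewrite cprod_terms /cev; elim: (cterms v p u) => [|t r IH]; first by rewrite !big_nil.
rewrite big_cons IH cnorm_val /=; case: (cnorm t.2) => [[s w]|] /=.
  by rewrite big_cons /= scalerA mulrC.
by rewrite scaler0 add0r.
Qed.

End GhostWords.

(** * Consequences of the Jacobi identity *)

Section Gbin.
Variable K : fieldType.

Lemma gbin_0 m : gbin K m 0 = 1.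
Proof. by rewrite /gbin big_ord0 fact0 divr1. Qed.

Lemma gbin_nat (m j : nat) : (m < j)%N -> gbin K m%:Z j = 0.
Proof.
by move=> mj; rewrite /gbin (bigD1 (Ordinal mj)) //= -pmulrn subrr !mul0r.
Qed.

Lemma gbin_1 m : gbin K m 1 = m%:~R.
Proof. by rewrite /gbin big_ord_recl big_ord0 /= subr0 mulr1 divr1. Qed.

Hypothesis char0 : forall n, n.+1%:R != 0 :> K.

Lemma gbin22 : gbin K 2 2 = 1.
Proof.
rewrite /gbin !big_ord_recl big_ord0 /= mulr1 subr0 (_ : 2%:~R - 1 = 1 :> K).
  by rewrite mulr1 divff // (char0 1).
by rewrite -[1 in LHS]/(1%:~R) -intrB.
Qed.

Lemma gbinN1 j : (-1) ^+ j * gbin K (-1) j = 1.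
Proof.
rewrite /gbin mulrA -[X in X * _]/(_ * _).
have -> : \prod_(i < j) ((-1)%:~R - i%:R) = (-1) ^+ j * j`!%:R :> K.
  elim: j => [|j IH]; first by rewrite big_ord0 mulr1.
  rewrite big_ord_recr /= IH factS natrM exprS.
  rewrite -[X in _ * (_ - X)]/(j%:R) (_ : (-1)%:~R = -1 :> K) // -opprD -natr1.
  by ring.
rewrite mulrA -signr_odd -exprMn mulrNN mulr1 expr1n mul1r divff //.
by case: (j`!) (fact_gt0 j) => // n _; exact: char0.
Qed.
End Gbin.

Section VertexAlgebra.
Variables (K : fieldType) (A : lmodType K) (D : voa_data A) (gr : nat -> set A).
Hypothesis char0 : forall n, n.+1%:R != 0 :> K.
Hypothesis HD : is_voa D gr.
Local Notation "a $[ n ] b" := (vprod D a n b)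
  (at level 35, n at level 99, right associativity).

Lemma vprod_bil n : bilin (fun a b => a $[n] b).
Proof. by split=> x k y z; [exact: (voa_linl HD)|exact: (voa_linr HD)]. Qed.

Let vE n := bilE (vprod_bil n).

Lemma Lmode_lin n : lin (Lmode D n).
Proof. by move=> k x y; rewrite /Lmode (voa_linr HD). Qed.

(** The Jacobi identity at k = 0, where the binomials on the right leave only j = 0. *)
Lemma vcomm (m : nat) a n b c :
  a $[m%:Z] b $[n] c - b $[n] a $[m%:Z] c =
  \sum_(j <- iota 0 m.+1) gbin K m j *: (a $[j%:Z] b) $[m%:Z + n - j%:Z] c.
Proof.
have := voa_jacobi HD a b c 0 m%:Z n.
rewrite (@fsumE _ _ (iota 0 m.+1)) ?iota_uniq // => [|i]; last first.
  by rewrite mem_iota /= -ltnNge => mi; rewrite gbin_nat ?scale0r //; lia.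
rewrite (@fsumE _ _ (iota 0 1)) ?iota_uniq // => [|i]; last first.
  by rewrite mem_iota /= -ltnNge => mi; rewrite (@gbin_nat _ 0) ?mulr0 ?scale0r.
rewrite [X in _ = X -> _]big_seq1 gbin_0 expr0 mul1r expr0z !scale1r.
rewrite -[Posz 0]/(0 : int) !(subr0, addr0) => <-.
by apply: eq_bigr => j _; rewrite add0r.
Qed.

(** The Jacobi identity at k = -1 and m = 0. The coefficients on the right are 1 by [gbinN1], and
    [p] bounds the infinite sum. *)
Lemma vassoc a b n c (p : nat) :
  (forall j : nat, (p <= j)%N -> b $[n + j%:Z] c = 0 /\ a $[j%:Z] c = 0) ->
  (a $[-1] b) $[n] c =
  \sum_(j <- iota 0 p) (a $[-1 - j%:Z] b $[n + j%:Z] c + b $[n - 1 - j%:Z] a $[j%:Z] c).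
Proof.
move=> van; have := voa_jacobi HD a b c (-1) 0 n.
rewrite (@fsumE _ _ (iota 0 1)) ?iota_uniq // => [|i]; last first.
  by rewrite mem_iota /= -ltnNge => mi; rewrite (@gbin_nat _ 0) ?mulr0 ?scale0r.
rewrite big_seq1 gbin_0 scale1r addr0 subr0 add0r => ->.
rewrite (@fsumE _ _ (iota 0 p)) ?iota_uniq // => [|i]; last first.
  rewrite mem_iota /= add0n -leqNgt => /van[bc ac].
  by rewrite bc add0r ac !vE scaler0 subr0 scaler0.
apply: eq_bigr => j _; rewrite gbinN1 // scale1r add0r add0r.
by rewrite (_ : (-1 : K) ^ (-1) = -1) ?scaleN1r ?opprK // exprN1 invrN1.
Qed.

Lemma vvac_mode n b : vvac D $[n] b = if n == -1 then b else 0.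
Proof. exact: voa_vacuum HD n b. Qed.

Lemma vcreate a : a $[-1] vvac D = a.
Proof. by have [] := voa_creation HD a. Qed.

Lemma vcreate0 a n : 0 <= n -> a $[n] vvac D = 0.
Proof. by have [_] := voa_creation HD a; apply. Qed.

Lemma vtrans a n b : Lmode D (-1) a $[n] b = - (n%:~R *: a $[n - 1] b).
Proof. exact: voa_translation HD a n b. Qed.

(** The Jacobi identity on the vacuum with m = -1 and n = 0. By the hypothesis only two terms of the
    skew-symmetry series survive, the second being a single translation. *)
Lemma vskew a b k : (forall j : nat, (1 < j)%N -> a $[k + j%:Z] b = 0) ->
  b $[k] a = - ((-1) ^ k *: (a $[k] b - Lmode D (-1) (a $[k + 1] b))).
Proof.
move=> van; have := voa_jacobi HD a b (vvac D) k (-1) 0.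
rewrite (@fsumE _ _ (iota 0 2)) ?iota_uniq // => [|i]; last first.
  by rewrite mem_iota /= -ltnNge => mi; rewrite van // vE scaler0.
rewrite (@fsumE _ _ (iota 0 1)) ?iota_uniq // => [|i]; last first.
  rewrite mem_iota /= -ltnNge => mi.
  by rewrite !vcreate0 ?vE ?scaler0 ?subr0 ?scaler0 //; lia.
rewrite big_cons !big_seq1 !gbin_0 gbin_1 expr0 !mul1r !scale1r.
rewrite -[Posz 0]/(0 : int) -[Posz 1]/(1 : int) !(subr0, addr0) (vcreate0 b) //.
rewrite vE sub0r !vcreate => E.
have LX X : Lmode D (-1) X = X $[-1 - 1] vvac D.
  by rewrite -[LHS]vcreate vtrans scaleN1r opprK.
move: E; rewrite mulrN1z scaleN1r -LX add0r => ->.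
rewrite scalerN opprK scalerA -expfzMl mulrNN mulr1 exp1rz scale1r //.
Qed.

Lemma int_char0 (z : int) : z%:~R = 0 :> K -> z = 0.
Proof.
case: z => [[|n]|n] //= /eqP; first by rewrite -pmulrn (negPf (char0 n)).
by rewrite NegzE mulrNz oppr_eq0 -pmulrn (negPf (char0 n)).
Qed.

Lemma L0_weight p a : gr p a -> Lmode D 0 a = p%:R *: a.
Proof. by move/(voa_weight HD). Qed.

Lemma L0_vprod p q a b n : gr p a -> gr q b ->
  Lmode D 0 (a $[n] b) = (p%:Z + q%:Z - n - 1)%:~R *: a $[n] b.
Proof.
move=> ap bq; have := vcomm 1 (vomega D) n a b.
rewrite big_cons big_seq1 gbin_0 gbin_1 !scale1r.
rewrite -[vomega D $[1] b]/(Lmode D 0 b) -[vomega D $[1] (a $[n] b)]/(Lmode D 0 (a $[n] b)).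
rewrite -[vomega D $[0%N] a]/(Lmode D (-1) a) -[vomega D $[1%N] a]/(Lmode D 0 a).
rewrite (L0_weight ap) (L0_weight bq) !vE vtrans => /eqP; rewrite subr_eq => /eqP ->.
rewrite (_ : 1%:Z + n - 0%N%:Z - 1 = n); last by lia.
rewrite (_ : 1%:Z + n - 1%N%:Z = n); last by lia.
rewrite (_ : 1%:Z + n - 0%N%:Z = n + 1); last by lia.
rewrite !rmorphB !rmorphD /= -!pmulrn.
by lmod_with K ltac:(ring).
Qed.

(** Applying L_0 - z to the homogeneous components multiplies them by n - z, which is nonzero for n
    >= 0 in characteristic 0. The truncation of products by conformal weight rests on this. *)
Lemma L0_eigen0 (z : int) x : z < 0 -> Lmode D 0 x = z%:~R *: x -> x = 0.
Proof.
move=> z0 xz; have [p [u [ug xu]]] := gr_span (voa_grading HD) x.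
have := @gr_free _ _ _ (voa_grading HD) p (fun n => (n%:R - z%:~R) *: u n).
have sub n : is_subspace (gr n) by exact: gr_sub (voa_grading HD) n.
have ug' n : gr n ((n%:R - z%:~R) *: u n).
  have [g0 gD] := sub n; rewrite -[X in gr n X]addr0; exact: gD.
move=> /(_ ug'); have -> : \sum_(n < p) (n%:R - z%:~R) *: u n = 0.
  transitivity (Lmode D 0 x - z%:~R *: x); last by rewrite xz subrr.
  rewrite xu (lin_sum (Lmode_lin 0)) scaler_sumr -sumrB; apply: eq_bigr => n _.
  by rewrite (L0_weight (ug n)) scalerBl.
move=> /(_ erefl) u0; rewrite xu big1 // => n _.
have /eqP := u0 n (ltn_ord n); rewrite scaler_eq0 => /orP[|/eqP //].
rewrite -[n%:R]/(n%:Z%:~R) -intrB => /eqP /int_char0; lia.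
Qed.

Lemma vprod_weight0 p q a b n : gr p a -> gr q b -> (p + q)%:Z <= n -> a $[n] b = 0.
Proof.
by move=> ap bq n_ge; apply: (L0_eigen0 _ (L0_vprod n ap bq)); lia.
Qed.

Lemma vprod_weight p q r a b n : gr p a -> gr q b -> p%:Z + q%:Z - n - 1 = r%:Z ->
  gr r (a $[n] b).
Proof. by move=> ap bq E; apply/(voa_weight HD); rewrite (L0_vprod n ap bq) E. Qed.

Lemma L0_Lmode p a n : gr p a -> Lmode D 0 (Lmode D n a) = (p%:Z - n)%:~R *: Lmode D n a.
Proof.
move=> ap; have := voa_virasoro HD 0 n a.
rewrite (L0_weight ap) (linE (Lmode_lin n)) !add0r => /eqP; rewrite subr_eq => /eqP ->.
have -> : (if n == 0 then (0 ^+ 3 - 0)%:~R / 12 * vcharge D else 0) = 0.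
  by case: ifP => _ //; rewrite expr0n subr0 /= !mul0r.
by rewrite rmorphB rmorphN /= -pmulrn; lmod_with K ltac:(ring).
Qed.

Lemma Lmode_weight0 p a n : gr p a -> p%:Z < n -> Lmode D n a = 0.
Proof. by move=> ap pn; apply: (L0_eigen0 _ (L0_Lmode n ap)); lia. Qed.

Lemma Lmode_weight p r a n : gr p a -> p%:Z - n = r%:Z -> gr r (Lmode D n a).
Proof. by move=> ap E; apply/(voa_weight HD); rewrite (L0_Lmode n ap) E. Qed.

(** The commutator formula for the mode of index 2 of the conformal vector; the translation axiom
    merges the terms of L_-1 a and L_0 a into a multiple of a_(n+1). *)
Lemma L1_vprod p a n b : gr p a ->
  Lmode D 1 (a $[n] b) = a $[n] Lmode D 1 b
    + (2 * p%:R - (n + 2)%:~R) *: a $[n + 1] b + Lmode D 1 a $[n] b.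
Proof.
move=> ap; have := vcomm 2 (vomega D) n a b.
rewrite !big_cons big_nil gbin_0 gbin_1 gbin22 // !scale1r addr0.
rewrite -[vomega D $[2] b]/(Lmode D 1 b) -[vomega D $[2] (a $[n] b)]/(Lmode D 1 (a $[n] b)).
rewrite -[vomega D $[0%N] a]/(Lmode D (-1) a) -[vomega D $[1%N] a]/(Lmode D 0 a).
rewrite -[vomega D $[2%N] a]/(Lmode D 1 a).
rewrite (L0_weight ap) !vE vtrans => /eqP; rewrite subr_eq => /eqP ->.
rewrite (_ : 2%:Z + n - 1 = n + 1); last by lia.
rewrite (_ : 2%:Z + n - 2%N%:Z = n); last by lia.
rewrite (_ : 2%:Z + n = n + 2); last by lia.
rewrite -[2%:~R]/(2%:R).
by lmod_with K ltac:(ring).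
Qed.

Lemma zero_mode_der a b n c :
  a $[0] b $[n] c = (a $[0] b) $[n] c + b $[n] a $[0] c.
Proof.
have := vcomm 0 a n b c; rewrite big_seq1 gbin_0 scale1r add0r subr0 => <-.
by rewrite subrK.
Qed.

End VertexAlgebra.

(** * Leading coefficients in the formal parameter *)

Section SubspaceType.
Variables (K : fieldType) (M : lmodType K) (X : set M) (HX : is_subspace X).

(** The closure proof is an argument so that the type [ssp] carries it and the module structure can
    be inferred from the type. *)
Definition ssp_pred of is_subspace X : {pred M} := [pred v : M | `[< X v >]].

Record ssp := SSp { ssp_val :> M; _ : ssp_val \in ssp_pred HX }.

HB.instance Definition _ := [isSub for ssp_val].
HB.instance Definition _ := [Choice of ssp by <:].

Lemma ssp_submod : submod_closed (ssp_pred HX).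
Proof.
have [X0 XD] := HX; split=> [|k u v]; first exact/asboolP.
by move=> /asboolP Xu /asboolP Xv; apply/asboolP; exact: XD.
Qed.

HB.instance Definition _ :=
  GRing.isSubmodClosed.Build K M (ssp_pred HX) ssp_submod.
HB.instance Definition _ := [SubChoice_isSubLmodule of ssp by <:].

Definition mksp (v : M) : ssp := insubd (0 : ssp) v.

Lemma mkspK v : X v -> ssp_val (mksp v) = v.
Proof. by move=> Xv; rewrite /mksp -[ssp_val _]/(val _) insubdK //; apply/asboolP. Qed.

Lemma sspP (v : ssp) : X (ssp_val v).
Proof. by case: v => v /= /asboolP. Qed.

Lemma ssp_eq (u v : ssp) : ssp_val u = ssp_val v -> u = v.
Proof. exact: val_inj. Qed.

End SubspaceType.

(** * Laurent polynomials and order in h *)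

Section Laurent.
Variables (K : fieldType) (V : lmodType K).
Local Notation L := (laurent V).

Lemma laur_lin k : lin (@laur K V k).
Proof. exact: fsdelta_lin. Qed.

Lemma laurE k (v : V) j : laur k v j = if j == k then v else 0.
Proof. by []. Qed.

Lemma laurentP (X Y : L) : (forall k, X k = Y k) -> X = Y.
Proof. exact: fsP. Qed.

Lemma hmul_lin k : lin (@hmul K V k).
Proof. by apply: fslift_lin => j; exact: laur_lin. Qed.

Lemma hmul_laur k j (v : V) : hmul k (laur j v) = laur (j + k) v.
Proof. by rewrite /hmul fslift_delta // => i; rewrite (linE (laur_lin _)). Qed.

Lemma laurent_decomp (X : L) :
  exists2 r : seq int, uniq r & X = \sum_(j <- r) laur j (X j) /\ forall j, j \notin r -> X j = 0.
Proof.
have [r r_uniq X0] := fs_supp X; exists r => //; split=> //; exact: fs_decomp.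
Qed.

Lemma hmulE k (X : L) j : hmul k X j = X (j - k).
Proof.
have [r r_uniq [XE X0]] := laurent_decomp X.
rewrite {1}XE (lin_sum (hmul_lin k)) fs_sumE.
under eq_bigr do rewrite hmul_laur laurE.
case: (boolP ((j - k) \in r)) => [jr|jr].
  rewrite (bigD1_seq (j - k)) // subrK eqxx big1 => [|i ij]; first by rewrite /= addr0.
  by case: eqP => // jE; move: ij; rewrite jE addrK eqxx.
rewrite X0 // big1_seq // => i /andP[_ ir]; case: eqP => // jE.
by move: jr; rewrite jE addrK ir.
Qed.

Lemma hpoly_lin p k (X Y : L) : hpoly p X -> hpoly p Y -> hpoly p (k *: X + Y).
Proof. by move=> pX pY j jp; rewrite fsDE fsZE pX // pY // scaler0 addr0. Qed.

Lemma hpolyD p (X Y : L) : hpoly p X -> hpoly p Y -> hpoly p (X + Y).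
Proof. by move=> pX pY; rewrite -[X]scale1r; exact: hpoly_lin. Qed.

Lemma hpolyZ p k (X : L) : hpoly p X -> hpoly p (k *: X).
Proof. by move=> pX; rewrite -[_ *: _]addr0; exact: hpoly_lin. Qed.

Lemma hpoly_le p q (X : L) : q <= p -> hpoly p X -> hpoly q X.
Proof. by move=> qp pX j jq; apply: pX; exact: lt_le_trans jq qp. Qed.

Lemma hpoly_laur k (v : V) : hpoly k (laur k v).
Proof. by move=> j jk; rewrite laurE; case: eqP jk => // ->; rewrite ltxx. Qed.

End Laurent.

(** * Products, L_-1 and L_1 to leading order in h *)

Section FormalParameter.
Variables (K : fieldType) (V : lmodType K) (Vgr : nat -> set V).
Variable D : voa_data (laurent V).
Hypothesis char0 : forall n, n.+1%:R != 0 :> K.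
Hypothesis HD : voa_formal_parameter Vgr D.
Local Notation "a $[ n ] b" := (vprod D a n b)
  (at level 35, n at level 99, right associativity).
Local Notation L := (laurent V).
Let VD := fp_voa HD.
Let vE n := bilE (vprod_bil VD n).

Lemma Vgr_sub n : is_subspace (Vgr n).
Proof. exact: gr_sub (fp_grading HD) n. Qed.

Lemma Vgr0 n : Vgr n 0. Proof. by have [] := Vgr_sub n. Qed.

Lemma laur_gr n k (v : V) : Vgr n v -> laurent_gr Vgr n (laur k v).
Proof. by move=> vn j; rewrite laurE; case: ifP => _ //; exact: Vgr0. Qed.

Lemma hmulr A n k B : A $[n] hmul k B = hmul k (A $[n] B).
Proof. exact: (fp_central HD). Qed.

(** [fp_central] moves powers of h out of the right argument; the left one is reached through h^k
    vac. Its translation is h^k L_-1 vac = 0, so the translation axiom kills every mode except -1,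
    and that mode is found by skew-symmetry. *)
Lemma hvac_mode k n B : hmul k (vvac D) $[n] B = if n == -1 then hmul k B else 0.
Proof.
have X0 m C : m != -1 -> hmul k (vvac D) $[m] C = 0.
  move=> m1; have := vtrans VD (hmul k (vvac D)) (m + 1) C.
  rewrite /Lmode hmulr (vcreate0 VD) // (linE (hmul_lin k)) vE addrK => /esym/eqP.
  rewrite oppr_eq0 scaler_eq0 => /orP[/eqP /(int_char0 char0)|/eqP //]; lia.
case: eqP => [->|/eqP]; last exact: X0.
rewrite (vskew VD (a := B)) => [|j j1]; last first.
  by rewrite hmulr (vcreate0 VD) ?(linE (hmul_lin k)) //; lia.
rewrite !hmulr (vcreate VD) (vcreate0 VD) // (linE (hmul_lin k)) (linE (Lmode_lin VD _)).
by rewrite subr0 exprN1 invrN1 scaleN1r opprK.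
Qed.

Lemma hmull k A n B : hmul k A $[n] B = hmul k (A $[n] B).
Proof.
have [p An0] := voa_trunc VD A B.
(* Associativity then applies, and of all the modes of h^k vac only -1 contributes. *)
have -> : hmul k A = hmul k (vvac D) $[-1] A by rewrite hvac_mode.
have van (j : nat) : (`|p%:Z - n|.+1 <= j)%N ->
    A $[n + j%:Z] B = 0 /\ hmul k (vvac D) $[j%:Z] B = 0.
  by move=> jp; rewrite hvac_mode An0 //; lia.
rewrite (vassoc char0 VD van) (_ : iota 0 _ = 0%N :: iota 1 `|p%:Z - n|) //.
rewrite big_cons big_seq_cond big1 => [|j].
  by rewrite !hvac_mode -[Posz 0]/(0 : int) !subr0 !addr0 eqxx /= vE addr0.
rewrite mem_iota andbT => /andP[j1 _].
by rewrite !hvac_mode ifF ?add0r ?vE //; lia.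
Qed.

(* Products of nonnegative index are O(h) on V; [cp] is the leading coefficient. *)
Definition hord (n : int) : int := if 0 <= n then 1 else 0.

Definition cp (n : int) (u v : V) : V := (laur 0 u $[n] laur 0 v) (hord n).

Lemma hpoly_vprod0 n (u v : V) : hpoly (hord n) (laur 0 u $[n] laur 0 v).
Proof.
rewrite /hord; case: ifP => [n0|_]; first exact: (fp_light HD).
by apply: (fp_Vh_closed HD); exact: hpoly_laur.
Qed.

Lemma vprod_laur i j n (u v : V) :
  laur i u $[n] laur j v = hmul (i + j) (laur 0 u $[n] laur 0 v).
Proof.
rewrite (_ : laur i u = hmul i (laur 0 u)); last by rewrite hmul_laur add0r.
rewrite (_ : laur j v = hmul j (laur 0 v)); last by rewrite hmul_laur add0r.
rewrite hmull hmulr.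
by apply: laurentP => k; rewrite !hmulE; congr (_ _); ring.
Qed.

Lemma vprod_coef (X Y : L) n : exists r r', [/\ uniq r, uniq r',
  (forall j, j \notin r -> X j = 0), (forall j, j \notin r' -> Y j = 0) &
  forall m, (X $[n] Y) m =
    \sum_(i <- r) \sum_(j <- r') (laur 0 (X i) $[n] laur 0 (Y j)) (m - (i + j))].
Proof.
have [r r_uniq [XE X0]] := laurent_decomp X; have [r' r'_uniq [YE Y0]] := laurent_decomp Y.
exists r, r'; split=> // m; rewrite {1}XE {1}YE.
rewrite (lin_sum (f := fun X => X $[n] _)); last by case: (vprod_bil VD n).
rewrite fs_sumE; apply: eq_bigr => i _.
rewrite (lin_sum (f := fun Y => _ $[n] Y)); last by case: (vprod_bil VD n).
by rewrite fs_sumE; apply: eq_bigr => j _; rewrite vprod_laur hmulE.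
Qed.

Lemma hpoly_vprod p q n (X Y : L) : hpoly p X -> hpoly q Y ->
  hpoly (p + q + hord n) (X $[n] Y).
Proof.
move=> pX qY m m_lt; have [r [r' [_ _ _ _ ->]]] := vprod_coef X Y n.
rewrite big1 // => i _; rewrite big1 // => j _.
have [ip|pi] := ltP i p; first by rewrite pX // (linE (laur_lin _)) vE.
have [jq|qj] := ltP j q; first by rewrite qY // (linE (laur_lin _)) vE.
by apply: hpoly_vprod0; lia.
Qed.

Lemma lead_vprod p q n m (X Y : L) : hpoly p X -> hpoly q Y -> m = p + q + hord n ->
  (X $[n] Y) m = cp n (X p) (Y q).
Proof.
move=> pX qY ->; have [r [r' [r_uniq r'_uniq X0 Y0 ->]]] := vprod_coef X Y n.
have sum1 (s : seq int) (F : int -> V) c : uniq s -> (forall j, j != c -> F j = 0) ->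
    (c \notin s -> F c = 0) -> \sum_(j <- s) F j = F c.
  move=> s_uniq F0 Fc; case: (boolP (c \in s)) => [cs|/[dup] cs /Fc ->].
    by rewrite (bigD1_seq c) // big1 => [|j jc]; [rewrite /= addr0|exact: F0].
  rewrite big1_seq // => j /andP[_ js]; apply: F0; apply/eqP => jc.
  by move: cs; rewrite -jc js.
have van i j : (i != p) || (j != q) ->
    (laur 0 (X i) $[n] laur 0 (Y j)) (p + q + hord n - (i + j)) = 0.
  move=> ij.
  have [ip|pi] := ltP i p; first by rewrite pX // (linE (laur_lin _)) vE.
  have [jq|qj] := ltP j q; first by rewrite qY // (linE (laur_lin _)) vE.
  by apply: hpoly_vprod0; lia.
rewrite (sum1 _ _ p) // => [|i ip|pr].
- rewrite (sum1 _ _ q) // => [|j jq|qr].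
  + by rewrite /cp; congr (_ _); ring.
  + by apply: van; rewrite jq orbT.
  + by rewrite Y0 // (linE (laur_lin _)) vE.
- by rewrite big1 // => j _; apply: van; rewrite ip.
- by rewrite big1 // => j _; rewrite X0 // (linE (laur_lin _)) vE.
Qed.

Lemma cp_bil n : bilin (cp n).
Proof.
by split=> x k y z; rewrite /cp !(linE (laur_lin _)) !vE.
Qed.

Lemma cp_gr p q r n u v : Vgr p u -> Vgr q v -> p%:Z + q%:Z - n - 1 = r%:Z -> Vgr r (cp n u v).
Proof.
move=> pu qv E; exact: (vprod_weight VD (laur_gr 0 pu) (laur_gr 0 qv) E (hord n)).
Qed.

(** The coefficients are taken at h^0 here and at h^1 in [cdiv]: L_-1 preserves V, while L_1 maps
    V^1 into hV. *)
Definition cd (u : V) : V := Lmode D (-1) (laur 0 u) 0.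
Definition cdiv (a : V) : V := Lmode D 1 (laur 0 a) 1.

Lemma cd_lin : lin cd.
Proof. by move=> k u v; rewrite /cd (laur_lin _) (Lmode_lin VD _). Qed.
Lemma cdiv_lin : lin cdiv.
Proof. by move=> k u v; rewrite /cdiv (laur_lin _) (Lmode_lin VD _). Qed.

Lemma Lmode_coef n (X : L) : exists2 r, uniq r &
  [/\ forall j, j \notin r -> X j = 0 &
   forall m, (Lmode D n X) m = \sum_(j <- r) (Lmode D n (laur 0 (X j))) (m - j)].
Proof.
have [r r_uniq [XE X0]] := laurent_decomp X; exists r => //; split=> // m.
rewrite {1}XE (lin_sum (Lmode_lin VD n)) fs_sumE; apply: eq_bigr => j _.
by rewrite -[j in laur j _]add0r -hmul_laur /Lmode hmulr hmulE.
Qed.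

Lemma Lm1E (X : L) m : (Lmode D (-1) X) m = cd (X m).
Proof.
have [r r_uniq [X0 ->]] := Lmode_coef (-1) X.
have E u j : (Lmode D (-1) (laur 0 u)) j = if j == 0 then cd u else 0.
  by rewrite /cd; have [v ->] := fp_translation HD u; rewrite !laurE.
under eq_bigr do rewrite E.
case: (boolP (m \in r)) => [mr|mr].
  rewrite (bigD1_seq m) // subrr eqxx big1 => [|j jm]; first by rewrite /= addr0.
  by rewrite subr_eq0 eq_sym (negPf jm).
rewrite X0 // (linE cd_lin) big1_seq // => j /andP[_ jr]; rewrite subr_eq0.
by case: eqP => // mj; move: mr; rewrite mj jr.
Qed.

Lemma L1E (X : L) m : laurent_gr Vgr 1 X -> (Lmode D 1 X) m = cdiv (X (m - 1)).
Proof.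
move=> Xg; have [r r_uniq [X0 ->]] := Lmode_coef 1 X.
have E u j : Vgr 1 u -> (Lmode D 1 (laur 0 u)) j = if j == 1 then cdiv u else 0.
  by move=> /(fp_L1 HD)[v E]; rewrite /cdiv E !laurE.
under eq_bigr do rewrite E //.
case: (boolP ((m - 1) \in r)) => [mr|mr].
  rewrite (bigD1_seq (m - 1)) // subKr eqxx big1 => [|j jm]; first by rewrite /= addr0.
  by rewrite subr_eq addrC -subr_eq eq_sym (negPf jm).
rewrite X0 // (linE cdiv_lin) big1_seq // => j /andP[_ jr].
by rewrite subr_eq addrC -subr_eq; case: eqP => // mj; move: mr; rewrite mj jr.
Qed.

Lemma cd_gr u : Vgr 0 u -> Vgr 1 (cd u).
Proof. by move=> u0; exact: (Lmode_weight (n := -1) (r := 1) VD (laur_gr 0 u0) erefl 0). Qed.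

Lemma cdiv_gr a : Vgr 1 a -> Vgr 0 (cdiv a).
Proof. by move=> a1; exact: (Lmode_weight (n := 1) (r := 0) VD (laur_gr 0 a1) erefl 1). Qed.

Let h0 (x : V) : hpoly 0 (laur 0 x) := @hpoly_laur _ _ 0 x.
Let l0 (x : V) : laur 0 x 0 = x. Proof. by rewrite laurE. Qed.

Let van p q (x y : L) n : laurent_gr Vgr p x -> laurent_gr Vgr q y ->
  (p + q)%:Z <= n -> x $[n] y = 0.
Proof. exact: (vprod_weight0 char0 VD). Qed.

Let van2 p q n k (x y : L) : hpoly p x -> hpoly q y -> k < p + q + hord n ->
  (x $[n] y) k = 0.
Proof. by move=> px qy; exact: hpoly_vprod px qy k. Qed.

Section Identities.
Variables u v w a b : V.
Hypotheses (u0 : Vgr 0 u) (v0 : Vgr 0 v) (w0 : Vgr 0 w).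
Hypotheses (a1 : Vgr 1 a) (b1 : Vgr 1 b).

Let lu := laur_gr 0 u0.
Let lv := laur_gr 0 v0.
Let lw := laur_gr 0 w0.
Let la := laur_gr 0 a1.
Let lb := laur_gr 0 b1.
Lemma cp_mulC : cp (-1) u v = cp (-1) v u.
Proof.
rewrite {1}/cp (vskew VD) => [|j j1]; last by apply: van lv lu _; lia.
rewrite (van lv lu (n := -1 + 1)) // (linE (Lmode_lin VD _)) subr0.
by rewrite exprN1 invrN1 scaleN1r opprK.
Qed.

(** Skew-symmetry has the correction L_-1(u_0 a), which is O(h) and disappears in the leading
    coefficient. *)
Lemma cp_actC : cp (-1) a u = cp (-1) u a.
Proof.
rewrite {1}/cp (vskew VD) => [|j j1]; last by apply: van lu la _; lia.
rewrite exprN1 invrN1 scaleN1r opprK fsDE -scaleN1r fsZE Lm1E.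
by rewrite (@hpoly_vprod0 0) // (linE cd_lin) scaler0 addr0.
Qed.

Lemma cp_ancN : cp 0 u a = - cp 0 a u.
Proof.
rewrite {1}/cp (vskew VD) => [|j j1]; last by apply: van la lu _; lia.
rewrite (van la lu (n := 0 + 1)) // (linE (Lmode_lin VD _)) subr0 expr0z scale1r.
by [].
Qed.

Lemma cp_brkC : cp 0 a b + cp 0 b a = cd (cp 1 b a).
Proof.
rewrite {1}/cp (vskew VD) => [|j j1]; last by apply: van lb la _; lia.
rewrite expr0z scale1r opprB fsDE Lm1E add0r.
by rewrite -scaleN1r fsZE scaleN1r subrK.
Qed.

Lemma cp_prgC : cp 1 a b = cp 1 b a.
Proof.
rewrite {1}/cp (vskew VD) => [|j j1]; last by apply: van lb la _; lia.
rewrite (van lb la (n := 1 + 1)) // (linE (Lmode_lin VD _)) subr0 expr1z.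
by rewrite scaleN1r opprK.
Qed.

(** A zero mode is a derivation of all products. At n = -1, 0, 1 this yields the product rule of the
    anchor, the Jacobi identity and the invariance of the pairing. *)
Lemma cp_der n (x y z : V) : cp 0 x (cp n y z) = cp n (cp 0 x y) z + cp n y (cp 0 x z).
Proof.
have E := congr1 (fun X : L => X (hord n + 1))
  (zero_mode_der VD (laur 0 x) (laur 0 y) n (laur 0 z)).
have hn X Y m : hpoly (hord m) (laur 0 X $[m] laur 0 Y) by exact: hpoly_vprod0.
have e0 : hord 0 = 1 by [].
move: E; rewrite fsDE.
rewrite (lead_vprod (h0 x) (hn y z n)) ?l0; last by rewrite e0; ring.
rewrite (lead_vprod (hn x y 0) (h0 z)) ?l0; last by rewrite e0; ring.
by rewrite (lead_vprod (h0 y) (hn x z 0)) ?l0 //; rewrite e0; ring.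
Qed.

(** Apart from u_-1 v_-1 x, every term of the associativity formula contains a product of
    nonnegative index and is O(h). *)
Lemma cp_mulA p x : (p <= 1)%N -> Vgr p x ->
  cp (-1) (cp (-1) u v) x = cp (-1) u (cp (-1) v x).
Proof.
move=> p1 px; have lx := laur_gr 0 px.
have zero (j : nat) : (2 <= j)%N ->
    laur 0 v $[(-1) + j%:Z] laur 0 x = 0 /\ laur 0 u $[j%:Z] laur 0 x = 0.
  by move=> j2; split; [apply: van lv lx _|apply: van lu lx _]; lia.
have := congr1 (fun X : L => X 0) (vassoc (gr := laurent_gr Vgr) char0 VD zero).
have hn X Y m : hpoly (hord m) (laur 0 X $[m] laur 0 Y) by exact: hpoly_vprod0.
rewrite (lead_vprod (hn u v (-1)) (h0 x)) ?l0 // => ->.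
rewrite big_cons big_seq1 !fsDE.
rewrite (lead_vprod (h0 u) (hn v x (-1))) ?l0 //.
rewrite (van2 (h0 v) (hn u x 0)) // (van2 (h0 u) (hn v x (-1 + 1))) //.
by rewrite (van2 (h0 v) (hn u x 1)) // !addr0.
Qed.

Lemma cp_anc_act : cp 0 (cp (-1) u a) w = cp (-1) u (cp 0 a w).
Proof.
have zero (j : nat) : (1 <= j)%N ->
    laur 0 a $[0 + j%:Z] laur 0 w = 0 /\ laur 0 u $[j%:Z] laur 0 w = 0.
  by move=> j2; split; [apply: van la lw _|apply: van lu lw _]; lia.
have := congr1 (fun X : L => X 1) (vassoc (gr := laurent_gr Vgr) char0 VD zero).
have hn X Y m : hpoly (hord m) (laur 0 X $[m] laur 0 Y) by exact: hpoly_vprod0.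
rewrite (lead_vprod (hn u a (-1)) (h0 w)) ?l0 // => ->.
rewrite big_seq1 !fsDE.
rewrite (lead_vprod (h0 u) (hn a w 0)) ?l0 //.
by rewrite (van lu lw) // vE addr0.
Qed.

Lemma cp_prg_act : cp 1 (cp (-1) u a) b = cp (-1) u (cp 1 a b).
Proof.
have zero (j : nat) : (1 <= j)%N ->
    laur 0 a $[1 + j%:Z] laur 0 b = 0 /\ laur 0 u $[j%:Z] laur 0 b = 0.
  by move=> j2; split; [apply: van la lb _|apply: van lu lb _]; lia.
have := congr1 (fun X : L => X 1) (vassoc (gr := laurent_gr Vgr) char0 VD zero).
have hn X Y m : hpoly (hord m) (laur 0 X $[m] laur 0 Y) by exact: hpoly_vprod0.
rewrite (lead_vprod (hn u a (-1)) (h0 b)) ?l0 // => ->.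
rewrite big_seq1 !fsDE.
rewrite (lead_vprod (h0 u) (hn a b 1)) ?l0 //.
by rewrite (van2 (h0 a) (hn u b 0)) ?addr0.
Qed.

Lemma laur_cd (x : V) : laur 0 (cd x) = Lmode D (-1) (laur 0 x).
Proof.
by apply: laurentP => k; rewrite Lm1E !laurE; case: eqP; rewrite ?(linE cd_lin).
Qed.

Lemma cp_cd n (x y : V) : cp n (cd x) y =
  (- (n%:~R *: laur 0 x $[n - 1] laur 0 y)) (hord n).
Proof. by rewrite /cp laur_cd (vtrans VD). Qed.

End Identities.

Section DerivedIdentities.
Variables u v a b : V.
Hypotheses (u0 : Vgr 0 u) (v0 : Vgr 0 v).
Hypotheses (a1 : Vgr 1 a) (b1 : Vgr 1 b).

Let lu := laur_gr 0 u0.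
Let la := laur_gr 0 a1.
Let lb := laur_gr 0 b1.
Lemma cp_brk_act : cp 0 (cp (-1) u a) b =
  cp (-1) u (cp 0 a b) + cp (-1) (cp 1 a b) (cd u) - cp (-1) (cp 0 b u) a.
Proof.
have zero (j : nat) : (2 <= j)%N ->
    laur 0 a $[0 + j%:Z] laur 0 b = 0 /\ laur 0 u $[j%:Z] laur 0 b = 0.
  by move=> j2; split; [apply: van la lb _|apply: van lu lb _]; lia.
have := congr1 (fun X : L => X 1) (vassoc (gr := laurent_gr Vgr) char0 VD zero).
have hn X Y m : hpoly (hord m) (laur 0 X $[m] laur 0 Y) by exact: hpoly_vprod0.
rewrite (lead_vprod (hn u a (-1)) (h0 b)) ?l0 // => ->.
rewrite big_cons big_seq1 !fsDE.
rewrite (lead_vprod (h0 u) (hn a b 0)) ?l0 //.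
rewrite (lead_vprod (h0 a) (hn u b 0)) ?l0 //.
rewrite (lead_vprod (h0 u) (hn a b 1)) ?l0 //.
rewrite (van lu lb (n := 1%N%:Z)) // vE addr0.
rewrite -!/(cp _ _ _) (cp_ancN u0 b1) fs0E addr0 (bilE (cp_bil _)).
rewrite (cp_actC (u := cp 0 b u)) //; last exact: (cp_gr b1 u0).
(* The remaining term is u_-2 a_1 b, and u_-2 is the mode -1 of L_-1 u. *)
rewrite -(cp_actC (u := cp 1 a b) (a := cd u)); last exact: cd_gr.
  rewrite cp_cd mulrN1z scaleN1r opprK.
  by rewrite -addrA [X in _ + X]addrC addrA.
exact: (cp_gr a1 b1).
Qed.

Lemma cp_cd_mul : cd (cp (-1) u v) = cp (-1) u (cd v) + cp (-1) v (cd u).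
Proof.
have := congr1 (fun X : L => X 0) (zero_mode_der VD (vomega D) (laur 0 u) (-1) (laur 0 v)).
rewrite -!/(Lmode D (-1) _) Lm1E fsDE -!laur_cd -!/(cp _ _ _) => ->.
by rewrite addrC (cp_actC v0) //; exact: cd_gr.
Qed.

Lemma cp_anc_cd x : cp 0 (cd u) x = 0.
Proof. by rewrite cp_cd mulr0z scale0r oppr0. Qed.

Lemma cp_prg_cd : cp 1 (cd u) a = cp 0 a u.
Proof.
rewrite cp_cd scale1r subrr -scaleN1r fsZE scaleN1r -[_ (hord 1)]/(cp 0 u a).
by rewrite cp_ancN // opprK.
Qed.

(** In the commutator of L_1 with u_-1 the term u_0 a has coefficient 2 * 0 - 1 = -1, and u_0 a = -
    a_0 u to leading order. *)
Lemma cdiv_act : cdiv (cp (-1) u a) = cp (-1) u (cdiv a) + cp 0 a u.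
Proof.
have g1 : laurent_gr Vgr 1 (laur 0 u $[-1] laur 0 a) by exact: (vprod_weight VD lu la).
have := congr1 (fun X : L => X 1) (L1_vprod char0 VD (-1) (laur 0 a) lu).
rewrite (L1E 1 g1) subrr -/(cp (-1) u a) => ->.
have -> : Lmode D 1 (laur 0 u) = 0 by exact: (Lmode_weight0 char0 VD lu).
rewrite (bilE (vprod_bil VD _)) addr0 fsDE fsZE.
have -> : 2 * 0%:R - (-1 + 2)%:~R = -1 :> K by rewrite mulr0 sub0r.
rewrite scaleN1r.
rewrite -[_ 1 in X in _ - X]/(cp 0 u a) cp_ancN // opprK; congr (_ + _).
have hL : hpoly 1 (Lmode D 1 (laur 0 a)).
  by move=> k k1; rewrite L1E // laurE; case: eqP; rewrite ?(linE cdiv_lin) //; lia.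
by rewrite (lead_vprod (h0 u) hL) ?l0.
Qed.

(** The commutator of L_1 and L_-1 is 2 L_0, which is 0 on weight 0; the central term vanishes
    because 1^3 - 1 = 0. *)
Lemma cdiv_cd : cdiv (cd u) = 0.
Proof.
have E := voa_virasoro VD 1 (-1) (laur 0 u).
have {E} := congr1 (fun X : L => X 1) E.
have -> : Lmode D 1 (laur 0 u) = 0 by exact: (Lmode_weight0 char0 VD lu).
rewrite (linE (Lmode_lin VD _)) subr0 subrr eqxx.
rewrite (L0_weight VD lu) scale0r scaler0 add0r mulr0z mul0r mul0r scale0r.
by rewrite -laur_cd.
Qed.

(** Both L_1 and the zeroth product gain one h, so coefficients of h^2 are compared. The term a_1 b
    of the commutator has coefficient 2 * 1 - 2 = 0. *)
Lemma cdiv_brk : cdiv (cp 0 a b) = cp 0 a (cdiv b) - cp 0 b (cdiv a).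
Proof.
have g1 : laurent_gr Vgr 1 (laur 0 a $[0] laur 0 b) by exact: (vprod_weight VD la lb).
have := congr1 (fun X : L => X 2) (L1_vprod char0 VD 0 (laur 0 b) la).
rewrite (L1E 2 g1) (_ : 2 - 1 = 1) // -/(cp 0 a b) => ->.
have hL x : Vgr 1 x -> hpoly 1 (Lmode D 1 (laur 0 x)).
  move=> x1 k k1; rewrite L1E ?laurE; last exact: laur_gr.
  by case: eqP; rewrite ?(linE cdiv_lin) //; lia.
have -> : 2 * 1%:R - (0 + 2)%:~R = 0 :> K by rewrite mulr1 add0r subrr.
rewrite scale0r addr0 fsDE (lead_vprod (h0 a) (hL b b1)) // (lead_vprod (hL a a1) (h0 b)) //.
by rewrite !l0 -!/(cdiv _) (cp_ancN (cdiv_gr a1) b1).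
Qed.

End DerivedIdentities.
End FormalParameter.

(** * The classical structure of light modes *)

Section LightCourant.
Variables (K : fieldType) (V : lmodType K) (Vgr : nat -> set V).
Variable D : voa_data (laurent V).
Hypothesis char0 : forall n, n.+1%:R != 0 :> K.
Hypothesis HD : voa_formal_parameter Vgr D.

Definition lw (n : nat) : lmodType K := ssp (Vgr_sub HD n).
Local Notation V0 := (lw 0).
Local Notation V1 := (lw 1).

Definition lmk n (v : V) : lw n := mksp (Vgr_sub HD n) v.
Definition lval n (v : lw n) : V := ssp_val v.

Lemma lmkK n v : Vgr n v -> lval (lmk n v) = v.
Proof. exact: mkspK. Qed.

Lemma lval_gr n (v : lw n) : Vgr n (lval v).
Proof. exact: sspP. Qed.

Lemma lval_inj n (u v : lw n) : lval u = lval v -> u = v.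
Proof. exact: ssp_eq. Qed.

Definition light : courant_data V0 V1 := {|
  mul := fun u v => lmk 0 (cp D (-1) (lval u) (lval v));
  act := fun u a => lmk 1 (cp D (-1) (lval u) (lval a));
  anc := fun a u => lmk 0 (cp D 0 (lval a) (lval u));
  brk := fun a b => lmk 1 (cp D 0 (lval a) (lval b));
  prg := fun a b => lmk 0 (cp D 1 (lval a) (lval b));
  dd := fun u => lmk 1 (cd D (lval u));
  dv := fun a => lmk 0 (cdiv D (lval a));
  lap0 := fun _ => 0;
  lap1 := fun _ => 0 |}.

Let gv n (v : lw n) : Vgr n (lval v) := lval_gr v.

Lemma lval_mul u v : lval (mul light u v) = cp D (-1) (lval u) (lval v).
Proof. by apply: lmkK; exact: (cp_gr HD (gv u) (gv v)). Qed.
Lemma lval_act u a : lval (act light u a) = cp D (-1) (lval u) (lval a).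
Proof. by apply: lmkK; exact: (cp_gr HD (gv u) (gv a)). Qed.
Lemma lval_anc a u : lval (anc light a u) = cp D 0 (lval a) (lval u).
Proof. by apply: lmkK; exact: (cp_gr HD (gv a) (gv u)). Qed.
Lemma lval_brk a b : lval (brk light a b) = cp D 0 (lval a) (lval b).
Proof. by apply: lmkK; exact: (cp_gr HD (gv a) (gv b)). Qed.
Lemma lval_prg a b : lval (prg light a b) = cp D 1 (lval a) (lval b).
Proof. by apply: lmkK; exact: (cp_gr HD (gv a) (gv b)). Qed.
Lemma lval_dd u : lval (dd light u) = cd D (lval u).
Proof. by apply: lmkK; exact: (cd_gr HD (gv u)). Qed.
Lemma lval_dv a : lval (dv light a) = cdiv D (lval a).
Proof. by apply: lmkK; exact: (cdiv_gr HD (gv a)). Qed.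

Lemma lvalD n (u v : lw n) : lval (u + v) = lval u + lval v. Proof. by []. Qed.
Lemma lvalN n (u : lw n) : lval (- u) = - lval u. Proof. by []. Qed.
Lemma lvalZ n k (u : lw n) : lval (k *: u) = k *: lval u. Proof. by []. Qed.
Lemma lval0 n : lval (0 : lw n) = 0. Proof. by []. Qed.

Definition lvalE := (lval_mul, lval_act, lval_anc, lval_brk, lval_prg, lval_dd,
  lval_dv, lvalD, lvalN, lvalZ, lval0).

Let bE n := bilE (cp_bil HD n).

Lemma light_courant : is_courant light.
Proof.
have lm (U W : lmodType K) (f : U -> W) : lin f -> lin f by [].
split.
1-5: by split=> x k y z; apply: lval_inj; rewrite !lvalE !bE.
1-2: by move=> k x y; apply: lval_inj; rewrite !lvalE ?(linE (cd_lin HD)) ?(linE (cdiv_lin HD)).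
1-2: by move=> k x y; rewrite scaler0 addr0.
- by move=> u v; apply: lval_inj; rewrite !lvalE; exact: (cp_mulC char0 HD (gv u) (gv v)).
- by move=> u v w; apply: lval_inj; rewrite !lvalE; exact: (cp_mulA char0 HD (gv u) (gv v) _ (gv w)).
- by move=> u v a; apply: lval_inj; rewrite !lvalE; exact: (cp_mulA char0 HD (gv u) (gv v) _ (gv a)).
- by move=> a b; apply: lval_inj; rewrite !lvalE; exact: (cp_prgC char0 HD (gv a) (gv b)).
- by move=> u a b; apply: lval_inj; rewrite !lvalE; exact: (cp_prg_act char0 HD (gv u) (gv a) (gv b)).
- by move=> a u v; apply: lval_inj; rewrite !lvalE; exact: (cp_der char0 HD).
- by move=> u a w; apply: lval_inj; rewrite !lvalE; exact: (cp_anc_act char0 HD (gv u) (gv w) (gv a)).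
- by move=> u v; apply: lval_inj; rewrite !lvalE; exact: (cp_cd_mul char0 HD (gv u) (gv v)).
- by move=> u a; apply: lval_inj; rewrite !lvalE; exact: (cp_prg_cd char0 HD (gv u) (gv a)).
- by move=> u a b; apply: lval_inj; rewrite !lvalE; exact: (cp_brk_act char0 HD (gv u) (gv a) (gv b)).
- move=> a b; apply: lval_inj; rewrite !lvalE (cp_prgC char0 HD (gv a) (gv b)).
  exact: (cp_brkC char0 HD (gv a) (gv b)).
- by move=> b a c; apply: lval_inj; rewrite !lvalE; exact: (cp_der char0 HD).
- by move=> u; apply: lval_inj; rewrite !lvalE (linE (cd_lin HD)).
- by move=> u; apply: lval_inj; rewrite !lvalE scaler0 oppr0; exact: (cdiv_cd char0 HD (gv u)).
- by move=> a; apply: lval_inj; rewrite !lvalE (linE (cdiv_lin HD)).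
- move=> u v; apply: lval_inj; rewrite !lvalE !bE (cp_anc_cd HD) oppr0 !addr0.
  by [].
- move=> u v; apply: lval_inj; rewrite !lvalE !bE (cp_anc_cd HD) oppr0 !addr0.
  by [].
- by move=> u a; apply: lval_inj; rewrite !lvalE; exact: (cdiv_act char0 HD (gv u) (gv a)).
- move=> a b; apply: lval_inj; rewrite !lvalE !bE oppr0 !addr0.
  exact: (cdiv_brk char0 HD (gv a) (gv b)).
Qed.

Lemma light_isotropic N (s : 'I_N -> V) (sg : forall i, Vgr 1 (s i)) :
  (forall i, primary D 1 (laur 0 (s i))) ->
  (forall i j, regular_ope D (laur 0 (s i)) (laur 0 (s j))) ->
  is_isotropic light (fun i => lmk 1 (s i)).
Proof.
move=> s_prim s_reg; split=> //.
- by move=> a b c; apply: lval_inj; rewrite !lvalE; exact: (cp_der char0 HD).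
- by move=> a b u; apply: lval_inj; rewrite !lvalE (cp_der char0 HD) addrK.
- by move=> u a; apply: lval_inj; rewrite !lvalE (cp_anc_cd HD).
- move=> i; apply: lval_inj; rewrite !lvalE lmkK // /cdiv.
  by have [_ ->] := s_prim i.
- by move=> i j; apply: lval_inj; rewrite !lvalE !lmkK // /cp s_reg.
- by move=> i j; apply: lval_inj; rewrite !lvalE !lmkK // /cp s_reg.
Qed.

End LightCourant.

(** * Products of states with polynomial ghosts *)

Section Tensor.
Variables (K : fieldType) (A : lmodType K).
Local Notation W := (gtens A).

Lemma tens_linl x : lin (fun a : A => tens a x).
Proof.
move=> k a b; have [r r_uniq x0] := fs_supp x.
rewrite /tens !(fslift_on r_uniq x0); try by move=> S; rewrite scale0r (linE (fsdelta_lin S)).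
rewrite scaler_sumr -big_split; apply: eq_bigr => S _.
by rewrite scalerDr scalerA [_ * k]mulrC -scalerA (fsdelta_lin S).
Qed.

Lemma tens_linr a : lin (@tens K A a).
Proof.
by apply: fslift_lin => S k u v; rewrite -(fsdelta_lin S) scalerA -scalerDl.
Qed.

Lemma tens_bil : bilin (@tens K A).
Proof. by split; [exact: tens_linl|exact: tens_linr]. Qed.

Lemma tens_fe a S : tens a (fe K S) = fsdelta S a :> W.
Proof.
by rewrite /tens fslift_delta ?scale1r // => T; rewrite scale0r (linE (fsdelta_lin T)).
Qed.

(** Distinct canonical words index distinct basis vectors, so such a list serves as a coordinate
    system in which products become finite tables. *)
Definition wok (ws : seq (seq nat)) : bool := all canon ws && uniq ws.

Definition wsum (ws : seq (seq nat)) (l : seq A) : W :=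
  \sum_(i <- iota 0 (size ws)) tens (nth 0 l i) (dw K (nth [::] ws i)).

Lemma wsum_delta ws l : wok ws -> wsum ws l =
  \sum_(i <- iota 0 (size ws)) fsdelta (Fw (nth [::] ws i)) (nth 0 l i).
Proof.
move=> /andP[/allP wc _]; apply: eq_big_seq => i; rewrite mem_iota => /andP[_ i_lt].
by rewrite dw_fe ?tens_fe //; apply: wc; apply: mem_nth.
Qed.

Lemma fslift_wsum (M : lmodType K) (g : {fset int} -> A -> M) ws l : wok ws ->
  (forall S, g S 0 = 0) -> fslift g (wsum ws l) =
  \sum_(i <- iota 0 (size ws)) g (Fw (nth [::] ws i)) (nth 0 l i).
Proof.
move=> wsok g0; have /andP[/allP wc wu] := wsok.
rewrite wsum_delta //; set x := \sum_(i <- _) _.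
have injF : {in iota 0 (size ws) &, injective (fun i => Fw (nth [::] ws i))}.
  move=> i j; rewrite !mem_iota => /andP[_ i_lt] /andP[_ j_lt] E.
  apply/eqP; rewrite -(nth_uniq [::] i_lt j_lt wu); apply/eqP; apply: Fw_inj E.
    exact/wc/mem_nth.
  exact/wc/mem_nth.
rewrite (@fslift_on _ _ _ _ _ _ [seq Fw (nth [::] ws i) | i <- iota 0 (size ws)]) //.
- rewrite big_map; apply: eq_big_seq => i ii; congr (g _ _).
  rewrite /x fs_sumE (bigD1_seq i) ?iota_uniq // fsdeltaE eqxx big1_seq => [|j /andP[ji jj]].
    by rewrite /= addr0.
  by rewrite fsdeltaE; case: eqP => // /(injF _ _ ii jj) ij; rewrite ij eqxx in ji.
- by rewrite map_inj_in_uniq ?iota_uniq.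
- move=> S S_notin; rewrite /x fs_sumE big1_seq // => j /andP[_ jj].
  by rewrite fsdeltaE; case: eqP => // SE; case/negP: S_notin; rewrite SE; apply: map_f.
Qed.

Lemma fe_field_Fw w n x : canon w -> fe_field (Fw w) n x = fock_field (map cint w) n x :> fock K.
Proof. by move=> cw; rewrite /fe_field enum_Fw. Qed.

Lemma ghost_op_wsum (g : fock K -> fock K) ws l : wok ws -> ghost_op g (wsum ws l) =
  \sum_(i <- iota 0 (size ws)) tens (nth 0 l i) (g (dw K (nth [::] ws i))) :> W.
Proof.
move=> wsok; rewrite /ghost_op fslift_wsum // => [|S]; last by rewrite (bilE tens_bil).
have /andP[/allP wc _] := wsok.
apply: eq_big_seq => i; rewrite mem_iota => /andP[_ i_lt].
by rewrite dw_fe //; apply: wc; apply: mem_nth.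
Qed.

Lemma card_Fw w : canon w -> #|` Fw w| = size w.
Proof.
move=> cw; rewrite -(size_map cint) -enum_Fw // size_sort; by [].
Qed.

Lemma gpart_wsum e ws l : wok ws -> gpart e (wsum ws l) =
  \sum_(i <- iota 0 (size ws)) (if odd (size (nth [::] ws i)) == e
    then tens (nth 0 l i) (dw K (nth [::] ws i)) else 0) :> W.
Proof.
move=> wsok; rewrite /gpart fslift_wsum // => [|S]; last first.
  by case: ifP => _ //; rewrite (linE (fsdelta_lin S)).
have /andP[/allP wc _] := wsok.
apply: eq_big_seq => i; rewrite mem_iota => /andP[_ i_lt].
have cw : canon (nth [::] ws i) by apply: wc; apply: mem_nth.
by rewrite card_Fw // dw_fe // tens_fe.
Qed.

End Tensor.

(** * Products as finite tables *)

Section Products.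
Variables (K : fieldType) (A : lmodType K) (D : voa_data A) (gr : nat -> set A).
Hypothesis char0 : forall n, n.+1%:R != 0 :> K.
Hypothesis VD : is_voa D gr.
Local Notation W := (gtens A).
Let vE n := bilE (vprod_bil VD n).
Let tE := bilE (tens_bil A).

Let inner0 n S a T (b : A) : (a = 0) \/ (b = 0) ->
  \sum_(k \in [set: int]) tens (vprod D a k b) (fe_field S (n - 1 - k) (fe K T)) = 0.
Proof.
by move=> ab; rewrite fsbig1 // => k _; case: ab => ->; rewrite vE tE.
Qed.

Lemma wprod_wsum ws l n ws' l' : wok ws -> wok ws' ->
  wprod D (wsum ws l) n (wsum ws' l') =
  \sum_(i <- iota 0 (size ws)) \sum_(j <- iota 0 (size ws'))
   \sum_(k \in [set: int]) tens (vprod D (nth 0 l i) k (nth 0 l' j))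
     (fock_field (map cint (nth [::] ws i)) (n - 1 - k) (dw K (nth [::] ws' j))).
Proof.
move=> ok ok'; rewrite /wprod fslift_wsum // => [|S]; last first.
  by rewrite fslift_wsum // => [|T]; [rewrite big1 // => j _|]; apply: inner0; auto.
have /andP[/allP wc _] := ok; have /andP[/allP wc' _] := ok'.
apply: eq_big_seq => i; rewrite mem_iota => /andP[_ i_lt].
rewrite fslift_wsum // => [|T]; last by apply: inner0; auto.
apply: eq_big_seq => j; rewrite mem_iota => /andP[_ j_lt].
apply: eq_fsbigr => k _; rewrite fe_field_Fw; last by apply: wc; apply: mem_nth.
by rewrite dw_fe //; apply: wc'; apply: mem_nth.
Qed.

(** The sum over k is cut on both sides: below n by the regularity of the ghost field, from n + P on
    by the vanishing of a_k b. *)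
Lemma wprod_pair a b w x n (P : nat) : regular_state x ->
  (forall k, n + P%:Z <= k -> vprod D a k b = 0) ->
  \sum_(k \in [set: int]) tens (vprod D a k b) (fock_field (map cint w) (n - 1 - k) x) =
  \sum_(p <- iota 0 P) tens (vprod D a (n + p%:Z) b) (cprod w p x) :> W.
Proof.
move=> rx van.
rewrite (@fsumE _ _ [seq n + p%:Z | p <- iota 0 P]).
- rewrite big_map; apply: eq_bigr => p _; rewrite fock_field_c // ifT; last by lia.
  by congr (tens _ (cprod _ _ _)); lia.
- by rewrite map_inj_uniq ?iota_uniq // => p q; lia.
- move=> k k_notin; have [nk|kn] := leP n k.
    rewrite van ?tE //; apply: contraNT k_notin; rewrite -ltNge => k_lt.
    by apply/mapP; exists (absz (k - n)); rewrite ?mem_iota; lia.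
  by rewrite fock_field_c // ifF ?tE //; lia.
Qed.

(* [(i, j, p, (e, k, w))] stands for the term (-1)^e k w of the product of the
   i-th and j-th words that goes with the p-th mode. *)
Definition wtable (P : nat -> nat -> nat) (ws ws' : seq (seq nat)) (wt wt' : seq nat) :
    seq (nat * nat * nat * (bool * nat * seq nat)) :=
  flatten [seq flatten [seq flatten [seq
    [seq (i, j, p, t) | t <- cev (nth [::] ws i) p (nth [::] ws' j)]
    | p <- iota 0 (P (nth 0%N wt i) (nth 0%N wt' j))]
    | j <- iota 0 (size ws')] | i <- iota 0 (size ws)].

Definition has_weights (wt : seq nat) (l : seq A) : Prop :=
  forall i, gr (nth 0%N wt i) (nth 0 l i).

Lemma wprod_table n P ws ws' wt wt' l l' : wok ws -> wok ws' ->
  has_weights wt l -> has_weights wt' l' ->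
  (forall i j, (i + j)%:Z <= n + (P i j)%:Z) ->
  wprod D (wsum ws l) n (wsum ws' l') =
  \sum_(t <- wtable P ws ws' wt wt') ((-1) ^+ t.2.1.1 * t.2.1.2%:R) *:
    tens (vprod D (nth 0 l t.1.1.1) (n + t.1.2%:Z) (nth 0 l' t.1.1.2)) (dw K t.2.2).
Proof.
move=> ok ok' lw lw' Pn; rewrite wprod_wsum //.
rewrite big_flatten big_map; apply: eq_bigr => i _.
rewrite big_flatten big_map; apply: eq_bigr => j _.
rewrite (@wprod_pair _ _ _ _ _ (P (nth 0%N wt i) (nth 0%N wt' j))); first last.
- move=> k k_ge; apply: (vprod_weight0 char0 VD (lw i) (lw' j)).
  exact: le_trans (Pn _ _) k_ge.
- exact: regular_dw.
rewrite big_flatten big_map; apply: eq_bigr => p _.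
rewrite big_map cprod_ev (lin_sum (tens_linr _)); apply: eq_bigr => t _.
by rewrite tE.
Qed.

Lemma wprod_high n ws ws' wt wt' l l' : wok ws -> wok ws' ->
  has_weights wt l -> has_weights wt' l' ->
  (forall i j, (nth 0%N wt i + nth 0%N wt' j)%:Z <= n) ->
  wprod D (wsum ws l) n (wsum ws' l') = 0.
Proof.
move=> ok ok' lw lw' Pn; rewrite wprod_wsum // big1 // => i _; rewrite big1 // => j _.
rewrite (@wprod_pair _ _ _ _ _ 0) ?big_nil //; first exact: regular_dw.
move=> k k_ge; apply: (vprod_weight0 char0 VD (lw i) (lw' j)); apply: le_trans (Pn i j) _.
by rewrite addr0 in k_ge.
Qed.

Lemma wprod0 x n : wprod D x n 0 = 0.
Proof.
rewrite /wprod /fslift fsbig1 // => S _; rewrite fsbig1 // => T _.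
by apply: inner0; auto.
Qed.

End Products.

(** * The Lian-Zuckerman operations on light modes *)

Definition par6 (K : fieldType) (V0 V1 : lmodType K) (e : bool) (x : six V0 V1) :
    six V0 V1 :=
  if e then mk6 0 (six1 x) (six1' x) 0 0 (six3 x)
  else mk6 (six0 x) 0 0 (six2 x) (six2' x) 0.

Section ExactOperations.
Variables (K : fieldType) (A : lmodType K) (D : voa_data A) (gr : nat -> set A).
Hypothesis char0 : forall n, n.+1%:R != 0 :> K.
Hypothesis VD : is_voa D gr.
Local Notation W := (gtens A).
Local Notation "a $[ n ] b" := (vprod D a n b)
  (at level 35, n at level 99, right associativity).
Let vE n := bilE (vprod_bil VD n).
Let tE := bilE (tens_bil A).
Let two : 2 != 0 :> K := char0 1.

Definition light_words : seq (seq nat) :=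
  [:: [::]; [:: 0]; [:: 1]; [:: 1; 0]; [:: 2; 0]; [:: 2; 1; 0]]%N.
Definition light_weights : seq nat := [:: 0; 1; 0; 1; 0; 0]%N.

Definition embL (x : six A A) : W :=
  tens (six0 x) (gvac K) + (tens (six1 x) (st_c K) + tens (six1' x) (st_dc K))
  + (tens (six2 x) (st_cdc K) + tens (six2' x) (st_cd2c K))
  + tens (six3 x) (st_cdcd2c K).

(** The coefficients of [embL] against [light_words]: decreasing order of the letters costs a sign,
    and \partial^2 c is twice a divided derivative. *)
Definition embl (x : six A A) : seq A :=
  [:: six0 x; six1 x; six1' x; - six2 x; - (2 *: six2' x); - (2 *: six3 x)].

Lemma st_cE : st_c K = dw K [:: 0%N]. Proof. by []. Qed.
Lemma st_dcE : st_dc K = dw K [:: 1%N]. Proof. by []. Qed.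
Lemma st_cdcE : st_cdc K = - dw K [:: 1%N; 0%N].
Proof. exact: (@dcC K 0 1 (gvac K)). Qed.
Lemma st_d2cE : st_d2c K = 2 *: dw K [:: 2%N]. Proof. by []. Qed.
Lemma st_cd2cE : st_cd2c K = - (2 *: dw K [:: 2%N; 0%N]).
Proof.
rewrite /st_cd2c st_d2cE -[c_ 1 _]/(dc 0 _) (linE (@dc_lin K 0)) -scalerN.
congr (_ *: _); exact: (@dcC K 0 2 (gvac K)).
Qed.
Lemma st_cdcd2cE : st_cdcd2c K = - (2 *: dw K [:: 2%N; 1%N; 0%N]).
Proof.
rewrite /st_cdcd2c st_d2cE -[c_ 1 _]/(dc 0 (dc 1 _)) !(linE (@dc_lin K _)) -scalerN.
congr (_ *: _); rewrite -[dc 0 _]/(dw K [:: 0; 1; 2]%N) cnorm_val.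
by rewrite -[RHS]scaleN1r.
Qed.

Definition stE := (st_cE, st_dcE, st_cdcE, st_d2cE, st_cd2cE, st_cdcd2cE).

Lemma embLE x : embL x = wsum light_words (embl x).
Proof.
rewrite /embL !stE /wsum /= !big_cons big_nil /= -[gvac K]/(dw K [::]) !tE.
by lmod_with K ltac:(ring).
Qed.

Lemma embL_lin : lin embL.
Proof.
move=> k; apply: six_mk => x0 x1 y1 x2 y2 x3; apply: six_mk => u0 u1 v1 u2 v2 u3.
rewrite mk6Z mk6D /embL !mk6E !tE.
by lmod_with K ltac:(ring).
Qed.

Definition six_gr (x : six A A) : Prop :=
  [/\ gr 0 (six0 x), gr 1 (six1 x), gr 0 (six1' x), gr 1 (six2 x) &
      gr 0 (six2' x) /\ gr 0 (six3 x)].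

Lemma gr_lin n k a b : gr n a -> gr n b -> gr n (k *: a + b).
Proof. by move=> an bn; have [_] := gr_sub (voa_grading VD) n; apply. Qed.
Lemma gr0 n : gr n 0. Proof. by have [] := gr_sub (voa_grading VD) n. Qed.
Lemma grD n a b : gr n a -> gr n b -> gr n (a + b).
Proof. by move=> an bn; rewrite -[a]scale1r; exact: gr_lin. Qed.
Lemma grZ n k a : gr n a -> gr n (k *: a).
Proof. by move=> an; rewrite -[_ *: _]addr0; apply: gr_lin => //; exact: gr0. Qed.
Lemma grN n a : gr n a -> gr n (- a).
Proof. by move=> an; rewrite -scaleN1r; exact: grZ. Qed.

Lemma embl_weights x : six_gr x -> has_weights gr light_weights (embl x).
Proof.
case=> g0 g1 g1' g2 [g2' g3] [|[|[|[|[|[|i]]]]]] //=.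
- exact: grN.
- by apply: grN; exact: grZ.
- by apply: grN; exact: grZ.
- by rewrite nth_nil (nth_default 0) //; exact: gr0.
Qed.

(** Exact in h. The terms without counterpart in [mu6], such as [six1' x $[0] six1 y], are of higher
    order than their component records. *)
Definition muL (x y : six A A) : six A A :=
  mk6 (six0 x $[-1] six0 y)
    (six0 x $[-1] six1 y + six1 x $[-1] six0 y)
    (six0 x $[-1] six1' y + six1' x $[-1] six0 y + six1 x $[0] six0 y)
    (six0 x $[-1] six2 y + six2 x $[-1] six0 y - six1 x $[0] six1 y
       + six1 x $[-1] six1' y - six1' x $[-1] six1 y)
    (six0 x $[-1] six2' y + six2' x $[-1] six0 y - 2^-1 *: six1 x $[1] six1 y
       - six1' x $[0] six1 y + six2 x $[0] six0 y)
    (six0 x $[-1] six3 y + six3 x $[-1] six0 y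
       + (2^-1 *: six1 x $[1] six2 y - six1 x $[0] six2' y
          - six1' x $[-1] six2' y + six1' x $[0] six2 y)
       + (2^-1 *: six2 x $[1] six1 y + six2' x $[0] six1 y
          - six2' x $[-1] six1' y - six2 x $[0] six1' y)).

(** The table mentions neither the scalars nor the coefficients, only indices, signs and words; it
    is a closed term that evaluation reduces to a list. *)
Local Ltac table_eval :=
  match goal with |- context [wtable ?P ?ws ?ws' ?wt ?wt'] =>
    let l := eval vm_compute in (wtable P ws ws' wt wt') in
    change (wtable P ws ws' wt wt') with l end;
  rewrite ?big_cons ?big_nil; cbn [nth fst snd embl];
  rewrite ?[_ ^+ false]expr0 ?[_ ^+ true]expr1;
  rewrite -?[-1 + Posz 0]/(-1 : int) -?[-1 + Posz 1]/(0 : int) -?[-1 + Posz 2]/(1 : int)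
    -?[0 + Posz 0]/(0 : int) -?[0 + Posz 1]/(1 : int);
  rewrite ?vE ?tE.

Lemma lz_mu_embL x y : six_gr x -> six_gr y -> lz_mu D (embL x) (embL y) = embL (muL x y).
Proof.
move=> gx gy; rewrite /lz_mu !embLE.
rewrite (wprod_table (P := fun i j => (i + j + 1)%N) char0 VD _ _
  (embl_weights gx) (embl_weights gy)) //; last by move=> i j; lia.
rewrite -embLE /embL !stE -[gvac K]/(dw K [::]) /muL !mk6E; table_eval.
by lmod_with K ltac:(first [ring | by field]).
Qed.

(* The zeroth product has conformal weight -1, where only c and c \partial c
   occur. *)
Definition dot_c (x y : six A A) : A := six0 x $[0] six1 y + six1 x $[0] six0 y.
Definition dot_cdc (x y : six A A) : A :=
  six0 x $[0] six2 y + six2 x $[0] six0 y + six1 x $[0] six1' y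
  - six1' x $[0] six1 y - six1 x $[1] six1 y.

Definition low_words : seq (seq nat) := [:: [:: 0]; [:: 1; 0]]%N.
Definition dotL (x y : six A A) : W := wsum low_words [:: dot_c x y; - dot_cdc x y].

Lemma wprod0_embL x y : six_gr x -> six_gr y -> wprod D (embL x) 0 (embL y) = dotL x y.
Proof.
move=> gx gy; rewrite !embLE.
rewrite (wprod_table (P := fun i j => (i + j)%N) char0 VD _ _
  (embl_weights gx) (embl_weights gy)) //.
table_eval; rewrite /dotL /wsum !big_cons big_nil /= /dot_c /dot_cdc ?tE.
by lmod_with K ltac:(first [ring | by field]).
Qed.

(** Such a product has conformal weight at most -2, while words in c have weight at least -1 and
    matter at least 0. Hence only i = 0 survives in the series defining m and n. *)
Lemma wprodS_embL x y (i : nat) : six_gr x -> six_gr y ->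
  wprod D (embL x) i.+1%:Z (embL y) = 0.
Proof.
move=> gx gy; rewrite !embLE; case: i => [|i].
  rewrite (wprod_table (P := fun i j => (i + j - 1)%N) char0 VD _ _
    (embl_weights gx) (embl_weights gy)) //; last by move=> i j; lia.
  by table_eval.
apply: (wprod_high char0 VD _ _ (embl_weights gx) (embl_weights gy)) => // j k.
have wt n : (nth 0%N light_weights n <= 1)%N.
  by case: n => [|[|[|[|[|[|n]]]]]] //=; rewrite nth_nil.
by have := wt j; have := wt k; lia.
Qed.

Lemma dot_gr x y : six_gr x -> six_gr y -> gr 0 (dot_c x y) /\ gr 0 (dot_cdc x y).
Proof.
case=> g0 g1 g1' g2 [g2' g3] [k0 k1 k1' k2 [k2' k3]].
split; rewrite /dot_c /dot_cdc; do ?[apply: grD | apply: grN].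
all: by apply: (vprod_weight VD); eauto.
Qed.

(** The mode b_(q-1), acting as contraction with \partial^q c / q!. *)
Definition da (q : nat) : fock K -> fock K := @fannih K (cint q).

Lemma da_dc q j x : da q (dc j x) = (if eqn q j then x else 0) - dc j (da q x).
Proof.
rewrite dcE /da fannih_create; congr (_ - _).
by rewrite (inj_eq cint_inj) eqnE.
Qed.

Lemma da_vac q : da q (gvac K) = 0. Proof. exact: fannih_vac. Qed.

Lemma da_lin q : lin (da q). Proof. exact: fannih_lin. Qed.

Let dE := (fun j => linE (@dc_lin K j), fun q => linE (da_lin q), subr0, sub0r, oppr0).

Lemma bm1_wsum ws (l : seq A) : wok ws -> bm1 (wsum ws l) =
  \sum_(i <- iota 0 (size ws)) tens (nth 0 l i) (da 0 (dw K (nth [::] ws i))).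
Proof. exact: ghost_op_wsum. Qed.

Definition bm1_words : seq (seq nat) := [:: [::]; [:: 1]; [:: 2]; [:: 2; 1]]%N.
Definition bm1_weights : seq nat := [:: 1; 1; 0; 0]%N.
Definition bm1_list (x : six A A) : seq A :=
  [:: six1 x; six2 x; 2 *: six2' x; - (2 *: six3 x)].

Local Ltac da_eval := cbn [nth dw foldr]; rewrite ?da_dc ?da_vac /= ?dE ?opprK.

Lemma bm1_embL x : bm1 (embL x) = wsum bm1_words (bm1_list x).
Proof.
rewrite embLE bm1_wsum // /wsum !big_cons !big_nil; da_eval; rewrite ?tE.
by lmod_with K ltac:(ring).
Qed.

Lemma bm1_weightsP x : six_gr x -> has_weights gr bm1_weights (bm1_list x).
Proof.
case=> g0 g1 g1' g2 [g2' g3] [|[|[|[|i]]]] //=.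
- exact: grZ.
- by apply: grN; exact: grZ.
- by rewrite nth_nil (nth_default 0) //; exact: gr0.
Qed.

Definition low_weights : seq nat := [:: 0; 0]%N.

Lemma dotL_weights x y : six_gr x -> six_gr y ->
  has_weights gr low_weights [:: dot_c x y; - dot_cdc x y].
Proof.
move=> gx gy; have [d0 d1] := dot_gr gx gy; case=> [|[|i]] //=; first exact: grN.
by rewrite !nth_nil; exact: gr0.
Qed.

Lemma wsum_nil : wsum [::] [::] = 0 :> W.
Proof. by rewrite /wsum /= big_nil. Qed.

Lemma wprod0l y n : wprod D 0 n y = 0.
Proof.
rewrite -{1}wsum_nil /wprod fslift_wsum /= ?big_nil // => S.
by rewrite /fslift fsbig1 // => T _; rewrite fsbig1 // => k _; rewrite vE tE.
Qed.

Lemma bm10 : bm1 (0 : W) = 0.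
Proof.
by rewrite -{1}wsum_nil bm1_wsum //= big_nil.
Qed.

Lemma lz_m_embL x y : six_gr x -> six_gr y ->
  lz_m D (embL x) (embL y) = embL (mk6 (dot_c x y) 0 (dot_cdc x y) 0 0 0).
Proof.
move=> gx gy; rewrite /lz_m (@fsumE _ _ [:: 0%N]) // => [|[|i]] //; last first.
  by move=> _; rewrite wprodS_embL // wprod0l bm10 scaler0.
rewrite big_seq1 expr0 divr1 scale1r wprod0_embL //.
have -> : wvac D = wsum [:: [::]] [:: vvac D].
  by rewrite /wsum /= big_seq1.
have vac_weights : has_weights gr [:: 0%N] [:: vvac D].
  move=> [|i] /=; last by rewrite !nth_nil; exact: gr0.
  by apply/(voa_weight VD); rewrite /Lmode (vcreate0 VD) // scale0r.
rewrite /dotL (wprod_table (n := -1) (P := fun i j => (i + j + 1)%N) char0 VD _ _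
  (dotL_weights gx gy) vac_weights) //; last by move=> i j; lia.
table_eval; rewrite !(vcreate VD).
rewrite [X in bm1 X](_ : _ = dotL x y); last first.
  by rewrite /dotL /wsum !big_cons big_nil /= ?tE; lmod_with K ltac:(ring).
rewrite /dotL bm1_wsum // !big_cons big_nil; da_eval.
by rewrite /embL !mk6E !stE ?tE /dw /=; lmod_with K ltac:(ring).
Qed.

Definition tL (x : six A A) (c d : A) : six A A :=
  mk6 0 (six1 x $[-1] c) 0 (six1 x $[-1] d - six2 x $[-1] c)
    (- (six2 x $[0] c) - six2' x $[-1] c)
    (six2 x $[0] d + six2' x $[-1] d + six3 x $[-1] c).

Lemma wprod_bm1_dotL x y z : six_gr x -> six_gr y -> six_gr z ->
  wprod D (bm1 (embL x)) (-1) (dotL y z) = embL (tL x (dot_c y z) (dot_cdc y z)).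
Proof.
move=> gx gy gz; rewrite bm1_embL; have := dotL_weights gy gz; rewrite /dotL.
move: (dot_c y z) (dot_cdc y z) => c d wcd.
rewrite (wprod_table (P := fun i j => (i + j + 1)%N) char0 VD _ _
  (bm1_weightsP gx) wcd) //; last by move=> i j; lia.
rewrite /bm1_list; table_eval; rewrite /tL /embL !mk6E !stE ?tE.
by lmod_with K ltac:(first [ring | by field]).
Qed.

Lemma lz_n_half x y z : six_gr x -> six_gr y -> six_gr z ->
  \sum_(i \in [set: nat]) i.+1%:R^-1 *:
     wprod D (bm1 (embL x)) (- i%:Z - 1) (wprod D (embL y) i%:Z (embL z)) =
  embL (tL x (dot_c y z) (dot_cdc y z)).
Proof.
move=> gx gy gz; rewrite (@fsumE _ _ [:: 0%N]) // => [|[|i]] //; last first.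
  by move=> _; rewrite wprodS_embL // (wprod0 VD) scaler0.
rewrite big_seq1 invr1 scale1r wprod0_embL //.
exact: wprod_bm1_dotL.
Qed.

Lemma par6_gr e x : six_gr x -> six_gr (par6 e x).
Proof.
by case=> g0 g1 g1' g2 [g2' g3]; case: e; split; rewrite ?mk6E //; try split; rewrite ?mk6E //;
  exact: gr0.
Qed.

Lemma gpart_embL e x : gpart e (embL x) = embL (par6 e x).
Proof.
rewrite !embLE gpart_wsum // /wsum !big_cons !big_nil; cbn [nth embl].
by case: e; rewrite !mk6E /= ?tE ?scaler0 ?oppr0 ?tE.
Qed.

Definition nL (x y z : six A A) : six A A :=
  tL x (dot_c y z) (dot_cdc y z) +
  \sum_(e : bool) \sum_(e' : bool) (-1) ^+ (e && e') *:
    tL (par6 e' y) (dot_c (par6 e x) z) (dot_cdc (par6 e x) z).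

Lemma lz_n_embL x y z : six_gr x -> six_gr y -> six_gr z ->
  lz_n D (embL x) (embL y) (embL z) = embL (nL x y z).
Proof.
move=> gx gy gz; rewrite /lz_n /nL (linE embL_lin); congr (_ + _); first exact: lz_n_half.
rewrite (lin_sum embL_lin); apply: eq_bigr => e _.
rewrite (lin_sum embL_lin); apply: eq_bigr => e' _.
rewrite (linE embL_lin) !gpart_embL; congr (_ *: _).
by apply: lz_n_half => //; exact: par6_gr.
Qed.

Definition zmap (a : A) (x : six A A) : six A A :=
  mk6 (a $[0] six0 x) (a $[0] six1 x) (a $[0] six1' x)
      (a $[0] six2 x) (a $[0] six2' x) (a $[0] six3 x).

(** b_-1 strips the ghost from ca, so the residue is the zero mode of a; the sign is (-1)^|ca|. *)
Lemma lz_bracket_embL a x : gr 1 a -> six_gr x ->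
  lz_bracket D (tens a (st_c K)) (embL x) = - embL (zmap a x).
Proof.
move=> ga gx; have -> : tens a (st_c K) = embL (mk6 0 a 0 0 0 0).
  by rewrite /embL !mk6E !tE !addr0 add0r.
rewrite /lz_bracket big_bool /= !gpart_embL.
rewrite [X in _ + X](_ : _ = 0); last first.
  rewrite (_ : embL _ = 0); first by rewrite bm10 wprod0l scaler0.
  by rewrite /embL !mk6E !tE !addr0.
rewrite addr0 expr1 scaleN1r bm1_embL; congr (- _).
rewrite (_ : wsum _ _ = wsum [:: [::]] [:: a]); last first.
  by rewrite /wsum /= !big_cons !big_nil /= !mk6E !scaler0 oppr0 !tE !addr0.
have a_weights : has_weights gr [:: 1%N] [:: a].
  by move=> [|i] //=; rewrite !nth_nil; exact: gr0.
rewrite [embL x]embLE (wprod_table (P := fun i j => (i + j)%N) char0 VD _ _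
  a_weights (embl_weights gx)) //.
table_eval; rewrite /zmap /embL !mk6E !stE -[gvac K]/(dw K [::]) ?tE.
by lmod_with K ltac:(first [ring | by field]).
Qed.
End ExactOperations.

(** * The BRST operator on light modes *)

Section Brst.
Variables (K : fieldType) (A : lmodType K) (D : voa_data A) (gr : nat -> set A).
Hypothesis char0 : forall n, n.+1%:R != 0 :> K.
Hypothesis VD : is_voa D gr.
Local Notation W := (gtens A).
Local Notation "a $[ n ] b" := (vprod D a n b)
  (at level 35, n at level 99, right associativity).
Let vE n := bilE (vprod_bil VD n).
Let tE := bilE (tens_bil A).
Let two : 2 != 0 :> K := char0 1.

(** The labels 0, 1, 2 are the creators c_0, c_1, b_-2; putting them in increasing order exchanges
    c_1 and c_0, whence the sign in [st_cdcbE]. *)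
Definition cdcb_set : {fset int} := [fset x in [:: 0; 1; 2]]%fset.

Lemma st_cdcbE : st_cdcb K = - fe K cdcb_set.
Proof. by rewrite -fcreate_word // -[RHS]fcreateC. Qed.

Lemma brst_stateE : brst_state D =
  fsdelta (Fw [:: 0%N]) (vomega D) + fsdelta cdcb_set (- vvac D)
  + fsdelta (Fw [:: 2%N]) (3 *: vvac D) :> W.
Proof.
rewrite /brst_state tE st_cdcbE st_cE st_d2cE !tE !dw_fe // !tens_fe.
rewrite scalerA divfK // (linE (fsdelta_lin _)) (linE (fsdelta_lin _)).
by rewrite addrA.
Qed.

(* The mode of the field of c \partial c b whose index is 0. *)
Definition cdcb0 (x : fock K) : fock K :=
  \sum_(i <- iota 0 3) \sum_(l <- iota 0 3)
    i.+1%:R *: dc (1 + i) (dc l (da (i + l) x)).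

Lemma daE (n : nat) y : @b_ K (n%:Z - 1) y = da n y.
Proof. by rewrite /b_ ifF; [rewrite /da /cint opprB|lia]. Qed.

Lemma b_field_mode (n : nat) y : fock_field [:: 2%:Z] n%:Z y = da n y :> fock K.
Proof.
rewrite [fock_field _]/(normal_order (@b_field K) 0 false (fock_field [::])) /normal_order.
have term (i : nat) : b_field (- 1 - 0%N%:Z - i%:Z) (fock_field [::] (n%:Z + i%:Z) y)
    + (-1) ^+ (0 + false) *: fock_field [::] (n%:Z - 1 - 0%N%:Z - i%:Z) (b_field i%:Z y)
    = if i == n then da n y else 0.
  rewrite /fock_field (_ : n%:Z + i%:Z == -1 = false); last by lia.
  rewrite /b_field (linE (b_lin _)) add0r expr0 scale1r -daE.
  by case: eqP => [E|E]; case: eqP => // E'; [congr (b_ _ _)|..]; lia.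
rewrite (@fsumE _ _ [:: n]) // => [|i]; first by rewrite big_seq1 term eqxx binn scale1r.
by rewrite inE term => /negPf ->; rewrite scaler0.
Qed.

Lemma b_field0 m : fock_field [:: 2%:Z] m 0 = 0 :> fock K.
Proof.
rewrite [fock_field _]/(normal_order (@b_field K) 0 false (fock_field [::])) /normal_order.
rewrite fsbig1 // => i _; rewrite /fock_field /b_field (linE (b_lin (i%:Z - 1))) !if_same.
by rewrite (linE (b_lin _)) scaler0 addr0 scaler0.
Qed.

Lemma cb_field0 m : fock_field [:: 1; 2%:Z] m 0 = 0 :> fock K.
Proof.
rewrite [fock_field _]/(normal_order _ _ _ (fock_field [:: 2%:Z])) /normal_order.
rewrite fsbig1 // => i _; rewrite b_field0 /c_field (linE (c_lin _)) (linE (c_lin _)).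
by rewrite b_field0 scaler0 addr0 scaler0.
Qed.

Lemma cb_field_mode (n : nat) x : regular_state x -> (forall q, (2 < q)%N -> da q x = 0) ->
  fock_field [:: 1; 2%:Z] n%:Z x = \sum_(l <- iota 0 3) dc l (da (n + l) x) :> fock K.
Proof.
move=> rx x3.
rewrite [fock_field _]/(normal_order _ 0 _ (fock_field [:: 2%:Z])) /normal_order.
have term (i : nat) : c_field (- 1 - 0%N%:Z - i%:Z) (fock_field [:: 2%:Z] (n%:Z + i%:Z) x)
    + (-1) ^+ (0 + odd (size [:: 2%:Z])) *:
      fock_field [:: 2%:Z] (n%:Z - 1 - 0%N%:Z - i%:Z) (c_field i%:Z x) = dc i (da (n + i) x).
  have -> : c_field i%:Z x = 0 by apply: rx; lia.
  rewrite b_field0 scaler0 addr0 -PoszD b_field_mode /c_field /dc.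
  by congr (c_ _ _); lia.
rewrite (@fsumE _ _ (iota 0 3)) ?iota_uniq // => [|i].
  by apply: eq_bigr => i _; rewrite add0n binn scale1r -term.
rewrite mem_iota => i3; rewrite term x3 ?(linE (@dc_lin K _)) ?scaler0 //; lia.
Qed.

Lemma cdcb_field x : regular_state x -> (forall q, (2 < q)%N -> da q x = 0) ->
  fe_field cdcb_set 0 x = cdcb0 x.
Proof.
move=> rx x3; rewrite /fe_field sort_fset //.
rewrite [fock_field _]/(normal_order _ 1 _ (fock_field [:: 1; 2%:Z])) /normal_order.
have term (i : nat) : c_field (- 1 - 1%N%:Z - i%:Z) (fock_field [:: 1; 2%:Z] (0 + i%:Z) x)
    + (-1) ^+ (1 + odd (size [:: 1; 2%:Z])) *:
      fock_field [:: 1; 2%:Z] (0 - 1 - 1%N%:Z - i%:Z) (c_field i%:Z x)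
    = \sum_(l <- iota 0 3) dc (1 + i) (dc l (da (i + l) x)).
  have -> : c_field i%:Z x = 0 by apply: rx; lia.
  rewrite cb_field0 scaler0 addr0 add0r cb_field_mode // /c_field.
  rewrite -(lin_sum (@dc_lin K (1 + i))) /dc.
  by congr (c_ _ _); lia.
rewrite (@fsumE _ _ (iota 0 3)) ?iota_uniq // => [|i].
  apply: eq_bigr => i _; rewrite term scaler_sumr; apply: eq_bigr => l _.
  by rewrite add1n binSn.
rewrite mem_iota => i3; rewrite term big1 ?scaler0 // => l _.
by rewrite x3 ?(linE (@dc_lin K _)) //; lia.
Qed.

Lemma da_dw q v : q \notin v -> da q (dw K v) = 0.
Proof.
elim: v => [|j v IH]; first by rewrite da_vac.
rewrite inE negb_or => /andP[/negPf qj /IH E].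
by rewrite /= da_dc -/(dw K v) E eqnE qj (linE (@dc_lin K _)) subr0.
Qed.

Lemma da_dw_in q v : uniq v -> q \in v ->
  da q (dw K v) = (-1) ^+ index q v *: dw K (rem q v).
Proof.
elim: v => [|j v IH] //= /andP[jv uv]; rewrite da_dc -/(dw K v) eqnE inE eq_sym.
case: (eqVneq j q) => [jq _|jq /= qv].
  by rewrite jq in jv; rewrite da_dw // (linE (@dc_lin K _)) subr0 scale1r.
by rewrite IH // (linE (@dc_lin K _)) sub0r exprS mulN1r scaleNr.
Qed.

Definition cdcb_terms (v : seq nat) : seq (bool * nat * seq nat) :=
  flatten [seq flatten [seq
    if ((i + l)%N \in v) then
      if cnorm [:: (1 + i)%N, l & rem (i + l)%N v] is Some (s, w) then
        [:: (odd (index (i + l)%N v) (+) s, i.+1, w)] else [::]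
    else [::] | l <- iota 0 3] | i <- iota 0 3].

Lemma cdcb0_terms v : uniq v ->
  cdcb0 (dw K v) = \sum_(t <- cdcb_terms v) ((-1) ^+ t.1.1 * t.1.2%:R) *: dw K t.2.
Proof.
move=> uv; rewrite /cdcb0 /cdcb_terms big_flatten big_map; apply: eq_bigr => i _.
rewrite big_flatten big_map; apply: eq_bigr => l _.
case: ifP => [il|/negbT il]; last first.
  by rewrite da_dw // big_nil !(linE (@dc_lin K _)) scaler0.
rewrite da_dw_in // !(linE (@dc_lin K _)).
rewrite -[dc (1 + i) _]/(dw K [:: (1 + i)%N, l & rem (i + l)%N v]) cnorm_val.
case: (cnorm _) => [[s w]|]; last by rewrite big_nil /= !scaler0.
by rewrite big_seq1 /= !scalerA signr_addb signr_odd -mulrA mulrC.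
Qed.

Definition QL (x : six A A) : six A A :=
  mk6 0 (Lmode D (-1) (six0 x)) 0 (Lmode D (-1) (six1' x))
    (six1' x - 2^-1 *: Lmode D 1 (six1 x)) (2^-1 *: Lmode D 1 (six2 x)).

(** Matter weights are at most 1, so only L_-1, L_0 and L_1 act. The vacuum has the single mode -1,
    which leaves the residue of the pure ghost field. *)
Lemma brst_wsum l : has_weights gr light_weights l ->
  brst D (wsum light_words l) =
  \sum_(j <- iota 0 6)
    (\sum_(p <- iota 0 3) tens (Lmode D (p%:Z - 1) (nth 0 l j))
        (cprod [:: 0%N] p (dw K (nth [::] light_words j)))
     - tens (nth 0 l j) (cdcb0 (dw K (nth [::] light_words j)))).
Proof.
move=> lw; rewrite /brst /wprod brst_stateE.
set r := [:: Fw [:: 0%N]; cdcb_set; Fw [:: 2%N]].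
have mem1 : (2 \in Fw [:: 0%N]) = false by rewrite !inE.
have mem2 : 2 \in cdcb_set by rewrite !inE.
have mem3 : (2 \in Fw [:: 2%N]) = false by rewrite !inE.
have mem4 : 1 \in Fw [:: 0%N] by rewrite !inE.
have mem5 : (1 \in Fw [:: 2%N]) = false by rewrite !inE.
have ne12 : Fw [:: 0%N] != cdcb_set by apply: contraTneq mem2 => <-; rewrite mem1.
have ne23 : cdcb_set != Fw [:: 2%N] by apply: contraTneq mem2 => ->; rewrite mem3.
have ne13 : Fw [:: 0%N] != Fw [:: 2%N] by apply: contraTneq mem4 => ->; rewrite mem5.
have r_uniq : uniq r by rewrite /= !inE negb_or ne12 ne13 ne23.
rewrite (@fslift_on _ _ _ _ _ _ r) //; first last.
- move=> S; rewrite /fslift fsbig1 // => T _; rewrite fsbig1 // => k _.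
  by rewrite vE tE.
- move=> S; rewrite !inE !negb_or => /and3P[/negPf S1 /negPf S2 /negPf S3].
  by rewrite !fsDE !fsdeltaE S1 S2 S3 !addr0.
have inner S a : fslift (fun T b => \sum_(k \in [set: int])
    tens (a $[k] b) (fe_field S (0 - 1 - k) (fe K T))) (wsum light_words l) =
    \sum_(j <- iota 0 6) \sum_(k \in [set: int]) tens (a $[k] nth 0 l j)
      (fe_field S (0 - 1 - k) (dw K (nth [::] light_words j))).
  rewrite fslift_wsum // => [|T]; last by rewrite fsbig1 // => k _; rewrite vE tE.
  apply: eq_big_seq => j; rewrite mem_iota => /andP[_ j_lt].
  by rewrite dw_fe //; case: j j_lt => [|[|[|[|[|[|j]]]]]].
have big3 (F : {fset int} -> W) :
    \sum_(S <- r) F S = F (Fw [:: 0%N]) + F cdcb_set + F (Fw [:: 2%N]).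
  by rewrite /r !big_cons big_nil addr0 addrA.
rewrite big3 !inner.
rewrite !fsDE !fsdeltaE !eqxx (negPf ne12) (negPf ne13) (negPf ne23).
rewrite [cdcb_set == _]eq_sym (negPf ne12) [Fw [:: 2%N] == _]eq_sym (negPf ne13).
rewrite [Fw [:: 2%N] == _]eq_sym (negPf ne23) !addr0 !add0r -!big_split.
apply: eq_bigr => j _; rewrite -[LHS]/(_ + _ + _).
(* The term \partial^2 c is a power series on regular states and has no residue. *)
rewrite [X in _ + X](_ : _ = 0); last first.
  rewrite fsbig1 // => k _; rewrite vE (vvac_mode VD); case: eqP => [->|_]; last first.
    by rewrite scaler0 tE.
  rewrite fe_field_Fw // fock_field_c; [by rewrite subrr ltxx tE|exact: regular_dw].
rewrite addr0; congr (_ + _).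
- under eq_fsbigr do rewrite fe_field_Fw //.
  rewrite (@wprod_pair _ _ D _ _ [:: 0%N] _ 0 3%N); first last.
  + move=> k k3; rewrite (_ : vprod D _ k _ = Lmode D (k - 1) (nth 0 l j)); last first.
      by rewrite /Lmode subrK.
    apply: (Lmode_weight0 char0 VD (lw j)).
    have : (nth 0%N light_weights j <= 1)%N.
      by case: j => [|[|[|[|[|[|j]]]]]] //=; rewrite nth_nil.
    by move: k3; clear; lia.
  + exact: regular_dw.
  by apply: eq_bigr => p _; rewrite /Lmode subrK add0r.
- rewrite (@fsumE _ _ [:: -1]) // => [|k].
    rewrite big_seq1 vE (vvac_mode VD) eqxx tE cdcb_field //; first exact: regular_dw.
    move=> [|[|[|q]]] // _; apply: da_dw.
    by case: j => [|[|[|[|[|[|j]]]]]]; rewrite /= ?nth_nil.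
  by rewrite inE vE (vvac_mode VD) => /negPf ->; rewrite oppr0 tE.
Qed.

Lemma brst_embL x : six_gr gr x -> brst D (embL x) = embL (QL x).
Proof.
move=> gx; rewrite embLE brst_wsum; last exact: (embl_weights VD gx).
have [g0 g1 g1' g2 [g2' g3]] := gx.
have L0 n a : gr n a -> Lmode D (0%:Z) a = n%:R *: a by exact: (L0_weight VD).
rewrite (_ : iota 0 6 = [:: 0; 1; 2; 3; 4; 5]%N) // (_ : iota 0 3 = [:: 0; 1; 2]%N) //.
rewrite !big_cons !big_nil !cprod_ev.
repeat match goal with |- context [cev ?v ?p ?u] =>
  let l := eval vm_compute in (cev v p u) in change (cev v p u) with l end.
rewrite !cdcb0_terms //.
repeat match goal with |- context [cdcb_terms ?v] =>
  let l := eval vm_compute in (cdcb_terms v) in change (cdcb_terms v) with l end.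
rewrite ?big_cons ?big_nil; cbn [nth fst snd embl].
rewrite ?[_ ^+ false]expr0 ?[_ ^+ true]expr1.
rewrite -?[Posz 0 - 1]/(-1 : int) -?[Posz 1 - 1]/(0 : int) -?[Posz 2 - 1]/(1 : int).
rewrite ?(fun n => linE (Lmode_lin VD n)).
have L1 a : gr 0 a -> Lmode D 1 a = 0 by move=> /(Lmode_weight0 char0 VD); apply.
(* The eigenvalues of L_0 will cancel against the ghost part, since light states have total
   conformal weight 0. *)
rewrite (L0 _ _ g0) (L0 _ _ g1) (L0 _ _ g1') (L0 _ _ g2) (L0 _ _ g2') (L0 _ _ g3).
rewrite (L1 _ g0) (L1 _ g1') (L1 _ g2') (L1 _ g3).
rewrite /embL /QL !mk6E !stE -[gvac K]/(dw K [::]) !tE.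
by lmod_with K ltac:(first [ring | by field]).
Qed.

End Brst.

(** * Transport to homotopy algebras *)

Section Transport.
Variables (K : fieldType) (V0 V1 : lmodType K) (C : courant_data V0 V1).
Variables (W : lmodType K) (emb : six V0 V1 -> W) (G : int -> set W) (X : set W).
Variables (Q : W -> W) (mu m : W -> W -> W) (n : W -> W -> W -> W).
Hypothesis two : 2 != 0 :> K.
Hypothesis HC : is_courant C.
Hypothesis emb_lin : lin emb.
Hypothesis GE : forall g x, G g x <-> exists2 t, deg6 g t & x = emb t.
Hypothesis XE : forall x, X x <-> exists t, x = emb t.
Hypothesis Q_emb : forall t, Q (emb t) = emb (Q6 C t).
Hypothesis mu_emb : forall t u, mu (emb t) (emb u) = emb (mu6 C t u).
Hypothesis m_emb : forall t u, m (emb t) (emb u) = emb (m6 C t u).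
Hypothesis n_emb : forall t u v, n (emb t) (emb u) (emb v) = emb (n6 C t u v).

Let sg (k : int) : K := (-1) ^ k.

Lemma sgD g h : sg (g + h) = sg g * sg h.
Proof. by rewrite /sg expfzDr // oppr_eq0 oner_eq0. Qed.

Lemma sgB g : sg (g + g) = 1.
Proof. by rewrite sgD /sg -expfzMl mulrNN mulr1 exp1rz. Qed.

Lemma tau6_deg g (t : six V0 V1) : deg6 g t -> tau6 t = sg g *: t.
Proof.
move: t; apply: six_mk => x0 x1 y1 x2 y2 x3 [].
rewrite /tau6 !mk6E mk6Z => h0 h1 h2 h3.
have [E|g0] := eqVneq g 0.
  subst g; have [-> ->] := h1 erefl; have [-> ->] := h2 erefl; rewrite (h3 erefl).
  by rewrite /sg expr0z !scale1r ?scaler0 !oppr0.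
rewrite (h0 g0); have [E|g1] := eqVneq g 1.
  subst g; have [-> ->] := h2 erefl; rewrite (h3 erefl).
  by rewrite /sg expr1z !scaleN1r !oppr0.
have [-> ->] := h1 g1; have [E|g2] := eqVneq g 2.
  by subst g; rewrite (h3 erefl) (sgB 1) !scale1r ?scaler0 !oppr0.
have [-> ->] := h2 g2; have [E|g3] := eqVneq g 3.
  by subst g; rewrite (sgD 1 2) (sgB 1) mulr1 /sg expr1z !scaleN1r !oppr0.
by rewrite (h3 g3) ?scaler0 !oppr0.
Qed.

Let uE := bilE (mu6_bil HC).
Let oE := bilE (m6_bil HC).
Let eE := linE emb_lin.

Let n6E : (forall k t u v, n6 C (k *: t) u v = k *: n6 C t u v) *
  (forall k t u v, n6 C t (k *: u) v = k *: n6 C t u v) *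
  (forall k t u v, n6 C t u (k *: v) = k *: n6 C t u v).
Proof.
have [n1 n2 n3] := n6_tri HC.
split; first split; move=> k t u v.
- exact: (linE (n1 u v)).2.
- exact: (linE (n2 t v)).2.
- exact: (linE (n3 t u)).2.
Qed.

Lemma transport_Q : operation1 G X 1 Q.
Proof.
split=> [k x y /XE[t ->] /XE[u ->]|g x /GE[t gt ->]].
  by rewrite -emb_lin !Q_emb -emb_lin (Q6_lin HC).
by apply/GE; exists (Q6 C t); [exact: deg6_Q|].
Qed.

Lemma transport_mu : operation2 G X 0 mu.
Proof.
split=> [k x x' y|k x y y'|g h x y].
- move=> /XE[t ->] /XE[t' ->] /XE[u ->]; rewrite -emb_lin !mu_emb -emb_lin.
  by rewrite !uE.
- move=> /XE[t ->] /XE[t' ->] /XE[u ->]; rewrite -emb_lin !mu_emb -emb_lin.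
  by rewrite !uE.
- move=> /GE[t gt ->] /GE[u gu ->]; apply/GE; exists (mu6 C t u); last exact: mu_emb.
  exact: deg6_mu.
Qed.

Lemma transport_m : operation2 G X (-1) m.
Proof.
split=> [k x x' y|k x y y'|g h x y].
- move=> /XE[t ->] /XE[t' ->] /XE[u ->]; rewrite -emb_lin !m_emb -emb_lin.
  by rewrite !oE.
- move=> /XE[t ->] /XE[t' ->] /XE[u ->]; rewrite -emb_lin !m_emb -emb_lin.
  by rewrite !oE.
- move=> /GE[t gt ->] /GE[u gu ->]; apply/GE; exists (m6 C t u); last exact: m_emb.
  exact: deg6_m.
Qed.

Lemma transport_n : operation3 G X (-1) n.
Proof.
have [n1 n2 n3] := n6_tri HC.
split=> [k x x' y z|k x y y' z|k x y z z'|g g' g'' x y z].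
- move=> /XE[t ->] /XE[t' ->] /XE[u ->] /XE[v ->]; rewrite -emb_lin !n_emb -emb_lin.
  by rewrite (n1 u v).
- move=> /XE[t ->] /XE[u ->] /XE[u' ->] /XE[v ->]; rewrite -emb_lin !n_emb -emb_lin.
  by rewrite (n2 t v).
- move=> /XE[t ->] /XE[u ->] /XE[v ->] /XE[v' ->]; rewrite -emb_lin !n_emb -emb_lin.
  by rewrite (n3 t u).
- move=> /GE[t gt ->] /GE[u gu ->] /GE[v gv ->]; apply/GE.
  by exists (n6 C t u v); [exact: deg6_n|exact: n_emb].
Qed.

Lemma transport_nilpotent : rel_nilpotent G Q.
Proof. by move=> g x /GE[t _ ->]; rewrite !Q_emb Q6_Q6 // eE. Qed.

Lemma transport_leibniz : rel_leibniz G Q mu.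
Proof.
move=> g h x y /GE[t gt ->] /GE[u gu ->].
rewrite !(Q_emb, mu_emb) mu6_leibniz // (tau6_deg gt) uE eE.
by congr (_ + _); rewrite eE.
Qed.

Lemma transport_comm : rel_comm G Q mu m.
Proof.
move=> g h x y /GE[t gt ->] /GE[u gu ->].
have sgn (k : int) : sg k = 1 \/ sg k = -1.
  have := sgB k; rewrite sgD => /eqP; rewrite -expr2 sqrf_eq1 => /orP[] /eqP; auto.
(* This brings the sign of the commutator into the form used in [m6_comm], where it is expressed
   through [tau6]. *)
have sgM : sg (g * h) = 2^-1 * (1 + sg g + sg h - sg g * sg h).
  have -> : sg (g * h) = sg g ^ h by rewrite /sg exprz_exp.
  case: (sgn g) => ->.
    by rewrite exp1rz; case: (sgn h) => ->; field.
  by rewrite -/(sg h); case: (sgn h) => ->; field.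
have key : mu6 C t u - sg (g * h) *: mu6 C u t =
    Q6 C (m6 C t u) + m6 C (Q6 C t) u + sg g *: m6 C t (Q6 C u).
  have := m6_comm two HC t u; rewrite (tau6_deg gt) (tau6_deg gu) !uE !oE => <-.
  by rewrite sgM; lmod_with K ltac:(first [ring | by field]).
rewrite !(Q_emb, mu_emb, m_emb).
transitivity (emb (mu6 C t u - sg (g * h) *: mu6 C u t)); first by rewrite !eE.
by rewrite key !eE.
Qed.

Lemma transport_assoc : rel_assoc G Q mu n.
Proof.
move=> g h k x y z /GE[t gt ->] /GE[u gu ->] /GE[v gv ->].
rewrite !(Q_emb, mu_emb, n_emb) -[in RHS](eE.1.2) -[in RHS](eE.1.1.1) -n6_assoc //.
by rewrite (tau6_deg gt) (tau6_deg gu) !n6E !eE scalerA -sgD.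
Qed.

Lemma transport_pentagon : rel_pentagon G mu n.
Proof.
move=> g1 g2 g3 g4 a1 a2 a3 a4 /GE[t gt ->] /GE[u gu ->] /GE[v gv ->] /GE[w gw ->].
rewrite !(mu_emb, n_emb) -[in RHS](eE.1.2) -!(eE.1.1.1) -n6_pentagon //.
by rewrite (tau6_deg gt) !uE !eE.
Qed.

Lemma transport_nn : rel_nn G n.
Proof.
move=> g1 g2 g3 g4 g5 a1 a2 a3 a4 a5.
move=> /GE[t gt ->] /GE[u gu ->] /GE[v gv ->] /GE[w gw ->] /GE[s gs ->].
rewrite !n_emb -[RHS](eE.1.1.2) -(n6_n6 HC t u v w s).
by rewrite (tau6_deg gt) (tau6_deg gu) !n6E !eE scalerA -sgD.
Qed.

Lemma transport_hac : homotopy_assoc_comm G X Q mu m n.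
Proof.
split; [exact: transport_Q|exact: transport_mu|exact: transport_m|exact: transport_n
  |exact: transport_nilpotent|exact: transport_leibniz|exact: transport_comm
  |exact: transport_assoc].
Qed.

Lemma transport_ainfty : ainfty3 G X Q mu n.
Proof.
split; [exact: transport_Q|exact: transport_mu|exact: transport_n
  |exact: transport_nilpotent|exact: transport_leibniz|exact: transport_assoc
  |exact: transport_pentagon|exact: transport_nn].
Qed.

End Transport.

(** * Quasiclassical limit *)

Lemma six_linE (K : fieldType) (U0 U1 : lmodType K) (c : K) (x y : six U0 U1) :
  ((six0 (c *: x + y) = (c *: six0 x + six0 y)%R) *
   (six1 (c *: x + y) = (c *: six1 x + six1 y)%R) *
   (six1' (c *: x + y) = (c *: six1' x + six1' y)%R) *
   (six2 (c *: x + y) = (c *: six2 x + six2 y)%R) *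
   (six2' (c *: x + y) = (c *: six2' x + six2' y)%R) *
   (six3 (c *: x + y) = (c *: six3 x + six3 y)%R))%type.
Proof.
move: x y; apply: six_mk => x0 x1 y1 x2 y2 x3; apply: six_mk => u0 u1 v1 u2 v2 u3.
by rewrite mk6Z mk6D !mk6E.
Qed.

Section Quasiclassical.
Variables (K : fieldType) (V : lmodType K) (Vgr : nat -> set V).
Variable D : voa_data (laurent V).
Hypothesis char0 : forall n, n.+1%:R != 0 :> K.
Hypothesis HD : voa_formal_parameter Vgr D.
Local Notation L := (laurent V).
Local Notation W := (gtens L).
Let VD := fp_voa HD.
Let tE := bilE (tens_bil L).
Let two : 2 != 0 :> K := char0 1.
Local Notation V0 := (lw HD 0).
Local Notation V1 := (lw HD 1).
Local Notation gr := (laurent_gr Vgr).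

Definition val6 (t : six V0 V1) : six V V :=
  mk6 (lval (six0 t)) (lval (six1 t)) (lval (six1' t)) (lval (six2 t))
      (lval (six2' t)) (lval (six3 t)).

(* In each component the power of h prescribed by the definition of the
   complex, multiplied by h^k. *)
Definition h6 (k : int) (x : six V V) : six L L :=
  mk6 (laur k (six0 x)) (laur k (six1 x)) (laur (k + 1) (six1' x))
      (laur (k + 1) (six2 x)) (laur (k + 1) (six2' x)) (laur (k + 2) (six3 x)).

Definition coef6 (k : int) (x : six L L) : six V V :=
  mk6 (six0 x k) (six1 x k) (six1' x (k + 1)) (six2 x (k + 1)) (six2' x (k + 1))
      (six3 x (k + 2)).

Definition hpoly6 (k : int) (x : six L L) : Prop :=
  [/\ hpoly k (six0 x), hpoly k (six1 x), hpoly (k + 1) (six1' x),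
      hpoly (k + 1) (six2 x) & hpoly (k + 1) (six2' x) /\ hpoly (k + 2) (six3 x)].

Definition emb (t : six V0 V1) : W := embL (h6 0 (val6 t)).

Lemma val6_lin : lin val6.
Proof.
move=> c; apply: six_mk => x0 x1 y1 x2 y2 x3; apply: six_mk => u0 u1 v1 u2 v2 u3.
by rewrite mk6Z mk6D /val6 !mk6E !lvalD !lvalZ [X in _ = X + _]mk6Z [RHS]mk6D.
Qed.

Lemma h6_lin k : lin (h6 k).
Proof.
move=> c; apply: six_mk => x0 x1 y1 x2 y2 x3; apply: six_mk => u0 u1 v1 u2 v2 u3.
rewrite mk6Z mk6D /h6 !mk6E [X in _ = X + _]mk6Z [RHS]mk6D.
by apply: mk6_eq; rewrite (laur_lin _).
Qed.

Lemma coef6_lin k : lin (coef6 k).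
Proof.
move=> c; apply: six_mk => x0 x1 y1 x2 y2 x3; apply: six_mk => u0 u1 v1 u2 v2 u3.
by rewrite mk6Z mk6D /coef6 !mk6E [X in _ = X + _]mk6Z [RHS]mk6D.
Qed.

Lemma emb_lin : lin emb.
Proof. by move=> c t u; rewrite /emb val6_lin h6_lin (embL_lin _). Qed.

Lemma six_eta (U0 U1 : lmodType K) (x : six U0 U1) :
  mk6 (six0 x) (six1 x) (six1' x) (six2 x) (six2' x) (six3 x) = x.
Proof. by move: x; apply: six_mk. Qed.

Lemma coef6_h6 k x : coef6 k (h6 k x) = x.
Proof. by rewrite /coef6 /h6 !mk6E !laurE !eqxx six_eta. Qed.

Lemma val6_inj : injective val6.
Proof.
move=> t u E; rewrite -[t]six_eta -[u]six_eta.
by apply: mk6_eq; apply: lval_inj; case: E.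
Qed.

Lemma six_gr_h6 k (t : six V0 V1) : six_gr gr (h6 k (val6 t)).
Proof.
have gl n j (v : lw HD n) : gr n (laur j (lval v)).
  by apply: (laur_gr HD); exact: lval_gr.
by rewrite /six_gr /h6 /val6 !mk6E; split=> //; split.
Qed.

Lemma hpoly6_h6 k x : hpoly6 k (h6 k x).
Proof.
by rewrite /hpoly6 /h6 !mk6E; split; try split; exact: hpoly_laur.
Qed.

Lemma hpoly6_lin k c x y : hpoly6 k x -> hpoly6 k y -> hpoly6 k (c *: x + y).
Proof.
case=> x0 x1 x1' x2 [x2' x3] [y0 y1 y1' y2 [y2' y3]].
by rewrite /hpoly6 !six_linE; split; try split; apply: hpoly_lin.
Qed.

Lemma six_gr_lin c (x y : six L L) : six_gr gr x -> six_gr gr y -> six_gr gr (c *: x + y).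
Proof.
case=> x0 x1 x1' x2 [x2' x3] [y0 y1 y1' y2 [y2' y3]].
by rewrite /six_gr !six_linE; split; try split; apply: (gr_lin VD).
Qed.

Lemma embL_inj (x : six L L) : embL x = 0 -> x = 0.
Proof.
rewrite embLE => x0.
have e0 i : (i < 6)%N -> nth 0 (embl x) i = 0.
  move=> i6.
  (* [fslift g] is the coordinate functional of the i-th word. *)
  pose g S (a : L) : L := if S == Fw (nth [::] light_words i) then a else 0.
  have g0 S : g S 0 = 0 by rewrite /g if_same.
  have := fslift_wsum (ws := light_words) (embl x) (erefl true) g0.
  rewrite x0 (_ : fslift g 0 = 0); last by rewrite (@fslift_on _ _ _ _ _ _ [::]) ?big_nil.
  move=> /esym; rewrite (bigD1_seq i) ?mem_iota ?iota_uniq // /g eqxx.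
  rewrite big1_seq => [|j /andP[ji]]; first by rewrite /= addr0.
  rewrite mem_iota => j6; case: eqP => // /Fw_inj E.
  have : nth [::] light_words j = nth [::] light_words i.
    by apply: E; apply: (allP (erefl : all canon light_words)); exact: mem_nth.
  by move/eqP; rewrite nth_uniq // (negPf ji).
have n2 (a : L) : - (2 *: a) = 0 -> a = 0.
  by move/eqP; rewrite oppr_eq0 scaler_eq0 (negPf two) => /eqP.
rewrite -[x]six_eta mk60; apply: mk6_eq.
- exact: (e0 0%N).
- exact: (e0 1%N).
- exact: (e0 2%N).
- by apply: oppr_inj; rewrite oppr0; exact: (e0 3%N).
- by apply: n2; exact: (e0 4%N).
- by apply: n2; exact: (e0 5%N).
Qed.

Lemma embE t : emb t = st 0 (lval (six0 t)) (gvac K)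
  + (st 0 (lval (six1 t)) (st_c K) + st 1 (lval (six1' t)) (st_dc K))
  + (st 1 (lval (six2 t)) (st_cdc K) + st 1 (lval (six2' t)) (st_cd2c K))
  + st 2 (lval (six3 t)) (st_cdcd2c K).
Proof. by rewrite /emb /embL /h6 !mk6E !add0r. Qed.

Lemma st0 k x : st k 0 x = 0 :> W.
Proof. by rewrite /st (linE (laur_lin _)) tE. Qed.

Lemma FdegE g x : Fdeg Vgr g x <-> exists2 t, deg6 g t & x = emb t.
Proof.
have z n : lval (0 : lw HD n) = 0 by [].
split.
- have zero : x = 0 -> exists2 t : six V0 V1, deg6 g t & x = emb t.
    by move=> ->; exists 0; [do !split|rewrite (linE emb_lin)].
  case: g zero => [[|[|[|[|g]]]]|g] zero; try exact: zero.
  + move=> [u u0 <-]; exists (mk6 (lmk HD 0 u) 0 0 0 0 0); first by do !split.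
    by rewrite embE !mk6E !z lmkK // !st0 !addr0.
  + move=> [a a1 [u u0 <-]]; exists (mk6 0 (lmk HD 1 a) (lmk HD 0 u) 0 0 0); first by do !split.
    by rewrite embE !mk6E !z !lmkK // !st0 !addr0 add0r.
  + move=> [a a1 [u u0 <-]]; exists (mk6 0 0 0 (lmk HD 1 a) (lmk HD 0 u) 0); first by do !split.
    by rewrite embE !mk6E !z !lmkK // !st0 !addr0 !add0r.
  + move=> [u u0 <-]; exists (mk6 0 0 0 0 0 (lmk HD 0 u)); first by do !split.
    by rewrite embE !mk6E !z lmkK // !st0 !addr0 !add0r.
- move=> [t [h0 h1 h2 h3] ->]; rewrite embE.
  have gv n (v : lw HD n) : Vgr n (lval v) := lval_gr v.
  case: g h0 h1 h2 h3 => [[|[|[|[|g]]]]|g] h0 h1 h2 h3.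
  + have [-> ->] := h1 erefl; have [-> ->] := h2 erefl; rewrite (h3 erefl) !z !st0 !addr0.
    by exists (lval (six0 t)).
  + rewrite (h0 erefl); have [-> ->] := h2 erefl; rewrite (h3 erefl) !z !st0 !addr0 add0r.
    by exists (lval (six1 t)) => //; exists (lval (six1' t)).
  + rewrite (h0 erefl); have [-> ->] := h1 erefl; rewrite (h3 erefl) !z !st0 !addr0 !add0r.
    by exists (lval (six2 t)) => //; exists (lval (six2' t)).
  + rewrite (h0 erefl); have [-> ->] := h1 erefl; have [-> ->] := h2 erefl.
    rewrite !z !st0 !addr0 !add0r.
    by exists (lval (six3 t)).
  + rewrite (h0 erefl); have [-> ->] := h1 erefl; have [-> ->] := h2 erefl; rewrite (h3 erefl).
    by rewrite !z !st0 !addr0.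
  + rewrite (h0 erefl); have [-> ->] := h1 erefl; have [-> ->] := h2 erefl; rewrite (h3 erefl).
    by rewrite !z !st0 !addr0.
Qed.

Lemma FlightE x : Flight Vgr x <-> exists t, x = emb t.
Proof.
split=> [[y [Fy ->]]|[t ->]].
- elim: 4%N => [|p [t E]].
    by exists 0; rewrite big_ord0 (linE emb_lin).
  rewrite big_ord_recr /= E; have /FdegE[u _ ->] := Fy p.
  by exists (t + u); rewrite (linE emb_lin).
- pose part (g : nat) : six V0 V1 :=
    mk6 (if g == 0%N then six0 t else 0) (if g == 1%N then six1 t else 0)
        (if g == 1%N then six1' t else 0) (if g == 2%N then six2 t else 0)
        (if g == 2%N then six2' t else 0) (if g == 3%N then six3 t else 0).
  exists (fun g => emb (part g)); split=> [g|].
    apply/FdegE; exists (part g) => //; rewrite /part.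
    have nz (j : nat) : g%:Z != j%:Z -> (g == j) = false by rewrite eqz_nat => /negPf.
    split; [move=> /(nz 0%N) E|move=> /(nz 1%N) E|move=> /(nz 2%N) E|move=> /(nz 3%N) E];
      by rewrite !mk6E E.
  rewrite -(lin_sum emb_lin) !big_ord_recl big_ord0.
  rewrite -[RHS]/(emb (part 0%N + (part 1%N + (part 2%N + (part 3%N + 0))))).
  by rewrite addr0 /part !eqxx ?mk6D !(addr0, add0r) six_eta.
Qed.

End Quasiclassical.

(** * Expansion in h and uniqueness of leading terms *)

Section Leading.
Variables (K : fieldType) (V : lmodType K) (Vgr : nat -> set V).
Variable D : voa_data (laurent V).
Hypothesis char0 : forall n, n.+1%:R != 0 :> K.
Hypothesis HD : voa_formal_parameter Vgr D.
Local Notation L := (laurent V).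
Local Notation W := (gtens L).
Local Notation V0 := (lw HD 0).
Local Notation V1 := (lw HD 1).
Local Notation gr := (laurent_gr Vgr).

Lemma hmulW_lin k : lin (@hmulW K V k).
Proof.
by apply: fslift_lin => S c a b; rewrite (hmul_lin _) (fsdelta_lin _).
Qed.

Lemma hmulW_tens k a x : hmulW k (tens a x) = tens (hmul k a) x :> W.
Proof.
have tE' b S v : tens b (fsdelta S v) = fsdelta S ((v : K) *: b) :> W.
  by rewrite /tens fslift_delta // => T; rewrite scale0r (linE (fsdelta_lin T)).
move: x; apply: lin_fs_eq => [||S v].
- exact: lin_comp (hmulW_lin k) (tens_linr a).
- exact: tens_linr.
rewrite !tE' /hmulW fslift_delta => [|T]; first by rewrite (linE (hmul_lin _)).
by rewrite (linE (hmul_lin _)) (linE (fsdelta_lin _)).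
Qed.

Lemma hmulW_emb k (t : six V0 V1) : hmulW k (emb t) = embL (h6 k (val6 t)).
Proof.
rewrite /emb /embL /h6 !mk6E !(linE (hmulW_lin k)) !hmulW_tens !hmul_laur !add0r.
by rewrite [1 + k]addrC [2 + k]addrC.
Qed.

(** The expansion holds for every large [p], so that the six components of a state can share one
    length. *)
Lemma laurent_expand m (X : L) : hpoly m X ->
  exists p0, forall p, (p0 <= p)%N -> X = \sum_(i < p) laur (m + i%:Z) (X (m + i%:Z)).
Proof.
move=> mX; have [r _ [_ X0]] := laurent_decomp X.
exists (\max_(j <- r) (absz (j - m)).+1) => p p_ge; apply: laurentP => k.
rewrite fs_sumE; under eq_bigr do rewrite laurE.
have [km|mk] := ltP k m.
  rewrite mX // big1 // => i _; rewrite ifF //; lia.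
case: (ltnP (absz (k - m)) p) => [kp|pk].
  rewrite (bigD1 (Ordinal kp)) // ifT; last by rewrite /=; lia.
  rewrite big1 => [|i]; first by rewrite /= addr0; congr (X _); lia.
  rewrite -val_eqE /= => ik; rewrite ifF //; move: ik mk; clear; lia.
rewrite X0; last first.
  apply/negP => kr.
  have := leq_trans (@leq_bigmax_seq _ r xpredT (fun j => (absz (j - m)).+1) k kr isT) p_ge.
  by rewrite ltnNge pk.
rewrite big1 // => i _; rewrite ifF //; have := ltn_ord i; move: mk pk; clear; lia.
Qed.

Definition lmk6 (x : six V V) : six V0 V1 :=
  mk6 (lmk HD 0 (six0 x)) (lmk HD 1 (six1 x)) (lmk HD 0 (six1' x))
    (lmk HD 1 (six2 x)) (lmk HD 0 (six2' x)) (lmk HD 0 (six3 x)).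

Lemma lmk6K k (x : six L L) : six_gr gr x -> val6 (lmk6 (coef6 k x)) = coef6 k x.
Proof.
case=> x0 x1 x1' x2 [x2' x3]; rewrite /val6 /lmk6 /coef6 !mk6E !lmkK //.
Qed.

Lemma h6_expand k (x : six L L) : hpoly6 k x ->
  exists p, x = \sum_(i < p) h6 (k + i%:Z) (coef6 (k + i%:Z) x).
Proof.
case=> /laurent_expand[p0 E0] /laurent_expand[p1 E1] /laurent_expand[p1' E1']
  /laurent_expand[p2 E2] [/laurent_expand[p2' E2'] /laurent_expand[p3 E3]].
pose p := (p0 + p1 + p1' + p2 + p2' + p3)%N; exists p.
have pr (f : six L L -> L) : (forall c y z, f (c *: y + z) = c *: f y + f z) ->
    forall F, f (\sum_(i < p) F i) = \sum_(i < p) f (F i).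
  by move=> fl F; exact: lin_sum fl _ _ _ _.
rewrite -[LHS]six_eta -[RHS]six_eta; apply: mk6_eq.
- rewrite pr => [|c y z]; last by rewrite six_linE.
  by rewrite [LHS](E0 p) //; rewrite /p; lia.
- rewrite pr => [|c y z]; last by rewrite six_linE.
  by rewrite [LHS](E1 p) //; rewrite /p; lia.
- rewrite pr => [|c y z]; last by rewrite six_linE.
  rewrite [LHS](E1' p); last by rewrite /p; lia.
  by apply: eq_bigr => i _; rewrite /h6 /coef6 !mk6E addrAC.
- rewrite pr => [|c y z]; last by rewrite six_linE.
  rewrite [LHS](E2 p); last by rewrite /p; lia.
  by apply: eq_bigr => i _; rewrite /h6 /coef6 !mk6E addrAC.
- rewrite pr => [|c y z]; last by rewrite six_linE.
  rewrite [LHS](E2' p); last by rewrite /p; lia.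
  by apply: eq_bigr => i _; rewrite /h6 /coef6 !mk6E addrAC.
- rewrite pr => [|c y z]; last by rewrite six_linE.
  rewrite [LHS](E3 p); last by rewrite /p; lia.
  by apply: eq_bigr => i _; rewrite /h6 /coef6 !mk6E addrAC.
Qed.

Lemma Fpoly_embL k x : six_gr gr x -> hpoly6 k x -> Fpoly Vgr k (embL x).
Proof.
move=> gx /h6_expand[p xE]; exists p, (fun i => emb (lmk6 (coef6 (k + i%:Z) x))); split.
  by move=> i; apply/(FlightE HD); eexists.
rewrite {1}xE (lin_sum (@embL_lin K L)); apply: eq_bigr => i _.
by rewrite hmulW_emb lmk6K.
Qed.

Lemma Fpoly_inv k x : Fpoly Vgr k x -> exists2 z, x = embL z & hpoly6 k z.
Proof.
move=> [p [y [Fy ->]]]; elim: p => [|p [z E hz]].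
  exists 0; first by rewrite big_ord0 (linE (@embL_lin K L)).
  by do 5!split.
rewrite big_ord_recr E; have /(FlightE HD)[t ->] := Fy p.
exists (z + h6 (k + p%:Z) (val6 t)); first by rewrite /= hmulW_emb !(linE (@embL_lin K L)).
rewrite -[z]scale1r; apply: hpoly6_lin => //.
have := @hpoly6_h6 K V (k + p%:Z) (val6 t).
by case=> h0 h1 h1' h2 [h2' h3]; split; try split;
  [apply: hpoly_le h0|apply: hpoly_le h1|apply: hpoly_le h1'|apply: hpoly_le h2|
   apply: hpoly_le h2'|apply: hpoly_le h3]; lia.
Qed.

Lemma emb_inj : injective (@emb K V Vgr D HD).
Proof.
move=> t u tu; apply: val6_inj; apply/eqP; rewrite -subr_eq0; apply/eqP.
have E : h6 0 (val6 t - val6 u) = 0.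
  apply: (embL_inj char0); rewrite !(linE (@h6_lin K V 0)) !(linE (@embL_lin K L)).
  by apply/eqP; rewrite subr_eq0; apply/eqP.
by rewrite -[LHS](coef6_h6 0) E !(linE (@coef6_lin K V 0)).
Qed.

(** Among states of order k, membership in h^(k+1) F[h] is the vanishing of [coef6 k]. This gives
    both the existence and the uniqueness that determine the chosen element. *)
Lemma lead_embL k x (t : six V0 V1) : six_gr gr x -> hpoly6 k x ->
  coef6 k x = val6 t -> lead Vgr k (embL x) = emb t.
Proof.
move=> gx hx xt.
have sub (u : six V0 V1) : embL x - hmulW k (emb u) = embL (x - h6 k (val6 u)).
  by rewrite hmulW_emb !(linE (@embL_lin K L)).
have E (u : six V0 V1) : x - h6 k (val6 u) = (-1) *: h6 k (val6 u) + x.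
  by rewrite scaleN1r addrC.
have gu (u : six V0 V1) : six_gr gr (x - h6 k (val6 u)).
  by rewrite E; apply: (six_gr_lin HD) => //; exact: six_gr_h6.
have hu (u : six V0 V1) : hpoly6 k (x - h6 k (val6 u)).
  by rewrite E; apply: hpoly6_lin => //; exact: hpoly6_h6.
have cu (u : six V0 V1) : coef6 k (x - h6 k (val6 u)) = coef6 k x - val6 u.
  by rewrite !(linE (@coef6_lin K V k)) coef6_h6.
have up (z : six L L) : hpoly6 k z -> coef6 k z = 0 -> hpoly6 (k + 1) z.
  have st (X : L) j : hpoly j X -> X j = 0 -> hpoly (j + 1) X.
    by move=> jX Xj i; rewrite ltzD1 le_eqVlt => /predU1P[->//|/jX].
  case=> h0 h1 h1' h2 [h2' h3]; rewrite mk60 => -[e0 e1 e1' e2 e2' e3].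
  have k2 : k + 1 + 2 = k + 2 + 1 by rewrite addrAC.
  rewrite /hpoly6 k2; split; [exact: st|exact: st|exact: st|exact: st|].
  by split; exact: st.
have down (z : six L L) : hpoly6 (k + 1) z -> coef6 k z = 0.
  by case=> h0 h1 h1' h2 [h2' h3]; rewrite /coef6 h0 ?h1 ?h1' ?h2 ?h2' ?h3 -?mk60 //; lia.
rewrite /lead; apply: xget_unique.
  split; first by apply/(FlightE HD); eexists.
  rewrite sub; apply: Fpoly_embL; rewrite //; apply: up => //.
  by rewrite cu xt subrr.
move=> f [/(FlightE HD)[u ->]]; rewrite sub => /Fpoly_inv[z uz hz].
congr (emb _); apply: val6_inj; apply/esym/eqP; rewrite -xt -subr_eq0 -cu.
suff -> : x - h6 k (val6 u) = z by rewrite down.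
apply/eqP; rewrite -subr_eq0; apply/eqP; apply: (embL_inj char0).
by rewrite (linE (@embL_lin K L)).1.1.1 uz (linE (@embL_lin K L)).1.2 subrr.
Qed.
End Leading.

Lemma sum_bool (W : nmodType) (F : bool -> W) :
  \sum_(e : bool) F e = F true + F false.
Proof. exact: big_bool. Qed.

Definition zmap6 (K : fieldType) (V0 V1 : lmodType K)
    (C : courant_data V0 V1) (a : V1) (x : six V0 V1) : six V0 V1 :=
  mk6 (anc C a (six0 x)) (brk C a (six1 x)) (anc C a (six1' x))
      (brk C a (six2 x)) (anc C a (six2' x)) (anc C a (six3 x)).

(** * Leading terms of the exact operations *)

Section LeadingOperations.
Variables (K : fieldType) (V : lmodType K) (Vgr : nat -> set V).
Variable D : voa_data (laurent V).
Hypothesis char0 : forall n, n.+1%:R != 0 :> K.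
Hypothesis HD : voa_formal_parameter Vgr D.
Local Notation "a $[ n ] b" := (vprod D a n b)
  (at level 35, n at level 99, right associativity).
Local Notation L := (laurent V).
Let VD := fp_voa HD.
Local Notation V0 := (lw HD 0).
Local Notation V1 := (lw HD 1).
Local Notation gr := (laurent_gr Vgr).

(* [X] = h^m [v] + O(h^(m+1)) *)
Definition lc (m : int) (X : L) (v : V) : Prop := hpoly m X /\ X m = v.

Definition lc6 (k : int) (x : six L L) (X : six V V) : Prop :=
  [/\ lc k (six0 x) (six0 X), lc k (six1 x) (six1 X), lc (k + 1) (six1' x) (six1' X),
      lc (k + 1) (six2 x) (six2 X) &
      lc (k + 1) (six2' x) (six2' X) /\ lc (k + 2) (six3 x) (six3 X)].

Lemma lc_laur m v : lc m (laur m v) v.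
Proof. by split; [exact: hpoly_laur|rewrite laurE eqxx]. Qed.

Lemma lc_0 m : lc m 0 0.
Proof. by split=> // k _; rewrite fs0E. Qed.

Lemma lc_D m X Y u v : lc m X u -> lc m Y v -> lc m (X + Y) (u + v).
Proof. by case=> hX <- [hY <-]; split; [exact: hpolyD|rewrite fsDE]. Qed.

Lemma lc_Z m k X u : lc m X u -> lc m (k *: X) (k *: u).
Proof. by case=> hX <-; split; [exact: hpolyZ|rewrite fsZE]. Qed.

Lemma lc_N m X u : lc m X u -> lc m (- X) (- u).
Proof. by rewrite -!scaleN1r; exact: lc_Z. Qed.

(** Here m is the order at which a component is read; a product that starts at a higher order
    contributes 0. This is how exact formulas lose their nonclassical terms. *)
Lemma lc_vprod i j n m X Y u v : lc i X u -> lc j Y v -> m <= i + j + hord n ->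
  lc m (X $[n] Y) (if m == i + j + hord n then cp D n u v else 0).
Proof.
move=> [hX <-] [hY <-] m_le; have h := hpoly_vprod char0 HD (n := n) hX hY.
split; first exact: hpoly_le h.
case: eqP => [E|/eqP m_ne]; first exact: (lead_vprod char0 HD).
by apply: h; rewrite lt_neqAle m_ne.
Qed.

Lemma lc6_h6 k X : lc6 k (h6 k X) X.
Proof. by rewrite /lc6 /h6 !mk6E; (split; [| | | |split]); exact: lc_laur. Qed.

Lemma lc6_par6 k e x X : lc6 k x X -> lc6 k (par6 e x) (par6 e X).
Proof.
case=> l0 l1 l1' l2 [l2' l3]; rewrite /lc6 /par6.
by case: e; rewrite !mk6E; (split; [| | | |split]); rewrite //; exact: lc_0.
Qed.

Lemma lc6D k x y X Y : lc6 k x X -> lc6 k y Y -> lc6 k (x + y) (X + Y).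
Proof.
case=> l0 l1 l1' l2 [l2' l3] [m0 m1 m1' m2 [m2' m3]].
rewrite -[x]six_eta -[y]six_eta -[X]six_eta -[Y]six_eta !mk6D /lc6 !mk6E.
by (split; [| | | |split]); exact: lc_D.
Qed.

Lemma lc6Z k c x X : lc6 k x X -> lc6 k (c *: x) (c *: X).
Proof.
case=> l0 l1 l1' l2 [l2' l3].
rewrite -[x]six_eta -[X]six_eta !mk6Z /lc6 !mk6E.
by (split; [| | | |split]); exact: lc_Z.
Qed.

Lemma lead_lc6 k x (t : six V0 V1) : six_gr gr x -> lc6 k x (val6 t) ->
  lead Vgr k (embL x) = emb t.
Proof.
move=> gx [[l0 e0] [l1 e1] [l1' e1'] [l2 e2] [[l2' e2'] [l3 e3]]].
apply: (lead_embL char0) => //.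
by rewrite /coef6 e0 e1 e1' e2 e2' e3 six_eta.
Qed.

Lemma lc_eq m X u v : lc m X u -> u = v -> lc m X v.
Proof. by move=> ? <-. Qed.

Local Ltac lc_eval := repeat first
  [ eassumption | apply: lc_0 | apply: lc_D | apply: lc_N | apply: lc_Z
  | (eapply lc_vprod; [eassumption|eassumption|exact: isT])].

Lemma lc6_muL x y X Y : lc6 0 x X -> lc6 0 y Y -> lc6 0 (muL D x y)
  (mk6 (cp D (-1) (six0 X) (six0 Y))
    (cp D (-1) (six0 X) (six1 Y) + cp D (-1) (six1 X) (six0 Y))
    (cp D (-1) (six0 X) (six1' Y) + cp D (-1) (six1' X) (six0 Y)
       + cp D 0 (six1 X) (six0 Y))
    (cp D (-1) (six0 X) (six2 Y) + cp D (-1) (six2 X) (six0 Y)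
       - cp D 0 (six1 X) (six1 Y) + cp D (-1) (six1 X) (six1' Y)
       - cp D (-1) (six1' X) (six1 Y))
    (cp D (-1) (six0 X) (six2' Y) + cp D (-1) (six2' X) (six0 Y)
       - 2^-1 *: cp D 1 (six1 X) (six1 Y))
    (cp D (-1) (six0 X) (six3 Y) + cp D (-1) (six3 X) (six0 Y)
       + (2^-1 *: cp D 1 (six1 X) (six2 Y) - cp D 0 (six1 X) (six2' Y)
          - cp D (-1) (six1' X) (six2' Y))
       + (2^-1 *: cp D 1 (six2 X) (six1 Y) + cp D 0 (six2' X) (six1 Y)
          - cp D (-1) (six2' X) (six1' Y)))).
Proof.
case=> l0 l1 l1' l2 [l2' l3] [k0 k1 k1' k2 [k2' k3]].
rewrite /lc6 /muL !mk6E; (split; [| | | |split]).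
all: eapply lc_eq; [lc_eval|].
all: rewrite /= ?oppr0 ?addr0 //.
Qed.

Lemma lc_dot x y X Y : lc6 0 x X -> lc6 0 y Y ->
  lc 1 (dot_c D x y) (cp D 0 (six0 X) (six1 Y) + cp D 0 (six1 X) (six0 Y)) /\
  lc 1 (dot_cdc D x y) (- cp D 1 (six1 X) (six1 Y)).
Proof.
case=> l0 l1 l1' l2 [l2' l3] [k0 k1 k1' k2 [k2' k3]]; rewrite /dot_c /dot_cdc.
split; eapply lc_eq; [lc_eval| |lc_eval|]; by rewrite /= ?oppr0 ?addr0 ?add0r.
Qed.

Let cpE n := bilE (cp_bil HD n).

Definition t6 (X : six V V) (d : V) : six V V :=
  mk6 0 0 0 (cp D (-1) (six1 X) d) 0 (cp D (-1) (six2' X) d).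

Lemma lc6_tL x c d X u v : lc6 0 x X -> lc 1 c u -> lc 1 d v ->
  lc6 0 (tL D x c d) (t6 X v).
Proof.
case=> l0 l1 l1' l2 [l2' l3] lc_c lc_d.
rewrite /lc6 /tL /t6 !mk6E; (split; [| | | |split]).
all: eapply lc_eq; [lc_eval|].
all: by rewrite /= ?oppr0 ?addr0 ?add0r.
Qed.

Lemma lc6_nL x y z X Y Z : lc6 0 x X -> lc6 0 y Y -> lc6 0 z Z ->
  lc6 0 (nL D x y z) (t6 X (- cp D 1 (six1 Y) (six1 Z)) +
    \sum_(e : bool) \sum_(e' : bool) (-1) ^+ (e && e') *:
      t6 (par6 e' Y) (- cp D 1 (six1 (par6 e X)) (six1 Z))).
Proof.
move=> lx ly lz; have half x' y' z' X' Y' Z' : lc6 0 x' X' -> lc6 0 y' Y' -> lc6 0 z' Z' ->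
    lc6 0 (tL D x' (dot_c D y' z') (dot_cdc D y' z')) (t6 X' (- cp D 1 (six1 Y') (six1 Z'))).
  by move=> lx' ly' lz'; have [lcc lcd] := lc_dot ly' lz'; exact: lc6_tL lcc lcd.
rewrite /nL !big_bool; do ?[apply: lc6D|apply: lc6Z].
all: by apply: half => //; exact: lc6_par6.
Qed.

Lemma lc6_zmap a x (s : V) X : lc 0 a s -> lc6 0 x X -> lc6 1 (zmap D a x)
  (mk6 (cp D 0 s (six0 X)) (cp D 0 s (six1 X)) (cp D 0 s (six1' X))
       (cp D 0 s (six2 X)) (cp D 0 s (six2' X)) (cp D 0 s (six3 X))).
Proof.
move=> la [l0 l1 l1' l2 [l2' l3]].
rewrite /lc6 /zmap !mk6E; (split; [| | | |split]).
all: eapply lc_eq; [lc_eval|].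
all: by rewrite /= ?oppr0 ?addr0 ?add0r.
Qed.

Local Ltac gr_eval :=
  do ?[apply: (grD VD)|apply: (grN VD)|apply: (grZ VD)|exact: (gr0 VD)];
  apply: (vprod_weight VD); eauto.

Lemma muL_gr x y : six_gr gr x -> six_gr gr y -> six_gr gr (muL D x y).
Proof.
case=> g0 g1 g1' g2 [g2' g3] [k0 k1 k1' k2 [k2' k3]].
by rewrite /six_gr /muL !mk6E; (split; [| | | |split]); gr_eval.
Qed.

Lemma tL_gr x c d : six_gr gr x -> gr 0%N c -> gr 0%N d -> six_gr gr (tL D x c d).
Proof.
case=> g0 g1 g1' g2 [g2' g3] gc gd.
by rewrite /six_gr /tL !mk6E; (split; [| | | |split]); gr_eval.
Qed.

Lemma nL_gr x y z : six_gr gr x -> six_gr gr y -> six_gr gr z -> six_gr gr (nL D x y z).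
Proof.
move=> gx gy gz.
have z0 : six_gr gr 0 by rewrite mk60 /six_gr !mk6E; (split; [| | | |split]); exact: (gr0 VD).
have gD u v : six_gr gr u -> six_gr gr v -> six_gr gr (u + v).
  by move=> gu gv; have := six_gr_lin HD 1 gu gv; rewrite scale1r.
have gZ (c : K) u : six_gr gr u -> six_gr gr (c *: u).
  by move=> gu; have := six_gr_lin HD c gu z0; rewrite addr0.
have half u v w : six_gr gr u -> six_gr gr v -> six_gr gr w ->
    six_gr gr (tL D u (dot_c D v w) (dot_cdc D v w)).
  by move=> gu gv gw; have [] := dot_gr VD gv gw; exact: tL_gr.
rewrite /nL !big_bool; apply gD; first exact: half.
by apply gD; apply gD; apply: gZ; apply: half => //; exact: (par6_gr VD).
Qed.

Lemma zmap_gr a x : gr 1%N a -> six_gr gr x -> six_gr gr (- zmap D a x).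
Proof.
move=> ga [g0 g1 g1' g2 [g2' g3]].
by rewrite /six_gr /zmap mk6N !mk6E; (split; [| | | |split]); gr_eval.
Qed.

Let gv n (v : lw HD n) : Vgr n (lval v) := lval_gr v.

Lemma mu0_emb (x y : six V0 V1) : mu0 Vgr D (emb x) (emb y) = emb (mu6 (light HD) x y).
Proof.
have [gx gy] := (six_gr_h6 0 x, six_gr_h6 0 y).
rewrite /mu0 (lz_mu_embL char0 VD) //; apply: lead_lc6; first exact: muL_gr.
have := lc6_muL (lc6_h6 0 (val6 x)) (lc6_h6 0 (val6 y)).
congr lc6; rewrite /val6 /mu6 !mk6E !lvalE.
have mC (u v : lw HD 0) := cp_mulC char0 HD (gv u) (gv v).
have aC (u : lw HD 0) (a : lw HD 1) := cp_actC char0 HD (gv u) (gv a).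
have pC (a b : lw HD 1) := cp_prgC char0 HD (gv a) (gv b).
have nC (u : lw HD 0) (a : lw HD 1) := cp_ancN char0 HD (gv u) (gv a).
rewrite !aC !nC (mC (six1' x) (six0 y)) (mC (six2' x) (six0 y)) (mC (six3 x) (six0 y)).
by rewrite (mC (six2' x) (six1' y)) (pC (six2 x) (six1 y)).
Qed.

Lemma m0_emb (x y : six V0 V1) : m0 Vgr D (emb x) (emb y) = emb (m6 (light HD) x y).
Proof.
have [gx gy] := (six_gr_h6 0 x, six_gr_h6 0 y).
rewrite /m0 (lz_m_embL char0 VD) //; apply: lead_lc6.
  have [gc gd] := dot_gr VD gx gy.
  by rewrite /six_gr !mk6E; (split; [| | | |split]) => //; exact: (gr0 VD).
have [[hc _] ld] := lc_dot (lc6_h6 0 (val6 x)) (lc6_h6 0 (val6 y)).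
rewrite /lc6 /val6 /m6 !mk6E !lvalE; (split; [| | | |split]); try exact: lc_0.
  (* [dot_c] is O(h), whereas the component of ghost number 0 is read at h^0. *)
  by split; [exact: hpoly_le hc|exact: hc].
exact: ld.
Qed.

Lemma n0_emb (x y z : six V0 V1) :
  n0 Vgr D (emb x) (emb y) (emb z) = emb (n6 (light HD) x y z).
Proof.
have [[gx gy] gz] := (six_gr_h6 0 x, six_gr_h6 0 y, six_gr_h6 0 z).
rewrite /n0 (lz_n_embL char0 VD) //; apply: lead_lc6; first exact: nL_gr.
have := lc6_nL (lc6_h6 0 (val6 x)) (lc6_h6 0 (val6 y)) (lc6_h6 0 (val6 z)).
congr lc6; rewrite !sum_bool /t6 /par6 /val6 /n6 !mk6E !lvalE !cpE.
rewrite !mk6Z !mk6D.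
have mC (u v : lw HD 0) := cp_mulC char0 HD (gv u) (gv v).
have aC (u : lw HD 0) (a : lw HD 1) := cp_actC char0 HD (gv u) (gv a).
rewrite /= expr1 expr0 !scaleN1r !scale1r !oppr0 !addr0 !add0r opprK.
rewrite -!lval_prg !aC !(mC (six2' _)).
by apply: mk6_eq; rewrite // addrC.
Qed.

Lemma bracket0_emb (s : V) (x : six V0 V1) : Vgr 1%N s ->
  bracket0 Vgr D (st 0 s (st_c K)) (emb x) = emb (- zmap6 (light HD) (lmk HD 1 s) x).
Proof.
move=> sg; have ga : gr 1%N (laur 0 s) by exact: (laur_gr HD).
have gx := six_gr_h6 0 x.
rewrite /bracket0 (lz_bracket_embL char0 VD) // -(linE (@embL_lin K L)).1.2.
apply: lead_lc6; first exact: zmap_gr.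
have := lc6Z (-1) (lc6_zmap (lc_laur 0 s) (lc6_h6 0 (val6 x))).
by rewrite !scaleN1r; congr lc6; rewrite mk6N /zmap6 /val6 mk6N !mk6E !lvalE lmkK.
Qed.

Lemma brst_emb (x : six V0 V1) : brst D (emb x) = emb (Q6 (light HD) x).
Proof.
have gx := six_gr_h6 0 x; rewrite (brst_embL char0 VD) //; congr embL.
have gl n k (v : lw HD n) : gr n (laur k (lval v)) by exact: (laur_gr HD).
have dE i (u : V) : Lmode D (-1) (laur i u) = laur i (cd D u).
  by apply: laurentP => k; rewrite (Lm1E HD) !laurE (fun_if (cd D)) (linE (cd_lin HD)).
have vE' i (a : V1) : Lmode D 1 (laur i (lval a)) = laur (i + 1) (cdiv D (lval a)).
  apply: laurentP => k; rewrite (L1E HD); last exact: gl.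
  by rewrite !laurE subr_eq (fun_if (cdiv D)) (linE (cdiv_lin HD)).
have lE k := linE (@laur_lin K V k).
rewrite /QL /h6 /Q6 /val6 !mk6E !lvalE !dE !vE' ?oppr0 !addr0.
by apply: mk6_eq; rewrite ?lE.
Qed.
End LeadingOperations.

(** * Dependence on eta *)

Section DeformedOperations.
Variables (K : fieldType) (V0 V1 : lmodType K) (C : courant_data V0 V1).
Variables (N : nat) (s : 'I_N -> V1) (eta : 'M[K]_N).
Hypothesis HC : is_courant C.
Hypothesis Hs : is_isotropic C s.
Local Notation "u ** v" := (mul C u v) (at level 40, left associativity).
Local Notation "u *> a" := (act C u a) (at level 40).
Local Notation E := (esum eta).

Let cE := (bilE (mul_bil HC), bilE (act_bil HC), bilE (anc_bil HC),
  bilE (brk_bil HC), bilE (prg_bil HC)).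

Lemma esum_mk6 (F0 : 'I_N -> 'I_N -> V0) F1 F1' F2 F2' F3 :
  E (fun i j => mk6 (F0 i j) (F1 i j) (F1' i j) (F2 i j) (F2' i j) (F3 i j)) =
  mk6 (E F0) (E F1) (E F1') (E F2) (E F2') (E F3) :> six V0 V1.
Proof.
rewrite -[LHS]six_eta; apply: mk6_eq.
- by apply: (@esum_lin _ _ _ _ _ (@six0 K V0 V1)) => c x y; rewrite six_linE.
- by apply: (@esum_lin _ _ _ _ _ (@six1 K V0 V1)) => c x y; rewrite six_linE.
- by apply: (@esum_lin _ _ _ _ _ (@six1' K V0 V1)) => c x y; rewrite six_linE.
- by apply: (@esum_lin _ _ _ _ _ (@six2 K V0 V1)) => c x y; rewrite six_linE.
- by apply: (@esum_lin _ _ _ _ _ (@six2' K V0 V1)) => c x y; rewrite six_linE.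
- by apply: (@esum_lin _ _ _ _ _ (@six3 K V0 V1)) => c x y; rewrite six_linE.
Qed.

(** The link between [deformed] and R_0^eta. The minus sign is that of the bracket with an element
    of ghost number one, so the bracket with f_j acts as - [zmap6]. *)
Lemma Q6_deformed x : Q6 (deformed C s eta) x = Q6 C x +
  E (fun i j => mu6 C (mk6 0 (s i) 0 0 0 0) (- zmap6 C (s j) x)).
Proof.
pose nu i j : six V0 V1 :=
  mk6 0 (- (anc C (s j) (six0 x) *> s i)) (- anc C (s i) (anc C (s j) (six0 x)))
    (brk C (s i) (brk C (s j) (six1 x)) + - (anc C (s j) (six1' x) *> s i))
    (2^-1 *: prg C (s i) (brk C (s j) (six1 x)))
    (- (2^-1 *: prg C (s i) (brk C (s j) (six2 x)))
       + anc C (s i) (anc C (s j) (six2' x))).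
rewrite (@eq_esum _ _ _ _ _ nu) => [|i j]; last first.
  rewrite /mu6 /zmap6 mk6N !mk6E !cE /nu.
  by apply: mk6_eq; lmod_with K ltac:(first [ring | by field]).
rewrite /nu esum_mk6 /Q6 mk6D; apply: mk6_eq => /=.
- by rewrite esum0 addr0.
- by rewrite esumN.
- by rewrite esumN !(iso_lap0 Hs) oppr0 add0r.
- rewrite esumD esumN !(iso_lap1 Hs).
  by lmod_with K ltac:(first [ring | by field]).
- by rewrite esumZ; lmod_with K ltac:(first [ring | by field]).
- rewrite esumD esumN esumZ (iso_lap0 Hs).
  by lmod_with K ltac:(first [ring | by field]).
Qed.

Definition mu6_corr (x y : six V0 V1) i j : six V0 V1 :=
  mk6 0 0 (- (prg C (s i) (six1 x) ** anc C (s j) (six0 y)))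
    (prg C (brk C (s j) (six1 x)) (six1 y) *> s i
       - prg C (s i) (six1 y) *> brk C (s j) (six1 x)
       + prg C (s i) (six1 x) *> brk C (s j) (six1 y)) 0
    (prg C (s i) (six1 x) ** anc C (s j) (six2' y)
       + prg C (s i) (six1 y) ** anc C (s j) (six2' x)).

(** The anchor and the bracket are affine in eta and enter [mu6] linearly, so the deformed product
    has degree at most one in eta. *)
Lemma mu6_deformed x y :
  mu6 (deformed C s eta) x y = mu6 C x y + E (mu6_corr x y).
Proof.
rewrite /mu6_corr esum_mk6 /mu6 mk6D; apply: mk6_eq => /=; rewrite ?esum0 ?addr0 //.
- by rewrite esumN; lmod_with K ltac:(first [ring | by field]).
- by lmod_with K ltac:(first [ring | by field]).
- by rewrite esumD; lmod_with K ltac:(first [ring | by field]).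
Qed.
End DeformedOperations.

Lemma polynomial_in_affine (K : fieldType) (W : lmodType K) (N : nat)
    (g : 'M[K]_N -> W) (w0 : W) (w : 'I_N -> 'I_N -> W) :
  (forall eta, g eta = w0 + esum eta w) -> polynomial_in g.
Proof.
(* [a0] is the exponent of the monomial 1 and [a1 q] that of the entry of eta at q; exponents 0 and
   1 suffice, hence d = 1. *)
move=> gE; pose a0 : {ffun 'I_N * 'I_N -> 'I_2} := [ffun=> ord0].
pose a1 q : {ffun 'I_N * 'I_N -> 'I_2} := [ffun p => if p == q then ord_max else ord0].
exists 1%N, (fun alpha => (if alpha == a0 then w0 else 0)
  + \sum_q (if alpha == a1 q then w q.1 q.2 else 0)) => eta.
have pick a (v : W) (c : {ffun 'I_N * 'I_N -> 'I_2} -> K) :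
    \sum_alpha c alpha *: (if alpha == a then v else 0) = c a *: v.
  rewrite (bigD1 a) //= eqxx big1 ?addr0 // => alpha /negPf ->.
  by rewrite scaler0.
rewrite gE; under [RHS]eq_bigr do rewrite scalerDr scaler_sumr.
rewrite big_split pick /= exchange_big.
under [X in _ = _ + X]eq_bigr do rewrite pick.
congr (_ + _).
  by rewrite big1 ?scale1r // => p _; rewrite ffunE expr0.
rewrite /esum pair_bigA; apply: eq_bigr => q _; congr (_ *: _).
rewrite (bigD1 q) //= ffunE eqxx expr1 big1 ?mulr1 // => p /negPf pq.
by rewrite ffunE pq expr0.
Qed.

(** * The deformed operations on the complex *)

Section Conclusion.
Variables (K : fieldType) (V : lmodType K) (Vgr : nat -> set V).
Variable D : voa_data (laurent V).
Hypothesis char0 : forall n, n.+1%:R != 0 :> K.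
Hypothesis HD : voa_formal_parameter Vgr D.
Local Notation L := (laurent V).
Local Notation W := (gtens L).
Let two : 2 != 0 :> K := char0 1.
Local Notation V0 := (lw HD 0).
Local Notation V1 := (lw HD 1).

Lemma st_c_emb (a : V) : Vgr 1%N a ->
  st 0 a (st_c K) = emb (mk6 0 (lmk HD 1 a) 0 0 0 0 : six V0 V1).
Proof. by move=> ga; rewrite embE !mk6E lmkK // !lval0 !st0 !addr0 add0r. Qed.

Variables (N : nat) (s : 'I_N -> V).
Hypothesis sg : forall i, Vgr 1%N (s i).
Hypothesis s_primary : forall i, primary D 1 (laur 0 (s i)).
Hypothesis s_regular : forall i j, regular_ope D (laur 0 (s i)) (laur 0 (s j)).
Let s' i : V1 := lmk HD 1 (s i).
Let HC := light_courant char0 HD.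
Let Hs := light_isotropic char0 HD sg s_primary s_regular.

Lemma brst_eta_emb eta (x : six V0 V1) :
  brst_eta Vgr D s eta (emb x) = emb (Q6 (deformed (light HD) s' eta) x).
Proof.
rewrite (Q6_deformed _ HC Hs) (linE (@emb_lin K V Vgr D HD)).1.1.1.
rewrite (esum_lin _ _ (@emb_lin K V Vgr D HD)) /brst_eta (brst_emb char0); congr (_ + _).
apply: eq_bigr => i _; apply: eq_bigr => j _; congr (_ *: _).
by rewrite (bracket0_emb char0) // st_c_emb // (mu0_emb char0).
Qed.

(** The inverse of [emb] on the complex, with default 0 elsewhere; it extends operations on
    sextuples to maps on all of W. *)
Definition coord (x : W) : six V0 V1 := xget 0 [set t | x = emb t]%classic.

Lemma embK t : coord (emb t) = t.
Proof. by apply: xget_unique => // u /(emb_inj char0). Qed.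

Lemma light_deformation : exists mue me ne,
  [/\ deformation2 (Flight Vgr) (mu0 Vgr D) mue,
      deformation2 (Flight Vgr) (m0 Vgr D) me,
      deformation3 (Flight Vgr) (n0 Vgr D) ne &
      forall eta : 'M[K]_N,
      [/\ homotopy_assoc_comm (Fdeg Vgr) (Flight Vgr) (brst_eta Vgr D s eta)
            (mue eta) (me eta) (ne eta),
          forall x y, Flight Vgr x -> Flight Vgr y -> me eta x y = m0 Vgr D x y,
          forall x y z, Flight Vgr x -> Flight Vgr y -> Flight Vgr z ->
            ne eta x y z = n0 Vgr D x y z &
          ainfty3 (Fdeg Vgr) (Flight Vgr) (brst_eta Vgr D s eta)
            (mue eta) (ne eta)]].
Proof.
pose C eta := deformed (light HD) s' eta.
pose mue eta (x y : W) : W := emb (mu6 (C eta) (coord x) (coord y)).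
pose me (eta : 'M[K]_N) (x y : W) : W := emb (m6 (light HD) (coord x) (coord y)).
pose ne (eta : 'M[K]_N) (x y z : W) : W :=
  emb (n6 (light HD) (coord x) (coord y) (coord z)).
have esum0l (X : lmodType K) (F : 'I_N -> 'I_N -> X) : esum 0 F = 0.
  by rewrite /esum big1 // => i _; rewrite big1 // => j _; rewrite mxE scale0r.
have mE eta x y : Flight Vgr x -> Flight Vgr y -> me eta x y = m0 Vgr D x y.
  by move=> /(FlightE HD)[t ->] /(FlightE HD)[u ->]; rewrite /me !embK (m0_emb char0).
have nE eta x y z : Flight Vgr x -> Flight Vgr y -> Flight Vgr z ->
    ne eta x y z = n0 Vgr D x y z.
  move=> /(FlightE HD)[t ->] /(FlightE HD)[u ->] /(FlightE HD)[v ->].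
  by rewrite /ne !embK (n0_emb char0).
have const (w : W) : polynomial_in (fun _ : 'M[K]_N => w).
  apply: (@polynomial_in_affine _ _ _ _ w (fun _ _ => 0)) => eta.
  by rewrite esum0 addr0.
exists mue, me, ne; split.
- move=> _ _ /(FlightE HD)[t ->] /(FlightE HD)[u ->].
  have muE eta : mue eta (emb t) (emb u) = mu0 Vgr D (emb t) (emb u)
      + esum eta (fun i j => emb (mu6_corr (light HD) s' t u i j)).
    rewrite /mue !embK mu6_deformed (linE (@emb_lin K V Vgr D HD)).1.1.1.
    by rewrite (esum_lin _ _ (@emb_lin K V Vgr D HD)) (mu0_emb char0).
  split; first exact: polynomial_in_affine muE.
  by rewrite muE esum0l addr0.
- by move=> x y Fx Fy; split; [exact: const|exact: mE].
- by move=> x y z Fx Fy Fz; split; [exact: const|exact: nE].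
move=> eta; have HCe := deformed_courant eta two HC Hs.
have Qt t := brst_eta_emb eta t.
have mut t u : mue eta (emb t) (emb u) = emb (mu6 (C eta) t u) by rewrite /mue !embK.
(* The undeformed [m6] and [n6] serve for every eta: they involve only the pairing and the module
   structure, which [deformed] keeps, so both sides are convertible. *)
have mt t u : me eta (emb t) (emb u) = emb (m6 (C eta) t u) by rewrite /me !embK.
have nt t u v : ne eta (emb t) (emb u) (emb v) = emb (n6 (C eta) t u v).
  by rewrite /ne !embK.
split; [|exact: mE|exact: nE|].
- exact: transport_hac two HCe (@emb_lin K V Vgr D HD) (FdegE HD) (FlightE HD) Qt mut mt nt.
- exact: transport_ainfty two HCe (@emb_lin K V Vgr D HD) (FdegE HD) (FlightE HD) Qt mut nt.
Qed.
End Conclusion.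

Theorem theorem4p1 (R : realType) (V : lmodType R[i]) (Vgr : nat -> set V)
    (D : voa_data (laurent V)) (HD : voa_formal_parameter Vgr D)
    (N : nat) (s : 'I_N -> V)
    (s_primary : forall i, Vgr 1%N (s i) /\ primary D 1 (laur 0 (s i)))
    (s_regular : forall i j, regular_ope D (laur 0 (s i)) (laur 0 (s j))) :
  exists (mue me : 'M[R[i]]_N ->
            gtens (laurent V) -> gtens (laurent V) -> gtens (laurent V))
         (ne : 'M[R[i]]_N -> gtens (laurent V) -> gtens (laurent V) ->
            gtens (laurent V) -> gtens (laurent V)),
    [/\ deformation2 (Flight Vgr) (mu0 Vgr D) mue,
        deformation2 (Flight Vgr) (m0 Vgr D) me,
        deformation3 (Flight Vgr) (n0 Vgr D) ne &
        forall eta : 'M[R[i]]_N,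
        [/\ homotopy_assoc_comm (Fdeg Vgr) (Flight Vgr) (brst_eta Vgr D s eta)
              (mue eta) (me eta) (ne eta),
            forall x y, Flight Vgr x -> Flight Vgr y -> me eta x y = m0 Vgr D x y,
            forall x y z, Flight Vgr x -> Flight Vgr y -> Flight Vgr z ->
              ne eta x y z = n0 Vgr D x y z &
            ainfty3 (Fdeg Vgr) (Flight Vgr) (brst_eta Vgr D s eta)
              (mue eta) (ne eta)]].
Proof.
have char0 n : n.+1%:R != 0 :> R[i] by rewrite pnatr_eq0.
exact: (light_deformation char0 HD (fun i => (s_primary i).1) (fun i => (s_primary i).2) s_regular).
Qed.
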